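(* Let $\mathbb{H}=\{\tau\in\mathbb{C}:\operatorname{Im}\tau>0\}$. Suppose $f,g:\mathbb{H}\to\mathbb{C}$ are holomorphic and connected via the formula $$g(\tau)=\vartheta_{00}(\tau)^{-2\beta}f(\tau)$$ for some $\beta\in\mathbb{R}$. Then, if $g$ has a hyperbolic Fourier series expansion $$g(\tau)=\tilde a_0+g_1(\tau)+g_2(-1/\tau),\qquad g_1(\tau)=\sum_{n=1}^{\infty}\tilde a_n\,e^{i\pi n\tau},\quad g_2(\tau)=\sum_{n=1}^{\infty}\tilde b_n\,e^{i\pi n\tau},$$ it follows that $f$ has a power skewed expansion $$f(\tau)=a_0+f_1(\tau)+(\tau/i)^{-\beta}f_2(-1/\tau),\qquad f_1(\tau)=\sum_{n=1}^{\infty}a_n\,e^{i\pi n\tau},\quad f_2(\tau)=\sum_{n=1}^{\infty}b_n\,e^{i\pi n\tau},$$ and vice versa. Here, the coefficient sequences $a_n,b_n$ and $\tilde a_n,\tilde b_n$ meet the subexponential growth bound $$\forall\epsilon>0:\quad|a_n|,|b_n|=O(e^{\epsilon n})\quad\text{as }n\to+\infty$$ (respectively the same bound for $|\tilde a_n|,|\tilde b_n|$) simultaneously. Moreover, the relationship between the two expansions is given by $\tilde a_0=a_0$ and $$f_1(\tau)=\big(\vartheta_{00}(\tau)^{2\beta}-1\big)\tilde a_0+\vartheta_{00}(\tau)^{2\beta}g_1(\tau),\qquad f_2(\tau)=\vartheta_{00}(\tau)^{2\beta}g_2(\tau).$$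
   Context: $\vartheta_{00}(\tau)=\sum_{n\in\mathbb{Z}}e^{i\pi n^2\tau}$, $\tau\in\mathbb{H}$, is zero-free in $\mathbb{H}$ and $\vartheta_{00}(iy)>1$ for $y>0$; $\log\vartheta_{00}$ denotes the holomorphic logarithm on $\mathbb{H}$ which is positive on $i\mathbb{R}_{>0}$, and $\vartheta_{00}(\tau)^\gamma:=\exp(\gamma\log\vartheta_{00}(\tau))$ for $\gamma\in\mathbb{C}$. The power $(\tau/i)^{-\beta}=\exp(-\beta\log(\tau/i))$ uses the principal branch of the logarithm ($\tau/i$ has positive real part for $\tau\in\mathbb{H}$). The series $\sum_{n\ge1}c_ne^{i\pi n\tau}$ converges on $\mathbb{H}$ exactly when $c_n=O(e^{\epsilon n})$ for every $\epsilon>0$. *)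

(* Defs.v *)
From Stdlib Require Import Reals ZArith ClassicalEpsilon.
From Coquelicot Require Import Coquelicot.

(* Complex analysis over Coquelicot's [C]. A function on the upper half-plane
   is a total function [C -> C] whose values off the half-plane are never
   looked at. *)

Open Scope R_scope.
Open Scope C_scope.

Definition Cexp (z : C) : C :=
  (exp (Re z) * cos (Im z), exp (Re z) * sin (Im z))%R.

(* Principal argument, in (-PI, PI] for z <> 0. *)
Definition Carg (z : C) : R :=
  if Rle_dec 0 (Im z) then acos (Re z / Cmod z) else Ropp (acos (Re z / Cmod z)).

Definition Clog (z : C) : C := (ln (Cmod z), Carg z).

Definition Cpower (z s : C) : C := Cexp (s * Clog z).

(* Sum of a convergent complex series; unspecified when [u] is not summable. *)
Definition CSeries (u : nat -> C) : C :=
  (Series (fun n => Re (u n)), Series (fun n => Im (u n))).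

Definition CSeriesZ (u : Z -> C) : C :=
  CSeries (fun n => u (Z.of_nat n)) + CSeries (fun n => u (- Z.of_nat (S n))%Z).

Definition upper (tau : C) : Prop := (0 < Im tau)%R.

Definition holomorphic_upper (f : C -> C) : Prop :=
  forall tau : C, upper tau -> @ex_derive C_AbsRing C_NormedModule f tau.

Definition theta00 (tau : C) : C :=
  CSeriesZ (fun n => Cexp (Ci * RtoC PI * RtoC (IZR n) ^ 2 * tau)).

(* These conditions determine L on the upper half-plane: two logarithms of
   theta00 differ there by a constant multiple of 2 i PI, and both are real on
   the imaginary half-axis. *)
Definition is_log_theta00 (L : C -> C) : Prop :=
  holomorphic_upper L /\
  (forall tau : C, upper tau -> Cexp (L tau) = theta00 tau) /\
  (forall y : R, (0 < y)%R ->
     Im (L (Ci * RtoC y)) = 0%R /\ (0 < Re (L (Ci * RtoC y)%C))%R).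

Definition log_theta00 : C -> C :=
  epsilon (inhabits (fun _ : C => RtoC 0)) is_log_theta00.

Definition theta00_pow (gamma tau : C) : C := Cexp (gamma * log_theta00 tau).

(* Coefficient sequences are indexed from 1; the entry at 0 is ignored. *)
Definition fourier_term (c : nat -> C) (tau : C) (n : nat) : C :=
  c (S n) * Cexp (Ci * RtoC PI * RtoC (INR (S n)) * tau).

Definition fourier_cvg (c : nat -> C) : Prop :=
  forall tau : C, upper tau ->
    @ex_series C_AbsRing C_NormedModule (fourier_term c tau).

Definition fourier_sum (c : nat -> C) (tau : C) : C :=
  CSeries (fourier_term c tau).

Definition hyperbolic_expansion (g : C -> C) (a0 : C) (a b : nat -> C) : Prop :=
  fourier_cvg a /\ fourier_cvg b /\
  forall tau : C, upper tau ->
    g tau = a0 + fourier_sum a tau + fourier_sum b (- (1) / tau).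

Definition power_skewed_expansion
    (beta : R) (f : C -> C) (a0 : C) (a b : nat -> C) : Prop :=
  fourier_cvg a /\ fourier_cvg b /\
  forall tau : C, upper tau ->
    f tau = a0 + fourier_sum a tau
            + Cpower (tau / Ci) (RtoC (- beta)) * fourier_sum b (- (1) / tau).

Definition subexponential (c : nat -> C) : Prop :=
  forall eps : R, (0 < eps)%R ->
    exists K : R, eventually (fun n => (Cmod (c n) <= K * exp (eps * INR n))%R).

(* Tilde coefficients (prefix t) belong to the hyperbolic expansion. *)
Definition expansions_related
    (beta : R) (a0 : C) (a b : nat -> C) (ta0 : C) (ta tb : nat -> C) : Prop :=
  ta0 = a0 /\
  (forall tau : C, upper tau ->
     fourier_sum a tau =
       (theta00_pow (RtoC (2 * beta)) tau - 1) * ta0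
       + theta00_pow (RtoC (2 * beta)) tau * fourier_sum ta tau) /\
  (forall tau : C, upper tau ->
     fourier_sum b tau = theta00_pow (RtoC (2 * beta)) tau * fourier_sum tb tau).

(* Main.v *)
Require Import Defs.
From Stdlib Require Import Reals ZArith ClassicalEpsilon Lra Lia Psatz.
From Coquelicot Require Import Coquelicot.

(* Write q = exp(i pi tau).  Jacobi's triple product identifies theta00 with
   exp(L), where L is an explicit power series in q without constant term: a
   combination of logarithms phi(tau) of Euler products.  The derivative of phi
   is a Lambert series, hence by Lipschitz' formula an iterated sum of
   (m tau + n)^(-2); interchanging the two summations costs exactly pi i / tau,
   which gives d/dtau [2 (L(-1/tau) - L(tau))] = 1 / tau and therefore
   L(-1/tau) = L(tau) + log(tau / i) / 2.  Since exp(2 beta L) is a power series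
   in q of radius at least 1 and with constant term 1, multiplying by
   theta00^(2 beta) or by its inverse exchanges the two kinds of expansions. *)

(** The exponent [beta] is real, so the inversion is needed for a logarithm of theta00 and not only
    for its values: values determine the logarithm at -1 / tau up to multiples of 2 i PI, and a real
    power turns such a multiple into an unknown factor. The triple product supplies this logarithm:
    it shows at once that theta00 has no zeros and that its logarithm, hence every power, is a power
    series in q. The missing constant term of L is what preserves the constant of an expansion,
    hence [ta0 = a0]. The double series over (m, n) converges only conditionally; the exchange of
    its summations is controlled by a telescoping comparison series, both of whose iterated sums are
    explicit. No integration is used: analytic identities come from differentiating an expression
    that ought to be constant, and the branch of the logarithm is fixed by an intermediate value
    argument that starts at i, the fixed point of the inversion. *)

Open Scope R_scope.
Open Scope C_scope.

(** * Complex sequences and series *)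

(** Indices run below [n], so that the empty sum exists and sums split without case distinctions;
    [sum_n] includes its upper index, hence the shift in [sum_n_csum]. *)
Fixpoint csum (u : nat -> C) (n : nat) : C :=
  match n with O => 0 | S m => csum u m + u m end.

Fixpoint rsum (u : nat -> R) (n : nat) : R :=
  match n with O => 0%R | S m => (rsum u m + u m)%R end.

(** Componentwise, because [CSeries] is defined through real and imaginary parts; [Clim_mod] and
    [Clim_eps] pass to the modulus. *)
Definition Clim (u : nat -> C) (l : C) : Prop :=
  is_lim_seq (fun n => Re (u n)) (Re l) /\ is_lim_seq (fun n => Im (u n)) (Im l).

Definition csums (u : nat -> C) (l : C) : Prop := Clim (csum u) l.

(** For the nonnegative sequences to which this is applied, bounded partial sums amount to
    convergence, and a bound is all that domination arguments consume. *)
Definition rsummable (u : nat -> R) : Prop := exists B, forall n, (rsum u n <= B)%R.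

Definition abs_summable (u : nat -> C) : Prop := rsummable (fun n => Cmod (u n)).

Lemma C_ext (z w : C) : Re z = Re w -> Im z = Im w -> z = w.
Proof. destruct z, w; simpl; intros; subst; reflexivity. Qed.

Lemma Im_plus z w : Im (z + w) = (Im z + Im w)%R. Proof. reflexivity. Qed.
Lemma Re_minus z w : Re (z - w) = (Re z - Re w)%R. Proof. reflexivity. Qed.
Lemma Im_minus z w : Im (z - w) = (Im z - Im w)%R. Proof. reflexivity. Qed.
Lemma Re_mult z w : Re (z * w) = (Re z * Re w - Im z * Im w)%R. Proof. reflexivity. Qed.
Lemma Im_mult z w : Im (z * w) = (Re z * Im w + Im z * Re w)%R. Proof. reflexivity. Qed.

Lemma Im_le_Cmod z : (Rabs (Im z) <= Cmod z)%R.
Proof. apply Rle_trans with (2 := Rmax_Cmod z). apply Rmax_r. Qed.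

Lemma Cmod_le_ReIm z : (Cmod z <= Rabs (Re z) + Rabs (Im z))%R.
Proof.
  replace z with (RtoC (Re z) + Ci * RtoC (Im z)) at 1
    by (apply C_ext; simpl; ring).
  eapply Rle_trans; [apply Cmod_triangle|].
  rewrite Cmod_mult, Cmod_Ci, !Cmod_R. lra.
Qed.

Lemma Cmod_minus_sym z w : Cmod (z - w) = Cmod (w - z).
Proof. rewrite <- Cmod_opp. f_equal. ring. Qed.

Lemma Cmod_triangle_rev z w : (Cmod z - Cmod w <= Cmod (z + w))%R.
Proof.
  generalize (Cmod_triangle (z + w) (- w)). rewrite Cmod_opp.
  replace (z + w + - w) with z by ring. lra.
Qed.

Lemma Clim_mod u l : Clim u l <-> is_lim_seq (fun n => Cmod (u n - l)) 0.
Proof.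
  split.
  - intros [H1 H2].
    apply is_lim_seq_le_le with (fun _ => 0%R)
      (fun n => (Rabs (Re (u n) - Re l) + Rabs (Im (u n) - Im l))%R).
    + intros n; split; [apply Cmod_ge_0|]. apply Cmod_le_ReIm.
    + apply is_lim_seq_const.
    + replace (Finite 0) with (Finite (Rabs (Re l - Re l) + Rabs (Im l - Im l))%R)
        by (f_equal; rewrite !Rminus_diag, Rabs_R0; ring).
      apply is_lim_seq_plus';
        apply (is_lim_seq_abs _ (Finite _));
        (apply is_lim_seq_minus'; [assumption | apply is_lim_seq_const]).
  - intros H. split.
    + apply is_lim_seq_ext with (fun n => (Re (u n - l) + Re l)%R).
      { intros n. rewrite Re_minus. ring. }
      replace (Finite (Re l)) with (Finite (0 + Re l)%R) by (f_equal; ring).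
      apply is_lim_seq_plus'; [|apply is_lim_seq_const].
      apply is_lim_seq_abs_0.
      apply is_lim_seq_le_le with (fun _ => 0%R) (fun n => Cmod (u n - l)); trivial.
      * intros n; split; [apply Rabs_pos | apply re_le_Cmod].
      * apply is_lim_seq_const.
    + apply is_lim_seq_ext with (fun n => (Im (u n - l) + Im l)%R).
      { intros n. rewrite Im_minus. ring. }
      replace (Finite (Im l)) with (Finite (0 + Im l)%R) by (f_equal; ring).
      apply is_lim_seq_plus'; [|apply is_lim_seq_const].
      apply is_lim_seq_abs_0.
      apply is_lim_seq_le_le with (fun _ => 0%R) (fun n => Cmod (u n - l)); trivial.
      * intros n; split; [apply Rabs_pos | apply Im_le_Cmod].
      * apply is_lim_seq_const.
Qed.

Lemma Clim_eps u l :
  Clim u l <->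
  forall eps, (0 < eps)%R -> exists N, forall n, (N <= n)%nat -> (Cmod (u n - l) < eps)%R.
Proof.
  rewrite Clim_mod, <- is_lim_seq_spec. split.
  - intros H eps He. destruct (H (mkposreal eps He)) as [N HN].
    exists N; intros n Hn. specialize (HN n Hn). simpl in HN.
    rewrite Rminus_0_r, Rabs_pos_eq in HN; trivial. apply Cmod_ge_0.
  - intros H [eps He]. destruct (H eps He) as [N HN].
    exists N; intros n Hn. simpl. rewrite Rminus_0_r, Rabs_pos_eq by apply Cmod_ge_0. auto.
Qed.

Lemma Clim_unique u l m : Clim u l -> Clim u m -> l = m.
Proof.
  intros [H1 H2] [H3 H4].
  apply is_lim_seq_unique in H1; apply is_lim_seq_unique in H2.
  apply is_lim_seq_unique in H3; apply is_lim_seq_unique in H4.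
  apply C_ext; congruence.
Qed.

Lemma Clim_ext u v l : (forall n, u n = v n) -> Clim u l -> Clim v l.
Proof.
  intros E [H1 H2]; split; (eapply is_lim_seq_ext; [|eassumption]); intros n; simpl; now rewrite E.
Qed.

Lemma Clim_const l : Clim (fun _ => l) l.
Proof. split; apply is_lim_seq_const. Qed.

Lemma Clim_plus u v l m : Clim u l -> Clim v m -> Clim (fun n => u n + v n) (l + m).
Proof. intros [H1 H2] [H3 H4]; split; now apply is_lim_seq_plus'. Qed.

Lemma Clim_mult u v l m : Clim u l -> Clim v m -> Clim (fun n => u n * v n) (l * m).
Proof.
  intros [H1 H2] [H3 H4]; split; rewrite ?Re_mult, ?Im_mult.
  - apply is_lim_seq_minus'; now apply is_lim_seq_mult'.
  - apply is_lim_seq_plus'; now apply is_lim_seq_mult'.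
Qed.

Lemma Clim_scal a u l : Clim u l -> Clim (fun n => a * u n) (a * l).
Proof. intros H. apply Clim_mult; trivial. apply Clim_const. Qed.

Lemma Clim_opp u l : Clim u l -> Clim (fun n => - u n) (- l).
Proof.
  intros [H1 H2]; split; [exact (proj1 (is_lim_seq_opp _ (Finite _)) H1) |
                          exact (proj1 (is_lim_seq_opp _ (Finite _)) H2)].
Qed.

Lemma Clim_minus u v l m : Clim u l -> Clim v m -> Clim (fun n => u n - v n) (l - m).
Proof. intros; apply Clim_plus; trivial. now apply Clim_opp. Qed.

Lemma Clim_inv u l : Clim u l -> l <> 0 -> Clim (fun n => / u n) (/ l).
Proof.
  intros [H1 H2] Hl.
  assert (Hd : (Re l ^ 2 + Im l ^ 2)%R <> 0%R).
  { intros E. apply Hl, Cmod_eq_0. unfold Cmod.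
    unfold Re, Im in E. rewrite E. apply sqrt_0. }
  assert (Hp : is_lim_seq (fun n => (Re (u n) ^ 2 + Im (u n) ^ 2)%R) (Re l ^ 2 + Im l ^ 2)%R).
  { simpl. apply is_lim_seq_plus'; apply is_lim_seq_mult'; trivial;
      apply is_lim_seq_mult'; trivial; apply is_lim_seq_const. }
  split; simpl; unfold Rdiv; apply is_lim_seq_mult';
    try exact (proj1 (is_lim_seq_opp _ (Finite _)) H2); trivial.
  - apply (is_lim_seq_inv _ (Finite _)); [exact Hp|intros E; injection E; exact Hd].
  - apply (is_lim_seq_inv _ (Finite _)); [exact Hp|intros E; injection E; exact Hd].
Qed.

Lemma Clim_div u v l m : Clim u l -> Clim v m -> m <> 0 -> Clim (fun n => u n / v n) (l / m).
Proof. intros. apply Clim_mult; trivial. now apply Clim_inv. Qed.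

Lemma Clim_subseq u l (phi : nat -> nat) :
  (forall N, exists K, forall n, (K <= n)%nat -> (N <= phi n)%nat) ->
  Clim u l -> Clim (fun n => u (phi n)) l.
Proof.
  rewrite !Clim_eps. intros Hp H eps He. destruct (H eps He) as [N HN].
  destruct (Hp N) as [K HK]. exists K. auto.
Qed.

Lemma Clim_incr_1 u l : Clim (fun n => u (S n)) l <-> Clim u l.
Proof. unfold Clim. now rewrite <- (is_lim_seq_incr_1 (fun n => Re (u n))), <- (is_lim_seq_incr_1 (fun n => Im (u n))). Qed.

Lemma Clim_ext_ev u v l N : (forall n, (N <= n)%nat -> u n = v n) -> Clim u l -> Clim v l.
Proof.
  intros E [H1 H2]; split; (eapply is_lim_seq_ext_loc; [|eassumption]);
  exists N; intros n Hn; now rewrite E.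
Qed.

Lemma Clim_bound u l B : Clim u l -> (forall n, (Cmod (u n) <= B)%R) -> (Cmod l <= B)%R.
Proof.
  intros H Hb. apply Rnot_lt_le; intros Hlt.
  destruct (proj1 (Clim_eps u l) H (Cmod l - B)%R) as [N HN]; [lra|].
  specialize (HN N (Nat.le_refl _)). specialize (Hb N).
  rewrite Cmod_minus_sym in HN.
  generalize (Cmod_triangle (l - u N) (u N)).
  replace (l - u N + u N) with l by ring. lra.
Qed.

Lemma csum_ext u v n : (forall k, (k < n)%nat -> u k = v k) -> csum u n = csum v n.
Proof. induction n; simpl; intros H; trivial. rewrite IHn, H; auto. Qed.

Lemma csum_plus u v n : csum (fun k => u k + v k) n = csum u n + csum v n.
Proof. induction n; simpl; [ring|]. rewrite IHn; ring. Qed.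

Lemma csum_opp u n : csum (fun k => - u k) n = - csum u n.
Proof. induction n; simpl; [ring|]. rewrite IHn; ring. Qed.

Lemma csum_scal a u n : csum (fun k => a * u k) n = a * csum u n.
Proof. induction n; simpl; [ring|]. rewrite IHn; ring. Qed.

Lemma csum_zero n : csum (fun _ => 0) n = 0.
Proof. induction n; simpl; trivial. rewrite IHn; ring. Qed.

Lemma csum_add u m n : csum u (m + n) = csum u m + csum (fun k => u (m + k)%nat) n.
Proof.
  induction n; simpl; [rewrite Nat.add_0_r; ring|].
  rewrite Nat.add_succ_r; simpl. rewrite IHn; ring.
Qed.

Lemma csum_S_l u n : csum u (S n) = u O + csum (fun k => u (S k)) n.
Proof. change (S n) with (1 + n)%nat. rewrite csum_add; simpl; ring. Qed.

Lemma csum_swap (u : nat -> nat -> C) m n :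
  csum (fun j => csum (u j) n) m = csum (fun k => csum (fun j => u j k) m) n.
Proof.
  induction m; simpl; [now rewrite csum_zero|]. now rewrite IHm, <- csum_plus.
Qed.

Lemma csum_Re u n : Re (csum u n) = rsum (fun k => Re (u k)) n.
Proof. induction n; simpl; trivial. now rewrite <- IHn. Qed.

Lemma csum_Im u n : Im (csum u n) = rsum (fun k => Im (u k)) n.
Proof. induction n; simpl; trivial. now rewrite <- IHn. Qed.

Lemma rsum_ext u v n : (forall k, (k < n)%nat -> u k = v k) -> rsum u n = rsum v n.
Proof. induction n; simpl; intros H; trivial. rewrite IHn, H; auto. Qed.

Lemma rsum_le u v n : (forall k, (k < n)%nat -> (u k <= v k)%R) -> (rsum u n <= rsum v n)%R.
Proof. induction n; simpl; intros H; [lra|]. apply Rplus_le_compat; auto. Qed.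

Lemma rsum_scal a u n : rsum (fun k => (a * u k)%R) n = (a * rsum u n)%R.
Proof. induction n; simpl; [ring|]. rewrite IHn; ring. Qed.

Lemma rsum_pos u n : (forall k, (0 <= u k)%R) -> (0 <= rsum u n)%R.
Proof. induction n; simpl; intros H; [lra|]. generalize (H n) (IHn H). lra. Qed.

Lemma rsum_const a n : rsum (fun _ => a) n = (INR n * a)%R.
Proof. induction n; [simpl; ring|]. rewrite S_INR; simpl rsum. rewrite IHn; ring. Qed.

Lemma rsum_mono u m n : (forall k, (0 <= u k)%R) -> (m <= n)%nat -> (rsum u m <= rsum u n)%R.
Proof. intros H; induction 1; [lra|]. simpl. generalize (H m0). lra. Qed.

Lemma Cmod_csum u n : (Cmod (csum u n) <= rsum (fun k => Cmod (u k)) n)%R.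
Proof.
  induction n; simpl; [rewrite Cmod_0; lra|].
  eapply Rle_trans; [apply Cmod_triangle|]. lra.
Qed.

Lemma sum_n_csum (u : nat -> C) n : @sum_n C_AbelianMonoid u n = csum u (S n).
Proof.
  induction n; [rewrite sum_O; simpl; ring|].
  rewrite sum_Sn, IHn. reflexivity.
Qed.

Lemma sum_n_rsum (u : nat -> R) n : sum_n u n = rsum u (S n).
Proof.
  induction n; [rewrite sum_O; simpl; ring|].
  rewrite sum_Sn, IHn. reflexivity.
Qed.

Lemma csums_CSeries u l : csums u l -> CSeries u = l.
Proof.
  intros H. apply Clim_incr_1 in H. destruct H as [H1 H2].
  unfold CSeries. apply C_ext; simpl; apply is_series_unique.
  - refine (is_lim_seq_ext _ _ (Finite _) _ H1).
    intros n. now rewrite sum_n_rsum, csum_Re.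
  - refine (is_lim_seq_ext _ _ (Finite _) _ H2).
    intros n. now rewrite sum_n_rsum, csum_Im.
Qed.

(** Translation between the filter convergence behind [fourier_cvg] and the concrete limits used
    here. *)
Lemma is_series_csums (u : nat -> C) (l : C) :
  @is_series C_AbsRing C_NormedModule u l <-> csums u l.
Proof.
  unfold csums. rewrite <- Clim_incr_1, Clim_eps.
  split.
  - intros H eps He.
    assert (Hb : locally (T := C_NormedModule) l (fun z => (Cmod (z - l) < eps)%R)).
    { apply (locally_le_locally_norm (V := C_NormedModule)).
      exists (mkposreal eps He). intros y Hy. exact Hy. }
    destruct (H _ Hb) as [N HN]. exists N. intros n Hn.
    rewrite <- sum_n_csum. apply (HN n Hn).
  - intros H P HP. apply (locally_norm_le_locally (V := C_NormedModule)) in HP.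
    destruct HP as [eps HP]. destruct (H eps (cond_pos eps)) as [N HN].
    exists N. intros n Hn. apply HP.
    unfold ball_norm. change (Cmod (@sum_n C_AbelianMonoid u n - l) < eps)%R.
    rewrite sum_n_csum. auto.
Qed.

(** Some partial sum comes within [eps] of the supremum, and the supremum bounds all the others. *)
Lemma rsummable_tail u : (forall k, (0 <= u k)%R) -> rsummable u ->
  forall eps, (0 < eps)%R -> exists K, forall n, (rsum u n <= rsum u K + eps)%R.
Proof.
  intros Hu [B HB] eps He.
  destruct (completeness (fun x => exists n, x = rsum u n)) as [s [Hs1 Hs2]].
  - exists B. intros x [n ->]. apply HB.
  - exists 0%R, O. reflexivity.
  - destruct (excluded_middle_informative (exists K, (s - eps < rsum u K)%R)) as [[K HK]|Hn].
    + exists K. intros n. assert (rsum u n <= s)%R by (apply Hs1; eauto). lra.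
    + exfalso. assert (s <= s - eps)%R; [|lra]. apply Hs2. intros x [n ->].
      apply Rnot_lt_le. intros H. apply Hn. eauto.
Qed.

Lemma csum_tail_bound (u : nat -> C) K n :
  (K <= n)%nat ->
  (Cmod (csum u n - csum u K) <= rsum (fun k => Cmod (u k)) n - rsum (fun k => Cmod (u k)) K)%R.
Proof.
  induction 1.
  - replace (csum u K - csum u K) with (RtoC 0) by ring. rewrite Cmod_0. lra.
  - simpl. replace (csum u m + u m - csum u K) with ((csum u m - csum u K) + u m) by ring.
    eapply Rle_trans; [apply Cmod_triangle|]. lra.
Qed.

Lemma abs_summable_csums u : abs_summable u -> csums u (CSeries u).
Proof.
  intros H.
  assert (HC : forall eps, (0 < eps)%R -> exists K, forall m n,
     (K <= m)%nat -> (K <= n)%nat -> (Cmod (csum u n - csum u m) < eps)%R).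
  { intros eps He.
    destruct (rsummable_tail _ (fun k => Cmod_ge_0 (u k)) H (eps / 3)%R) as [K HK]; [lra|].
    exists K. intros m n Hm Hn.
    replace (csum u n - csum u m) with ((csum u n - csum u K) + - (csum u m - csum u K)) by ring.
    eapply Rle_lt_trans; [apply Cmod_triangle|]. rewrite Cmod_opp.
    generalize (csum_tail_bound u K n Hn) (csum_tail_bound u K m Hm) (HK n) (HK m). lra. }
  assert (exists l, csums u l) as [l Hl].
  { assert (H1 : ex_finite_lim_seq (fun n => Re (csum u n))).
    { apply ex_lim_seq_cauchy_corr. intros [eps He]. destruct (HC eps He) as [K HK].
      exists K. intros n m Hn Hm. eapply Rle_lt_trans; [|apply (HK m n Hm Hn)].
      apply (re_le_Cmod (csum u n - csum u m)). }
    assert (H2 : ex_finite_lim_seq (fun n => Im (csum u n))).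
    { apply ex_lim_seq_cauchy_corr. intros [eps He]. destruct (HC eps He) as [K HK].
      exists K. intros n m Hn Hm. eapply Rle_lt_trans; [|apply (HK m n Hm Hn)].
      apply (Im_le_Cmod (csum u n - csum u m)). }
    destruct H1 as [a Ha], H2 as [b Hb]. exists (a, b). split; assumption. }
  now rewrite (csums_CSeries _ _ Hl).
Qed.

Lemma rsummable_le u v : (forall k, (u k <= v k)%R) -> rsummable v -> rsummable u.
Proof. intros H [B HB]. exists B. intros n. eapply Rle_trans; [apply rsum_le|apply HB]. auto. Qed.

Lemma abs_summable_le u v : (forall k, (Cmod (u k) <= v k)%R) -> rsummable v -> abs_summable u.
Proof. intros H Hv. now apply rsummable_le with v. Qed.

Lemma rsummable_scal a u : (0 <= a)%R -> rsummable u -> rsummable (fun k => (a * u k)%R).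
Proof.
  intros Ha [B HB]. exists (a * B)%R. intros n. rewrite rsum_scal. now apply Rmult_le_compat_l.
Qed.

Lemma rsummable_geom r : (0 <= r < 1)%R -> rsummable (fun n => (r ^ n)%R).
Proof.
  intros Hr. exists (/ (1 - r))%R. intros n.
  assert (E : rsum (fun k => (r ^ k)%R) n = ((1 - r ^ n) / (1 - r))%R).
  { induction n; simpl rsum; [simpl; field; lra|]. rewrite IHn. simpl. field. lra. }
  rewrite E. unfold Rdiv. rewrite <- (Rmult_1_l (/ (1 - r))) at 2.
  apply Rmult_le_compat_r; [left; apply Rinv_0_lt_compat; lra|].
  generalize (pow_le r n (proj1 Hr)). lra.
Qed.

Lemma CSeries_bound u v B :
  (forall k, (Cmod (u k) <= v k)%R) -> (forall n, (rsum v n <= B)%R) -> (Cmod (CSeries u) <= B)%R.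
Proof.
  intros H HB. apply Clim_bound with (csum u).
  - apply abs_summable_csums. apply abs_summable_le with v; trivial. now exists B.
  - intros n. eapply Rle_trans; [apply Cmod_csum|]. eapply Rle_trans; [apply rsum_le|apply HB]. auto.
Qed.

Lemma csums_ext u v l : (forall n, u n = v n) -> csums u l -> csums v l.
Proof. intros E. apply Clim_ext. intros n. apply csum_ext. auto. Qed.

Lemma CSeries_ext u v : (forall n, u n = v n) -> CSeries u = CSeries v.
Proof. intros E. unfold CSeries. f_equal; apply Series_ext; intros; now rewrite E. Qed.

Lemma csums_plus u v l m : csums u l -> csums v m -> csums (fun k => u k + v k) (l + m).
Proof.
  intros H1 H2. apply Clim_ext with (fun n => csum u n + csum v n).
  - intros; now rewrite csum_plus.
  - now apply Clim_plus.
Qed.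

Lemma csums_scal a u l : csums u l -> csums (fun k => a * u k) (a * l).
Proof.
  intros H1. apply Clim_ext with (fun n => a * csum u n).
  - intros; now rewrite csum_scal.
  - now apply Clim_scal.
Qed.

Lemma csums_opp u l : csums u l -> csums (fun k => - u k) (- l).
Proof.
  intros H1. apply Clim_ext with (fun n => - csum u n).
  - intros; now rewrite csum_opp.
  - now apply Clim_opp.
Qed.

Lemma csums_minus u v l m : csums u l -> csums v m -> csums (fun k => u k - v k) (l - m).
Proof. intros; apply csums_plus; trivial. now apply csums_opp. Qed.

Lemma csums_finite (u : nat -> C) N : (forall k, (N <= k)%nat -> u k = 0) -> csums u (csum u N).
Proof.
  intros H. apply Clim_ext_ev with (fun _ => csum u N) N; [|apply Clim_const].
  intros n Hn. induction Hn; trivial. simpl. rewrite <- IHHn, H by lia. ring.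
Qed.

Lemma csums_S u l : csums (fun k => u (S k)) l <-> csums u (u O + l).
Proof.
  split; intros H.
  - apply Clim_incr_1. apply Clim_ext with (fun n => u O + csum (fun k => u (S k)) n).
    + intros n; now rewrite csum_S_l.
    + apply Clim_plus; trivial. apply Clim_const.
  - apply Clim_incr_1 in H. replace l with (- u O + (u O + l)) by ring.
    apply Clim_ext with (fun n => - u O + csum u (S n)).
    + intros n; rewrite csum_S_l. ring.
    + apply Clim_plus; trivial. apply Clim_const.
Qed.

Lemma csums_term_0 u l : csums u l -> Clim u 0.
Proof.
  intros H. apply Clim_ext with (fun n => csum u (S n) - csum u n); [intros; simpl; ring|].
  replace (RtoC 0) with (l - l) by ring. apply Clim_minus; trivial. now apply Clim_incr_1.
Qed.

(** Dominated convergence for series: one index [K] makes the tails of all [a N] and of [b] at most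
    [eps / 4], and the head converges as a finite sum. Fubini, the triple product and both Lipschitz
    formulas rest on it. *)
Lemma tannery (a : nat -> nat -> C) (b : nat -> C) (M : nat -> R) :
  (forall N k, (Cmod (a N k) <= M k)%R) -> rsummable M ->
  (forall k, Clim (fun N => a N k) (b k)) ->
  abs_summable b /\ Clim (fun N => CSeries (a N)) (CSeries b).
Proof.
  intros Hb HM Hl.
  assert (HM0 : forall k, (0 <= M k)%R).
  { intros k. eapply Rle_trans; [apply Cmod_ge_0|apply (Hb O k)]. }
  assert (Hbb : forall k, (Cmod (b k) <= M k)%R).
  { intros k. apply Clim_bound with (1 := Hl k). auto. }
  assert (Hsb : abs_summable b) by now apply abs_summable_le with M.
  split; trivial.
  apply Clim_eps. intros eps He.
  destruct (rsummable_tail M HM0 HM (eps / 4)%R) as [K HK]; [lra|].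
  assert (HT : forall u, (forall k, (Cmod (u k) <= M k)%R) ->
             (Cmod (CSeries u - csum u K) <= eps / 4)%R).
  { intros u Hu.
    apply Clim_bound with (fun n => csum u (K + n)%nat - csum u K).
    - apply Clim_minus; [|apply Clim_const].
      apply Clim_subseq with (phi := fun n => (K + n)%nat).
      + intros N. exists N. lia.
      + apply abs_summable_csums. now apply abs_summable_le with M.
    - intros n. rewrite csum_add.
      replace (csum u K + csum (fun k => u (K + k)%nat) n - csum u K)
        with (csum (fun k => u (K + k)%nat) n) by ring.
      eapply Rle_trans; [apply Cmod_csum|].
      assert (E : (rsum M (K + n) = rsum M K + rsum (fun k => M (K + k)%nat) n)%R).
      { clear. induction n; simpl; [rewrite Nat.add_0_r; ring|].
        rewrite Nat.add_succ_r; simpl. rewrite IHn; ring. }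
      generalize (HK (K + n)%nat). rewrite E. intros.
      eapply Rle_trans; [apply rsum_le with (v := fun k => M (K + k)%nat); auto|lra]. }
  assert (Hf : Clim (fun N => csum (a N) K) (csum b K)).
  { clear -Hl. induction K; simpl; [apply Clim_const|]. apply Clim_plus; auto. }
  destruct (proj1 (Clim_eps _ _) Hf (eps / 4)%R) as [N0 HN0]; [lra|].
  exists N0. intros N HN.
  replace (CSeries (a N) - CSeries b) with
    ((CSeries (a N) - csum (a N) K) + ((csum (a N) K - csum b K) + - (CSeries b - csum b K))) by ring.
  eapply Rle_lt_trans; [apply Cmod_triangle|].
  eapply Rle_lt_trans; [apply Rplus_le_compat_l, Cmod_triangle|].
  rewrite Cmod_opp.
  generalize (HT (a N) (Hb N)) (HT b Hbb) (HN0 N HN). lra.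
Qed.

Lemma csum_CSeries (a : nat -> nat -> C) m :
  (forall j, abs_summable (a j)) ->
  csums (fun k => csum (fun j => a j k) m) (csum (fun j => CSeries (a j)) m).
Proof.
  intros H. induction m; simpl.
  - replace (RtoC 0) with (csum (fun _ : nat => RtoC 0) 0) by reflexivity.
    apply csums_finite. auto.
  - apply csums_plus; trivial. now apply abs_summable_csums.
Qed.

(** A majorant of product form [u j * v k] is available in every application and makes rows, columns
    and both iterated sums absolutely summable at once. The equality is Tannery's theorem for the
    partial sums over [j]. *)
Lemma fubini (a : nat -> nat -> C) (u v : nat -> R) :
  (forall j k, (Cmod (a j k) <= u j * v k)%R) -> (forall j, (0 <= u j)%R) -> (forall j, (0 <= v j)%R) ->
  rsummable u -> rsummable v ->
  (forall j, abs_summable (a j)) /\ (forall k, abs_summable (fun j => a j k)) /\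
  abs_summable (fun j => CSeries (a j)) /\ abs_summable (fun k => CSeries (fun j => a j k)) /\
  CSeries (fun j => CSeries (a j)) = CSeries (fun k => CSeries (fun j => a j k)).
Proof.
  intros Ha Hu Hv Su Sv.
  assert (H1 : forall j, abs_summable (a j)).
  { intros j. apply abs_summable_le with (fun k => (u j * v k)%R); auto. apply rsummable_scal; auto. }
  assert (H2 : forall k, abs_summable (fun j => a j k)).
  { intros k. apply abs_summable_le with (fun j => (v k * u j)%R).
    - intros j; rewrite Rmult_comm; auto.
    - apply rsummable_scal; auto. }
  destruct Su as [U HU], Sv as [V HV].
  assert (H3 : abs_summable (fun j => CSeries (a j))).
  { apply abs_summable_le with (fun j => (V * u j)%R).
    - intros j. apply CSeries_bound with (fun k => (u j * v k)%R); auto.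
      intros n. rewrite rsum_scal, Rmult_comm. apply Rmult_le_compat_r; auto.
    - apply rsummable_scal; [|now exists U].
      specialize (HV O). simpl in HV. trivial. }
  assert (HUU : forall k n, (rsum (fun j => Cmod (a j k)) n <= U * v k)%R).
  { intros k n. eapply Rle_trans; [apply rsum_le with (v := fun j => (v k * u j)%R)|].
    - intros; rewrite Rmult_comm; auto.
    - rewrite rsum_scal, Rmult_comm. apply Rmult_le_compat_r; auto. }
  destruct (tannery (fun m k => csum (fun j => a j k) m) (fun k => CSeries (fun j => a j k))
              (fun k => (U * v k)%R)) as [H4 H5].
  - intros N k. eapply Rle_trans; [apply Cmod_csum|]. apply HUU.
  - apply rsummable_scal; [|now exists V]. specialize (HU O). simpl in HU. trivial.
  - intros k. now apply (abs_summable_csums (fun j => a j k)).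
  - do 4 (split; trivial).
    apply Clim_unique with (csum (fun j => CSeries (a j))).
    + now apply (abs_summable_csums (fun j => CSeries (a j))).
    + apply Clim_ext with (2 := H5). intros m. apply csums_CSeries. now apply csum_CSeries.
Qed.

(** Zeros put in front of [v] turn the rows of a Cauchy product into sequences with a common
    index. *)
Definition delay (j : nat) (v : nat -> C) (n : nat) : C :=
  if (j <=? n)%nat then v (n - j)%nat else 0.

Lemma csums_delay j v l : csums v l -> csums (delay j v) l.
Proof.
  intros H. apply Clim_ext with (fun n => csum v (n - j)%nat).
  - intros n. induction n; trivial. simpl csum at 2. rewrite <- IHn. unfold delay.
    destruct (Nat.leb_spec j n).
    + replace (S n - j)%nat with (S (n - j)) by lia. reflexivity.
    + replace (S n - j)%nat with O by lia. replace (n - j)%nat with O by lia. simpl; ring.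
  - apply Clim_subseq with (phi := fun n => (n - j)%nat); trivial.
    intros N. exists (N + j)%nat. lia.
Qed.

(** If [v] is the coefficient sequence of f(x), this is the one of f(x^k). *)
Definition spread (k : nat) (v : nat -> C) (n : nat) : C :=
  if (n mod k =? 0)%nat then v (n / k)%nat else 0.

Lemma csums_spread k v l : (0 < k)%nat -> csums v l -> csums (spread k v) l.
Proof.
  (* The quotient [(n + (k - 1)) / k] is the ceiling of n / k, that is, the number of multiples of
     [k] below [n] and so the number of entries of [v] met so far. *)
  intros Hk H. apply Clim_ext with (fun n => csum v ((n + (k - 1)) / k)%nat).
  - intros n. induction n.
    + simpl. rewrite Nat.div_small by lia. reflexivity.
    + simpl csum at 2. rewrite <- IHn. unfold spread.
      pose proof (Nat.div_mod n k ltac:(lia)) as E.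
      pose proof (Nat.mod_upper_bound n k ltac:(lia)) as E2.
      set (d := (n / k)%nat) in *. set (r := (n mod k)%nat) in *.
      destruct (Nat.eqb_spec r 0) as [Hr|Hr].
      * replace ((S n + (k - 1)) / k)%nat with (S d).
        2:{ apply Nat.div_unique with O; nia. }
        replace ((n + (k - 1)) / k)%nat with d.
        2:{ apply Nat.div_unique with (k - 1)%nat; nia. }
        reflexivity.
      * replace ((S n + (k - 1)) / k)%nat with (S d).
        2:{ apply Nat.div_unique with r; nia. }
        replace ((n + (k - 1)) / k)%nat with (S d).
        2:{ apply Nat.div_unique with (r - 1)%nat; nia. }
        ring.
  - apply Clim_subseq with (phi := fun n => ((n + (k - 1)) / k)%nat); trivial.
    intros N. exists (N * k)%nat. intros n Hn.
    apply Nat.div_le_lower_bound; lia.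
Qed.

(** * Complex derivatives and the exponential *)

Definition Cder (f : C -> C) (z l : C) : Prop :=
  @is_derive C_AbsRing C_NormedModule f z l.

Lemma Cder_eps f z l :
  Cder f z l <->
  forall eps, (0 < eps)%R -> exists d, (0 < d)%R /\ forall w, (Cmod (w - z) < d)%R ->
    (Cmod (f w - f z - (w - z) * l) <= eps * Cmod (w - z))%R.
Proof.
  split.
  - intros [_ H] eps He.
    specialize (H z (fun P HP => HP) (mkposreal eps He)).
    destruct H as [[d Hd] H]. exists d. split; [exact Hd|].
    intros w Hw. apply (H w). exact Hw.
  - intros H. split; [apply is_linear_scal_l|].
    intros x Hx. apply (is_filter_lim_locally_unique (V := AbsRing_NormedModule C_AbsRing)) in Hx.
    subst x. intros [eps He]. destruct (H eps He) as [d [Hd Hw]].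
    exists (mkposreal d Hd). intros w Hb. apply Hw. exact Hb.
Qed.

(* The two canonical normed modules on C are not convertible. *)
Lemma Cder_AbsRing f z l :
  Cder f z l <-> @is_derive C_AbsRing (AbsRing_NormedModule C_AbsRing) f z l.
Proof. split; intros [_ H]; (split; [apply is_linear_scal_l|exact H]). Qed.

(** The inverse, the exponential and power series all come with an explicit quadratic remainder, so
    this criterion replaces separate limit arguments. *)
Lemma Cder_quad f z l K d : (0 < d)%R -> (0 <= K)%R ->
  (forall w, (Cmod (w - z) < d)%R ->
     (Cmod (f w - f z - (w - z) * l) <= K * (Cmod (w - z) * Cmod (w - z)))%R) ->
  Cder f z l.
Proof.
  intros Hd HK H. apply Cder_eps. intros eps He.
  exists (Rmin d (eps / (K + 1)))%R. split.
  - apply Rmin_pos; trivial. apply Rdiv_lt_0_compat; lra.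
  - intros w Hw. eapply Rle_trans; [apply H, Rlt_le_trans with (1 := Hw), Rmin_l|].
    assert (Hw2 : (Cmod (w - z) < eps / (K + 1))%R)
      by (eapply Rlt_le_trans; [apply Hw|apply Rmin_r]).
    generalize (Cmod_ge_0 (w - z)). intros H0.
    rewrite <- Rmult_assoc. apply Rmult_le_compat_r; trivial.
    apply Rle_trans with ((K + 1) * (eps / (K + 1)))%R; [|right; field; lra].
    apply Rmult_le_compat; lra.
Qed.

Lemma Cder_const a z : Cder (fun _ => a) z 0.
Proof. apply @is_derive_const. Qed.

Lemma Cder_id z : Cder (fun w => w) z 1.
Proof. apply Cder_AbsRing. exact (@is_derive_id C_AbsRing z). Qed.

Lemma Cder_plus f g z l m : Cder f z l -> Cder g z m -> Cder (fun w => f w + g w) z (l + m).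
Proof. apply @is_derive_plus. Qed.

Lemma Cder_opp f z l : Cder f z l -> Cder (fun w => - f w) z (- l).
Proof. apply @is_derive_opp. Qed.

Lemma Cder_minus f g z l m : Cder f z l -> Cder g z m -> Cder (fun w => f w - g w) z (l - m).
Proof. apply @is_derive_minus. Qed.

Lemma Cder_comp f g z l m : Cder f (g z) l -> Cder g z m -> Cder (fun w => f (g w)) z (m * l).
Proof. rewrite (Cder_AbsRing g). exact (@is_derive_comp C_AbsRing C_NormedModule f g z l m). Qed.

Lemma Cder_mult f g z l m : Cder f z l -> Cder g z m ->
  Cder (fun w => f w * g w) z (l * g z + f z * m).
Proof.
  rewrite !Cder_AbsRing. intros H1 H2.
  apply (@is_derive_mult C_AbsRing f g z l m H1 H2). exact Cmult_comm.
Qed.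

Lemma Cder_scal a f z l : Cder f z l -> Cder (fun w => a * f w) z (a * l).
Proof.
  intros H. replace (a * l) with (0 * f z + a * l) by ring.
  apply Cder_mult; trivial. apply Cder_const.
Qed.

Lemma Cder_eq f z l m : l = m -> Cder f z l -> Cder f z m.
Proof. now intros ->. Qed.

Lemma Cder_ext_loc f g z l d : (0 < d)%R -> (forall w, (Cmod (w - z) < d)%R -> f w = g w) ->
  Cder f z l -> Cder g z l.
Proof.
  intros Hd He. rewrite !Cder_eps. intros H eps Heps. destruct (H eps Heps) as [d' [Hd' H']].
  exists (Rmin d d'). split; [now apply Rmin_pos|]. intros w Hw.
  rewrite <- He, <- He.
  - apply H'. eapply Rlt_le_trans; [apply Hw|apply Rmin_r].
  - replace (z - z) with (RtoC 0) by ring. now rewrite Cmod_0.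
  - eapply Rlt_le_trans; [apply Hw|apply Rmin_l].
Qed.

Lemma Cder_unique f z l m : Cder f z l -> Cder f z m -> l = m.
Proof.
  intros H1 H2. apply is_C_derive_unique in H1. apply is_C_derive_unique in H2. congruence.
Qed.

Lemma Cder_inv (z : C) : z <> 0 -> Cder (fun w => / w) z (- / (z * z)).
Proof.
  intros Hz. assert (Hm : (0 < Cmod z)%R) by now apply Cmod_gt_0.
  (* The remainder is exactly (w - z)^2 / (w z^2), and |w| > |z| / 2 on the disc of radius |z| / 2;
     hence the constant 2 / |z|^3. *)
  apply Cder_quad with (2 / (Cmod z * (Cmod z * Cmod z)))%R (Cmod z / 2)%R; [lra| |].
  - left. apply Rdiv_lt_0_compat; [lra|]. repeat apply Rmult_lt_0_compat; trivial.
  - intros w Hw.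
    assert (Hw2 : (Cmod z / 2 < Cmod w)%R).
    { generalize (Cmod_triangle_rev z (w - z)). replace (z + (w - z)) with w by ring. lra. }
    assert (Hw0 : w <> 0) by (apply Cmod_gt_0; lra).
    replace (/ w - / z - (w - z) * - / (z * z)) with ((w - z) * (w - z) * / (w * (z * z)))
      by (field; auto).
    rewrite !Cmod_mult, Cmod_inv, !Cmod_mult by (repeat apply Cmult_neq_0; trivial).
    rewrite Rmult_comm. apply Rmult_le_compat_r.
    + apply Rmult_le_pos; apply Cmod_ge_0.
    + assert (0 < Cmod z * Cmod z)%R by now apply Rmult_lt_0_compat.
      replace (2 / (Cmod z * (Cmod z * Cmod z)))%R with (/ (Cmod z / 2 * (Cmod z * Cmod z)))%R
        by (field; lra).
      apply Rinv_le_contravar.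
      * apply Rmult_lt_0_compat; lra.
      * apply Rmult_le_compat_r; lra.
Qed.

(* Restriction to a real line reduces constancy and intermediate-value arguments to R. *)
Lemma Cder_line f a h t l : Cder f (a + RtoC t * h) l ->
  derivable_pt_lim (fun s => Re (f (a + RtoC s * h))) t (Re (h * l)) /\
  derivable_pt_lim (fun s => Im (f (a + RtoC s * h))) t (Im (h * l)).
Proof.
  rewrite Cder_eps. intros H.
  assert (HH : forall eps, (0 < eps)%R -> exists d : posreal, forall s, s <> 0%R -> (Rabs s < d)%R ->
    (Cmod ((f (a + RtoC (t + s)%R * h)%C - f (a + RtoC t * h)%C) / RtoC s - h * l)%C < eps)%R).
  { intros eps He. set (k := (Cmod h + 1)%R).
    assert (Hk : (0 < k)%R) by (unfold k; generalize (Cmod_ge_0 h); lra).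
    destruct (H (eps / 2 / k)%R) as [d [Hd Hw]].
    { repeat apply Rdiv_lt_0_compat; lra. }
    exists (mkposreal (d / k) (Rdiv_lt_0_compat _ _ Hd Hk)). simpl. intros s Hs Hsd.
    specialize (Hw (a + RtoC (t + s)%R * h)).
    replace (a + RtoC (t + s)%R * h - (a + RtoC t * h)) with (RtoC s * h) in Hw
      by (rewrite RtoC_plus; ring).
    assert (Hsp : (0 < Rabs s)%R) by now apply Rabs_pos_lt.
    assert (Hs0 : RtoC s <> 0) by (intros E; apply Hs; now injection E).
    rewrite Cmod_mult, Cmod_R in Hw.
    assert (Rabs s * Cmod h < d)%R.
    { apply Rle_lt_trans with (Rabs s * k)%R.
      - apply Rmult_le_compat_l; unfold k; lra.
      - apply Rlt_le_trans with (d / k * k)%R; [now apply Rmult_lt_compat_r|right; field; lra]. }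
    specialize (Hw H0).
    replace ((f (a + RtoC (t + s)%R * h) - f (a + RtoC t * h)) / RtoC s - h * l) with
      ((f (a + RtoC (t + s)%R * h) - f (a + RtoC t * h) - RtoC s * h * l) / RtoC s) by (field; auto).
    rewrite Cmod_div, Cmod_R by trivial.
    apply Rle_lt_trans with (eps / 2)%R; [|lra].
    apply Rmult_le_reg_r with (Rabs s); trivial.
    unfold Rdiv at 1. rewrite Rmult_assoc, Rinv_l, Rmult_1_r by lra.
    eapply Rle_trans; [apply Hw|].
    replace (eps / 2 / k * (Rabs s * Cmod h))%R with (eps / 2 * Rabs s * (Cmod h / k))%R
      by (field; lra).
    rewrite <- (Rmult_1_r (eps / 2 * Rabs s)) at 2.
    apply Rmult_le_compat_l; [apply Rmult_le_pos; lra|].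
    apply Rmult_le_reg_r with k; trivial.
    unfold Rdiv. rewrite Rmult_assoc, Rinv_l by lra. unfold k. lra. }
  split; intros eps He; destruct (HH eps He) as [d Hd]; exists d; intros s Hs Hsd;
    specialize (Hd s Hs Hsd); eapply Rle_lt_trans; [|exact Hd| |exact Hd].
  - eapply Rle_trans; [|apply re_le_Cmod]. right. f_equal.
    rewrite Re_minus. f_equal. unfold Cdiv. rewrite <- RtoC_inv by trivial.
    rewrite re_scal_r, Re_minus. reflexivity.
  - eapply Rle_trans; [|apply Im_le_Cmod]. right. f_equal.
    rewrite Im_minus. f_equal. unfold Cdiv. rewrite <- RtoC_inv by trivial.
    rewrite im_scal_r, Im_minus. reflexivity.
Qed.

Definition convex (D : C -> Prop) : Prop :=
  forall a b t, D a -> D b -> (0 <= t <= 1)%R -> D (a + RtoC t * (b - a)).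

(** The only source of global identities: an expression that ought to be constant is differentiated
    and then evaluated at a base point, 0 in the disc or i in the half-plane. Convexity reduces
    constancy to a segment. *)
Lemma Cder_zero_const D f : convex D -> (forall z, D z -> Cder f z 0) ->
  forall a b, D a -> D b -> f a = f b.
Proof.
  intros HD Hf a b Ha Hb.
  assert (H : forall t, (0 <= t <= 1)%R ->
     is_derive (fun s => Re (f (a + RtoC s * (b - a)))) t zero /\
     is_derive (fun s => Im (f (a + RtoC s * (b - a)))) t zero).
  { intros t Ht. destruct (Cder_line f a (b - a) t 0) as [H1 H2]; [apply Hf; auto|].
    rewrite Cmult_0_r in H1, H2. split; now apply is_derive_Reals. }
  assert (E0 : a + RtoC 0 * (b - a) = a) by ring.
  assert (E1 : a + RtoC 1 * (b - a) = b) by ring.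
  apply C_ext.
  - generalize (eq_is_derive _ 0 1 (fun t Ht => proj1 (H t Ht)) Rlt_0_1). simpl.
    now rewrite E0, E1.
  - generalize (eq_is_derive _ 0 1 (fun t Ht => proj2 (H t Ht)) Rlt_0_1). simpl.
    now rewrite E0, E1.
Qed.

Lemma convex_upper : convex upper.
Proof.
  intros a b t Ha Hb Ht. unfold upper in *.
  rewrite Im_plus, im_scal_l, Im_minus. destruct (Req_dec t 1) as [->|H]; [lra|].
  assert (0 < (1 - t) * Im a)%R by (apply Rmult_lt_0_compat; lra).
  assert (0 <= t * Im b)%R by (apply Rmult_le_pos; lra). lra.
Qed.

Definition unit_disc (z : C) : Prop := (Cmod z < 1)%R.

Lemma convex_unit_disc : convex unit_disc.
Proof.
  intros a b t Ha Hb Ht. unfold unit_disc in *.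
  replace (a + RtoC t * (b - a)) with (RtoC (1 - t)%R * a + RtoC t * b)
    by (rewrite RtoC_minus; ring).
  eapply Rle_lt_trans; [apply Cmod_triangle|].
  rewrite !Cmod_mult, !Cmod_R, !Rabs_pos_eq by lra.
  destruct (Req_dec t 1) as [->|H]; [lra|].
  assert ((1 - t) * Cmod a < (1 - t) * 1)%R by (apply Rmult_lt_compat_l; lra).
  assert (t * Cmod b <= t * 1)%R by (apply Rmult_le_compat_l; lra). lra.
Qed.

(** * The complex exponential, with elementary bounds for exp, sin and cos *)

Lemma Cexp_add z w : Cexp (z + w) = Cexp z * Cexp w.
Proof.
  unfold Cexp. apply C_ext; simpl; rewrite exp_plus, ?cos_plus, ?sin_plus; unfold Re, Im; ring.
Qed.

Lemma Cexp_0 : Cexp 0 = 1.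
Proof. unfold Cexp; simpl. rewrite exp_0, cos_0, sin_0. apply C_ext; simpl; ring. Qed.

Lemma Cexp_R (x : R) : Cexp (RtoC x) = RtoC (exp x).
Proof. unfold Cexp; simpl. rewrite cos_0, sin_0. apply C_ext; simpl; ring. Qed.

Lemma Cmod_Cexp z : Cmod (Cexp z) = exp (Re z).
Proof.
  unfold Cexp, Cmod; simpl fst; simpl snd.
  replace ((exp (Re z) * cos (Im z)) ^ 2 + (exp (Re z) * sin (Im z)) ^ 2)%R with
    (Rsqr (exp (Re z)) * (Rsqr (sin (Im z)) + Rsqr (cos (Im z))))%R by (unfold Rsqr; ring).
  rewrite sin2_cos2, Rmult_1_r. apply sqrt_Rsqr. left; apply exp_pos.
Qed.

Lemma Cexp_neq_0 z : Cexp z <> 0.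
Proof. apply Cmod_gt_0. rewrite Cmod_Cexp. apply exp_pos. Qed.

Lemma Cexp_opp z : Cexp (- z) = / Cexp z.
Proof.
  assert (H := Cexp_neq_0 z).
  assert (E : Cexp z * Cexp (- z) = 1)
    by (rewrite <- Cexp_add, <- Cexp_0; f_equal; ring).
  replace (Cexp (- z)) with (/ Cexp z * (Cexp z * Cexp (- z))) by (field; trivial).
  rewrite E; ring.
Qed.

Lemma Cexp_minus z w : Cexp (z - w) = Cexp z / Cexp w.
Proof. unfold Cminus. now rewrite Cexp_add, Cexp_opp. Qed.

Lemma Cexp_INR (n : nat) z : Cexp (RtoC (INR n) * z) = Cexp z ^ n.
Proof.
  induction n.
  - simpl. rewrite Cmult_0_l. apply Cexp_0.
  - rewrite S_INR, RtoC_plus, Cpow_S, <- IHn, <- Cexp_add. f_equal. ring.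
Qed.

(** Applied at [a] and at [- a], the inequality 1 + x <= exp x squeezes exp a - 1 - a between 0 and
    a^2 / (1 - a), and 1 - a >= 1 / 2. *)
Lemma exp_quad (a : R) : (Rabs a <= 1 / 2 -> Rabs (exp a - 1 - a) <= 2 * (a * a))%R.
Proof.
  intros Ha. apply Rabs_le_between in Ha.
  assert (H1 := exp_ineq1_le a). assert (H2 := exp_ineq1_le (- a)).
  rewrite exp_Ropp in H2. assert (H3 := exp_pos a).
  assert (H4 : (exp a * (1 - a) <= 1)%R).
  { apply Rmult_le_reg_l with (/ exp a)%R; [now apply Rinv_0_lt_compat|].
    rewrite <- Rmult_assoc, Rinv_l by lra. lra. }
  rewrite Rabs_pos_eq by lra. nra.
Qed.

Lemma Rabs_sin_le (u : R) : (Rabs (sin u) <= Rabs u)%R.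
Proof.
  assert (Hp : forall v, (0 <= v -> v <= 1 -> Rabs (sin v) <= v)%R).
  { intros v H0 H1. rewrite Rabs_pos_eq.
    - destruct H0 as [H0|<-]; [left; now apply sin_lt_x|rewrite sin_0; lra].
    - apply sin_ge_0; generalize PI2_1; lra. }
  destruct (Rle_dec (Rabs u) 1) as [Hu|Hu].
  - apply Rabs_le_between in Hu. destruct (Rle_dec 0 u).
    + rewrite (Rabs_pos_eq u) by trivial. apply Hp; lra.
    + rewrite <- (Rabs_Ropp (sin u)), <- sin_neg, <- (Rabs_Ropp u), (Rabs_pos_eq (- u)) by lra.
      apply Hp; lra.
  - apply Rle_trans with 1%R; [|lra]. apply Rabs_le. apply SIN_bound.
Qed.

Lemma cos_quad (b : R) : (Rabs (cos b - 1) <= b * b / 2)%R.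
Proof.
  assert (E : (cos b - 1 = - (2 * (sin (b / 2) * sin (b / 2))))%R).
  { replace b with (2 * (b / 2))%R at 1 by field. rewrite cos_2a_sin. ring. }
  rewrite E, Rabs_Ropp, Rabs_mult, Rabs_mult, (Rabs_pos_eq 2) by lra.
  assert (H := Rabs_sin_le (b / 2)).
  assert (Hb : (Rabs (b / 2) * Rabs (b / 2) = b * b / 4)%R).
  { rewrite <- Rabs_mult, Rabs_pos_eq by nra. field. }
  generalize (Rabs_pos (sin (b / 2))) (Rabs_pos (b / 2)). nra.
Qed.

Lemma sin_quad (b : R) : (Rabs b <= 1 -> Rabs (sin b - b) <= b * b)%R.
Proof.
  intros Hb.
  assert (Hs : (Rabs (sin b - b - (sin 0 - 0)) <= Rabs b * Rabs (b - 0))%R).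
  { apply (bounded_variation (fun t => (sin t - t)%R) (fun t => (cos t - 1)%R)).
    intros t Ht. rewrite !Rminus_0_r in Ht. split.
    - auto_derive; trivial. ring.
    - eapply Rle_trans; [apply cos_quad|].
      rewrite <- (Rabs_pos_eq (t * t)) by nra. rewrite Rabs_mult.
      generalize (Rabs_pos t). nra. }
  rewrite sin_0, !Rminus_0_r in Hs. rewrite <- Rabs_mult in Hs.
  rewrite (Rabs_pos_eq (b * b)) in Hs by nra. exact Hs.
Qed.

(** A weak form of Jordan's inequality, whose sharp slope is 2 / PI. Up to 1 it follows from |cos x
    - 1| <= 1 / 2; beyond 1, monotonicity suffices because t / 4 <= PI / 8 <= 1 / 2 <= sin 1. It
    will separate roots of unity from 1. *)
Lemma sin_lower (t : R) : (0 <= t <= PI / 2 -> t / 4 <= sin t)%R.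
Proof.
  intros Ht.
  assert (Hsmall : forall s, (0 <= s <= 1 -> s / 2 <= sin s)%R).
  { intros s Hs.
    assert (H : (Rabs (sin s - s - (sin 0 - 0)) <= 1 / 2 * Rabs (s - 0))%R).
    { apply (bounded_variation (fun t => (sin t - t)%R) (fun t => (cos t - 1)%R)).
      intros x Hx. rewrite !Rminus_0_r in Hx. split.
      - auto_derive; trivial. ring.
      - eapply Rle_trans; [apply cos_quad|].
        rewrite (Rabs_pos_eq s) in Hx by lra. apply Rabs_le_between in Hx. nra. }
    rewrite sin_0, !Rminus_0_r, (Rabs_pos_eq s) in H by lra. apply Rabs_le_between in H. lra. }
  destruct (Rle_dec t 1) as [H|H].
  - generalize (Hsmall t). lra.
  - assert (sin 1 <= sin t)%R by (apply sin_incr_1; lra).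
    generalize (Hsmall 1%R) PI_4. lra.
Qed.

(** With h = a + i b, the real part splits into (e^a - 1 - a) + e^a (cos b - 1) and the imaginary
    part into (e^a - 1 - a) b + a b + e^a (sin b - b). The five pieces add up to 9 |h|^2, so the
    constant 20 is generous. *)
Lemma Cexp_quad h : (Cmod h <= 1 / 2 -> Cmod (Cexp h - 1 - h) <= 20 * (Cmod h * Cmod h))%R.
Proof.
  intros Hh. set (a := Re h). set (b := Im h).
  assert (Ha : (Rabs a <= Cmod h)%R) by apply re_le_Cmod.
  assert (Hb : (Rabs b <= Cmod h)%R) by apply Im_le_Cmod.
  assert (Haa : (a * a <= Cmod h * Cmod h)%R).
  { rewrite <- (Rabs_pos_eq (a * a)) by nra. rewrite Rabs_mult.
    apply Rmult_le_compat; trivial; apply Rabs_pos. }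
  assert (Hbb : (b * b <= Cmod h * Cmod h)%R).
  { rewrite <- (Rabs_pos_eq (b * b)) by nra. rewrite Rabs_mult.
    apply Rmult_le_compat; trivial; apply Rabs_pos. }
  set (m := (Cmod h * Cmod h)%R) in *.
  assert (He : (Rabs (exp a - 1 - a) <= 2 * (a * a))%R) by (apply exp_quad; lra).
  assert (Hs : (Rabs (sin b - b) <= b * b)%R) by (apply sin_quad; lra).
  assert (Hc := cos_quad b). assert (Hbb0 : (0 <= b * b)%R) by nra.
  assert (He2 : (exp a <= 2)%R).
  { apply Rabs_le_between in He. assert (Rabs a <= 1/2)%R by lra. apply Rabs_le_between in H. nra. }
  assert (H0 := exp_pos a).
  eapply Rle_trans; [apply Cmod_le_ReIm|].
  replace (Re (Cexp h - 1 - h)) with ((exp a - 1 - a) + exp a * (cos b - 1))%R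
    by (unfold a, b, Cexp; rewrite !Re_minus; simpl; unfold Re; ring).
  replace (Im (Cexp h - 1 - h)) with ((exp a - 1 - a) * b + a * b + exp a * (sin b - b))%R
    by (unfold a, b, Cexp; rewrite !Im_minus; simpl; unfold Re, Im; ring).
  assert (R1 : (Rabs (exp a * (cos b - 1)) <= 2 * m)%R).
  { rewrite Rabs_mult, (Rabs_pos_eq (exp a)) by lra.
    apply Rmult_le_compat; try lra. apply Rabs_pos. }
  assert (R2 : (Rabs (exp a * (sin b - b)) <= 2 * m)%R).
  { rewrite Rabs_mult, (Rabs_pos_eq (exp a)) by lra.
    apply Rmult_le_compat; try lra. apply Rabs_pos. }
  assert (R3 : (Rabs (a * b) <= m)%R).
  { rewrite Rabs_mult. apply Rmult_le_compat; trivial; apply Rabs_pos. }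
  assert (R4 : (Rabs ((exp a - 1 - a) * b) <= 2 * m)%R).
  { rewrite Rabs_mult. replace (2 * m)%R with (2 * m * 1)%R by ring.
    apply Rmult_le_compat; try lra; apply Rabs_pos. }
  generalize (Rabs_triang (exp a - 1 - a) (exp a * (cos b - 1))).
  generalize (Rabs_triang ((exp a - 1 - a) * b + a * b) (exp a * (sin b - b))).
  generalize (Rabs_triang ((exp a - 1 - a) * b) (a * b)).
  assert (0 <= m)%R by (unfold m; generalize (Cmod_ge_0 h); nra).
  intros; lra.
Qed.

Lemma Cder_Cexp z : Cder Cexp z (Cexp z).
Proof.
  apply Cder_quad with (20 * Cmod (Cexp z))%R (1 / 2)%R; [lra| |].
  - generalize (Cmod_ge_0 (Cexp z)). lra.
  - intros w Hw. replace w with (z + (w - z)) at 1 by ring.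
    rewrite Cexp_add.
    replace (Cexp z * Cexp (w - z) - Cexp z - (w - z) * Cexp z) with
      (Cexp z * (Cexp (w - z) - 1 - (w - z))) by ring.
    rewrite Cmod_mult. rewrite (Rmult_comm 20), Rmult_assoc.
    apply Rmult_le_compat_l; [apply Cmod_ge_0|]. apply Cexp_quad. lra.
Qed.

Lemma Cder_Cexp_comp f z l : Cder f z l -> Cder (fun w => Cexp (f w)) z (l * Cexp (f z)).
Proof. intros H. apply Cder_comp; trivial. apply Cder_Cexp. Qed.

Lemma Clim_Cexp u l : Clim u l -> Clim (fun n => Cexp (u n)) (Cexp l).
Proof.
  intros [H1 H2].
  assert (He : is_lim_seq (fun n => exp (Re (u n))) (exp (Re l))).
  { apply (is_lim_seq_continuous exp); trivial.
    apply derivable_continuous_pt, derivable_pt_exp. }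
  assert (Hc : is_lim_seq (fun n => cos (Im (u n))) (cos (Im l))).
  { apply (is_lim_seq_continuous cos); trivial.
    apply derivable_continuous_pt, derivable_pt_cos. }
  assert (Hs : is_lim_seq (fun n => sin (Im (u n))) (sin (Im l))).
  { apply (is_lim_seq_continuous sin); trivial.
    apply derivable_continuous_pt, derivable_pt_sin. }
  split; now apply is_lim_seq_mult'.
Qed.

(** * Power series in the unit disc *)

(** Radius of convergence at least 1 in the form of Abel's lemma: bounded terms on every smaller
    circle. This is easier to propagate through products and exponentials than convergence
    itself. *)
Definition radius1 (c : nat -> C) : Prop :=
  forall r, (0 < r < 1)%R -> exists K, forall n, (Cmod (c n) * r ^ n <= K)%R.

Definition PS (c : nat -> C) (q : C) : C := CSeries (fun n => c n * q ^ n).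

(** Boundedness on the circle whose radius [r] lies halfway between |q| and 1 becomes geometric
    decay with ratio |q| / r. *)
Lemma radius1_geom c q : radius1 c -> unit_disc q ->
  exists K rho, (0 <= K)%R /\ (0 <= rho < 1)%R /\ forall n, (Cmod (c n * q ^ n) <= K * rho ^ n)%R.
Proof.
  intros Hc Hq. unfold unit_disc in Hq. assert (H0 := Cmod_ge_0 q).
  set (r := ((1 + Cmod q) / 2)%R).
  assert (Hr : (0 < r < 1)%R) by (unfold r; lra).
  destruct (Hc r Hr) as [K HK]. exists K, (Cmod q / r)%R.
  assert (HK0 : (0 <= K)%R).
  { apply Rle_trans with (2 := HK O). apply Rmult_le_pos; [apply Cmod_ge_0|simpl; lra]. }
  repeat split; trivial.
  - apply (Rle_div_r 0); lra.
  - apply Rlt_div_l; unfold r; lra.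
  - intros n. rewrite Cmod_mult, Cmod_pow.
    replace (Cmod q ^ n)%R with (r ^ n * (Cmod q / r) ^ n)%R.
    2:{ rewrite <- Rpow_mult_distr. f_equal. field. lra. }
    rewrite <- Rmult_assoc. apply Rmult_le_compat_r; trivial.
    apply pow_le. apply (Rle_div_r 0); lra.
Qed.

Lemma PS_abs c q : radius1 c -> unit_disc q -> abs_summable (fun n => c n * q ^ n).
Proof.
  intros Hc Hq. destruct (radius1_geom c q Hc Hq) as (K & rho & HK & Hr & H).
  apply abs_summable_le with (fun n => (K * rho ^ n)%R); trivial.
  apply rsummable_scal; trivial. now apply rsummable_geom.
Qed.

Lemma PS_csums c q : radius1 c -> unit_disc q -> csums (fun n => c n * q ^ n) (PS c q).
Proof. intros. apply abs_summable_csums. now apply PS_abs. Qed.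

Lemma PS_ext c d q : (forall n, c n = d n) -> PS c q = PS d q.
Proof. intros H. apply CSeries_ext. intros n. now rewrite H. Qed.

Lemma PS_0 c : PS c 0 = c O.
Proof.
  apply csums_CSeries. replace (c O) with (csum (fun n => c n * 0 ^ n) 1) by (simpl; ring).
  apply csums_finite. intros [|k] H; [lia|]. rewrite Cpow_S. ring.
Qed.

Lemma unit_disc_0 : unit_disc 0.
Proof. unfold unit_disc. rewrite Cmod_0. lra. Qed.

Lemma unit_disc_pow q n : (0 < n)%nat -> unit_disc q -> unit_disc (q ^ n).
Proof.
  intros Hn Hq. unfold unit_disc in *. rewrite Cmod_pow.
  destruct n; [lia|]. clear Hn. assert (H0 := Cmod_ge_0 q).
  induction n; simpl in *; [lra|].
  apply Rle_lt_trans with (Cmod q * 1)%R; [|lra]. apply Rmult_le_compat_l; trivial. lra.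
Qed.

Lemma radius1_plus c d : radius1 c -> radius1 d -> radius1 (fun n => c n + d n).
Proof.
  intros Hc Hd r Hr. destruct (Hc r Hr) as [K HK], (Hd r Hr) as [L HL]. exists (K + L)%R.
  intros n. eapply Rle_trans; [|apply Rplus_le_compat; [apply HK|apply HL]].
  rewrite <- Rmult_plus_distr_r. apply Rmult_le_compat_r; [apply pow_le; lra|].
  apply Cmod_triangle.
Qed.

Lemma radius1_scal a c : radius1 c -> radius1 (fun n => a * c n).
Proof.
  intros Hc r Hr. destruct (Hc r Hr) as [K HK]. exists (Cmod a * K)%R.
  intros n. rewrite Cmod_mult, Rmult_assoc. apply Rmult_le_compat_l; [apply Cmod_ge_0|auto].
Qed.

Lemma PS_plus c d q : radius1 c -> radius1 d -> unit_disc q ->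
  PS (fun n => c n + d n) q = PS c q + PS d q.
Proof.
  intros. apply csums_CSeries.
  apply csums_ext with (fun n => c n * q ^ n + d n * q ^ n); [intros; ring|].
  apply csums_plus; now apply PS_csums.
Qed.

Lemma PS_scal a c q : radius1 c -> unit_disc q -> PS (fun n => a * c n) q = a * PS c q.
Proof.
  intros. apply csums_CSeries.
  apply csums_ext with (fun n => a * (c n * q ^ n)); [intros; ring|].
  apply csums_scal; now apply PS_csums.
Qed.

(** Bernoulli's inequality for (1 / s)^n with 1 / s = 1 + d. Differentiation and convolution cost a
    factor n + 1, which is absorbed in this way by a slightly larger radius. *)
Lemma linear_geom_bound s : (0 < s < 1)%R -> exists K, forall n, (INR (S n) * s ^ n <= K)%R.
Proof.
  intros Hs. set (d := (/ s - 1)%R).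
  assert (Hi : (1 < / s)%R) by (rewrite <- Rinv_1; apply Rinv_lt_contravar; lra).
  assert (Hd : (0 < d)%R) by (unfold d; lra).
  exists (1 + / d)%R. intros n.
  assert (Hp : (1 + INR n * d <= (/ s) ^ n)%R).
  { replace (/ s)%R with (1 + d)%R by (unfold d; ring). now apply poly. }
  assert (Hsn : (0 < s ^ n)%R) by (apply pow_lt; lra).
  assert (E : ((/ s) ^ n * s ^ n = 1)%R) by (rewrite <- Rpow_mult_distr, Rinv_l, pow1; lra).
  assert (H1 : ((1 + INR n * d) * s ^ n <= 1)%R)
    by (rewrite <- E; apply Rmult_le_compat_r; lra).
  assert (Hid : (0 < / d)%R) by now apply Rinv_0_lt_compat.
  rewrite S_INR.
  assert (0 <= INR n)%R by apply pos_INR.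
  assert (H2 : (INR n + 1 <= (1 + / d) * (1 + INR n * d))%R).
  { replace ((1 + / d) * (1 + INR n * d))%R with (1 + INR n * d + / d + INR n)%R by (field; lra).
    assert (0 <= INR n * d)%R by (apply Rmult_le_pos; lra). lra. }
  apply Rle_trans with ((1 + / d) * ((1 + INR n * d) * s ^ n))%R.
  - rewrite <- Rmult_assoc. apply Rmult_le_compat_r; lra.
  - rewrite <- (Rmult_1_r (1 + / d)) at 2. apply Rmult_le_compat_l; lra.
Qed.

Lemma radius1_linear_le c d A : (0 <= A)%R -> radius1 c ->
  (forall n r s K, (0 < r < s)%R -> (s < 1)%R -> (forall m, (Cmod (c m) * s ^ m <= K)%R) ->
     (Cmod (d n) * s ^ n <= A * INR (S n) * K)%R) -> radius1 d.
Proof.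
  intros HA Hc H r Hr. set (s := ((1 + r) / 2)%R).
  assert (Hs : (0 < s < 1)%R) by (unfold s; lra).
  destruct (Hc s Hs) as [K HK].
  destruct (linear_geom_bound (r / s)) as [L HL].
  { split; [apply Rdiv_lt_0_compat; lra|]. apply Rlt_div_l; unfold s; lra. }
  assert (HK0 : (0 <= K)%R).
  { apply Rle_trans with (2 := HK O). apply Rmult_le_pos; [apply Cmod_ge_0|simpl; lra]. }
  exists (A * K * L)%R. intros n.
  replace (r ^ n)%R with (s ^ n * (r / s) ^ n)%R.
  2:{ rewrite <- Rpow_mult_distr. f_equal. field. lra. }
  rewrite <- Rmult_assoc.
  apply Rle_trans with (A * INR (S n) * K * (r / s) ^ n)%R.
  - apply Rmult_le_compat_r.
    + apply pow_le. left. apply Rdiv_lt_0_compat; lra.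
    + apply (H n r s K); trivial; unfold s; lra.
  - replace (A * INR (S n) * K * (r / s) ^ n)%R with (A * K * (INR (S n) * (r / s) ^ n))%R by ring.
    apply Rmult_le_compat_l; trivial. now apply Rmult_le_pos.
Qed.

(** Coefficients of q f'(q) here and of f'(q) in [dcoef]. *)
Definition ncoef (c : nat -> C) (n : nat) : C := RtoC (INR n) * c n.
Definition dcoef (c : nat -> C) (n : nat) : C := RtoC (INR (S n)) * c (S n).

Lemma radius1_ncoef c : radius1 c -> radius1 (ncoef c).
Proof.
  intros Hc. apply radius1_linear_le with c 1%R; trivial; [lra|].
  intros n r s K Hr Hs HK. unfold ncoef. rewrite Cmod_mult, Cmod_R, Rabs_pos_eq by apply pos_INR.
  rewrite Rmult_1_l, Rmult_assoc. apply Rmult_le_compat; trivial.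
  - apply pos_INR.
  - apply Rmult_le_pos; [apply Cmod_ge_0|apply pow_le; lra].
  - apply le_INR. lia.
Qed.

Lemma radius1_S c : radius1 c -> radius1 (fun n => c (S n)).
Proof.
  intros Hc r Hr. destruct (Hc r Hr) as [K HK]. exists (K / r)%R. intros n.
  apply (Rle_div_r _ K r); [lra|]. rewrite Rmult_assoc. rewrite (Rmult_comm _ r). apply (HK (S n)).
Qed.

Lemma radius1_dcoef c : radius1 c -> radius1 (dcoef c).
Proof. intros. apply (radius1_S (ncoef c)). now apply radius1_ncoef. Qed.

(** The factor [INR 0] kills the term of index 0, so the default value [pred 0 = 0] is harmless;
    this indexing agrees with the termwise derivative of q^n. *)
Lemma PS_dcoef c q : radius1 c -> unit_disc q ->
  csums (fun n => ncoef c n * q ^ pred n) (PS (dcoef c) q).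
Proof.
  intros Hc Hq. replace (PS (dcoef c) q) with (ncoef c O * q ^ pred O + PS (dcoef c) q)
    by (unfold ncoef; simpl; ring).
  apply (csums_S (fun n => ncoef c n * q ^ pred n)). simpl pred.
  apply PS_csums; trivial. now apply radius1_dcoef.
Qed.

(** The Taylor remainders satisfy D(n+1) = w D(n) + n q^(n-1) (w - q)^2, which gives n^2 r^(n-2) |w
    - q|^2 by induction. The factor [r * r] on the left avoids the truncated exponent n - 2. *)
Lemma pow_quad (q w : C) r n : (0 < r)%R -> (Cmod q <= r)%R -> (Cmod w <= r)%R ->
  (Cmod (w ^ n - q ^ n - (w - q) * (RtoC (INR n) * q ^ pred n)) * (r * r) <=
     INR n * INR n * r ^ n * (Cmod (w - q) * Cmod (w - q)))%R.
Proof.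
  intros Hr Hq Hw. induction n.
  - simpl. replace (1 - 1 - (w - q) * (0 * 1)) with (RtoC 0) by ring. rewrite Cmod_0. lra.
  - set (D := w ^ n - q ^ n - (w - q) * (RtoC (INR n) * q ^ pred n)) in *.
    replace (w ^ S n - q ^ S n - (w - q) * (RtoC (INR (S n)) * q ^ pred (S n))) with
      (w * D + RtoC (INR n) * q ^ pred n * ((w - q) * (w - q))).
    2:{ unfold D. rewrite S_INR, RtoC_plus. destruct n; [simpl; ring|].
        rewrite !Nat.pred_succ, !Cpow_S. ring. }
    set (m := (Cmod (w - q) * Cmod (w - q))%R) in *.
    assert (Hm : (0 <= m)%R) by (apply Rmult_le_pos; apply Cmod_ge_0).
    assert (Hn := pos_INR n).
    assert (H1 : (Cmod (w * D) * (r * r) <= r * (INR n * INR n * r ^ n * m))%R).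
    { rewrite Cmod_mult, Rmult_assoc. apply Rmult_le_compat; trivial.
      - apply Cmod_ge_0.
      - apply Rmult_le_pos; [apply Cmod_ge_0|]. apply Rmult_le_pos; lra. }
    assert (H2 : (Cmod (RtoC (INR n) * q ^ pred n * ((w - q) * (w - q))) * (r * r) <=
                  INR n * (r * r ^ n) * m)%R).
    { rewrite !Cmod_mult, Cmod_R, (Rabs_pos_eq (INR n)) by trivial. fold m.
      destruct n; [simpl; lra|]. rewrite Nat.pred_succ, Cmod_pow.
      replace (INR (S n) * Cmod q ^ n * m * (r * r))%R
        with (INR (S n) * (r * r) * m * Cmod q ^ n)%R by ring.
      replace (INR (S n) * (r * r ^ S n) * m)%R with (INR (S n) * (r * r) * m * r ^ n)%R by (simpl; ring).
      apply Rmult_le_compat_l.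
      - apply Rmult_le_pos; [apply Rmult_le_pos|]; trivial; nra.
      - apply pow_incr. split; trivial. apply Cmod_ge_0. }
    eapply Rle_trans.
    + apply Rmult_le_compat_r; [apply Rmult_le_pos; lra|apply Cmod_triangle].
    + rewrite Rmult_plus_distr_r.
      eapply Rle_trans; [apply Rplus_le_compat; eassumption|].
      rewrite S_INR. simpl pow.
      assert (0 <= r * r ^ n * m)%R.
      { apply Rmult_le_pos; trivial. apply Rmult_le_pos; [lra|apply pow_le; lra]. }
      replace (r * (INR n * INR n * r ^ n * m) + INR n * (r * r ^ n) * m)%R
        with ((INR n * INR n + INR n) * (r * r ^ n * m))%R by ring.
      replace ((INR n + 1) * (INR n + 1) * (r * r ^ n) * m)%R
        with ((INR n + 1) * (INR n + 1) * (r * r ^ n * m))%R by ring.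
      apply Rmult_le_compat_r; trivial. nra.
Qed.

Lemma Cder_PS c q : radius1 c -> unit_disc q -> Cder (PS c) q (PS (dcoef c) q).
Proof.
  intros Hc Hq. assert (H0 := Cmod_ge_0 q). unfold unit_disc in Hq.
  set (r := ((1 + Cmod q) / 2)%R).
  assert (Hr : (0 < r < 1)%R) by (unfold r; lra).
  assert (Hrd : unit_disc (RtoC r)).
  { unfold unit_disc. rewrite Cmod_R, Rabs_pos_eq; lra. }
  (* [B] bounds the partial sums of n^2 |c n| r^n, the majorant that [pow_quad] yields for the
     termwise remainders. *)
  destruct (PS_abs (ncoef (ncoef c)) (RtoC r)) as [B HB]; trivial.
  { now do 2 apply radius1_ncoef. }
  assert (HB0 : (0 <= B)%R) by apply (HB O).
  apply Cder_quad with (B / (r * r))%R ((1 - Cmod q) / 2)%R; [lra| |].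
  { apply Rmult_le_pos; trivial. left. apply Rinv_0_lt_compat. nra. }
  intros w Hw.
  assert (Hwr : (Cmod w <= r)%R).
  { generalize (Cmod_triangle (w - q) q). replace (w - q + q) with w by ring. unfold r. lra. }
  assert (E : csums (fun n => c n * (w ^ n - q ^ n - (w - q) * (RtoC (INR n) * q ^ pred n)))
                (PS c w - PS c q - (w - q) * PS (dcoef c) q)).
  { apply csums_ext with (fun n => c n * w ^ n - c n * q ^ n - (w - q) * (ncoef c n * q ^ pred n)).
    - intros n. unfold ncoef. ring.
    - apply csums_minus; [apply csums_minus|apply csums_scal, PS_dcoef; trivial];
        apply PS_csums; trivial. unfold unit_disc. lra. }
  rewrite <- (csums_CSeries _ _ E).
  set (m := (Cmod (w - q) * Cmod (w - q))%R).
  assert (Hm : (0 <= m)%R) by (apply Rmult_le_pos; apply Cmod_ge_0).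
  apply CSeries_bound with (fun n => (m / (r * r) * Cmod (ncoef (ncoef c) n * RtoC r ^ n))%R).
  - intros n. rewrite Cmod_mult.
    unfold ncoef. rewrite !Cmod_mult, Cmod_R, Cmod_pow, Cmod_R, Rabs_pos_eq, (Rabs_pos_eq r)
      by (try apply pos_INR; lra).
    assert (Hp := pow_quad q w r n). unfold m.
    replace (Cmod (w - q) * Cmod (w - q) / (r * r) * (INR n * (INR n * Cmod (c n)) * r ^ n))%R
     with (Cmod (c n) * (INR n * INR n * r ^ n * (Cmod (w - q) * Cmod (w - q)) / (r * r)))%R
     by (field; lra).
    apply Rmult_le_compat_l; [apply Cmod_ge_0|].
    apply Rle_div_r; [nra|]. apply Hp; unfold r in *; lra.
  - intros n. rewrite rsum_scal.
    replace (B / (r * r) * m)%R with (m / (r * r) * B)%R by (field; lra).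
    apply Rmult_le_compat_l; [|apply HB].
    apply Rmult_le_pos; trivial. left. apply Rinv_0_lt_compat. nra.
Qed.

(** * Products and exponentials of power series *)

Definition conv (c d : nat -> C) (n : nat) : C := csum (fun k => c k * d (n - k)%nat) (S n).

Lemma Cmod_conv_le c d s K L n : (0 < s)%R ->
  (forall m, (Cmod (c m) * s ^ m <= K)%R) -> (forall m, (Cmod (d m) * s ^ m <= L)%R) ->
  (Cmod (conv c d n) * s ^ n <= INR (S n) * (K * L))%R.
Proof.
  intros Hs HK HL. unfold conv.
  eapply Rle_trans; [apply Rmult_le_compat_r; [apply pow_le; lra|apply Cmod_csum]|].
  rewrite Rmult_comm, <- rsum_scal, <- rsum_const.
  apply rsum_le. intros k Hk. rewrite Cmod_mult.
  replace (s ^ n)%R with (s ^ k * s ^ (n - k))%R.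
  2:{ rewrite <- pow_add. f_equal. lia. }
  replace (s ^ k * s ^ (n - k) * (Cmod (c k) * Cmod (d (n - k)%nat)))%R
    with ((Cmod (c k) * s ^ k) * (Cmod (d (n - k)%nat) * s ^ (n - k)))%R by ring.
  apply Rmult_le_compat; trivial; (apply Rmult_le_pos; [apply Cmod_ge_0|apply pow_le; lra]).
Qed.

Lemma radius1_conv c d : radius1 c -> radius1 d -> radius1 (conv c d).
Proof.
  intros Hc Hd r Hr. set (s := ((1 + r) / 2)%R).
  assert (Hs : (0 < s < 1)%R) by (unfold s; lra).
  destruct (Hc s Hs) as [K HK], (Hd s Hs) as [L HL].
  destruct (linear_geom_bound (r / s)) as [M HM].
  { split; [apply Rdiv_lt_0_compat; lra|]. apply Rlt_div_l; unfold s; lra. }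
  assert (HK0 : (0 <= K)%R).
  { apply Rle_trans with (2 := HK O). apply Rmult_le_pos; [apply Cmod_ge_0|simpl; lra]. }
  assert (HL0 : (0 <= L)%R).
  { apply Rle_trans with (2 := HL O). apply Rmult_le_pos; [apply Cmod_ge_0|simpl; lra]. }
  exists (K * L * M)%R. intros n.
  replace (r ^ n)%R with (s ^ n * (r / s) ^ n)%R.
  2:{ rewrite <- Rpow_mult_distr. f_equal. field. lra. }
  rewrite <- Rmult_assoc.
  apply Rle_trans with (INR (S n) * (K * L) * (r / s) ^ n)%R.
  - apply Rmult_le_compat_r; [apply pow_le; left; apply Rdiv_lt_0_compat; lra|].
    now apply Cmod_conv_le.
  - replace (INR (S n) * (K * L) * (r / s) ^ n)%R with (K * L * (INR (S n) * (r / s) ^ n))%R by ring.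
    apply Rmult_le_compat_l; trivial. now apply Rmult_le_pos.
Qed.

Lemma pow_le_1 (r : R) n : (0 <= r <= 1)%R -> (r ^ n <= 1)%R.
Proof. intros Hr. rewrite <- (pow1 n). apply pow_incr. lra. Qed.

Lemma pow_decr (r : R) m n : (0 <= r <= 1)%R -> (m <= n)%nat -> (r ^ n <= r ^ m)%R.
Proof.
  intros Hr Hmn. replace n with (m + (n - m))%nat by lia. rewrite pow_add.
  rewrite <- (Rmult_1_r (r ^ m)) at 2. apply Rmult_le_compat_l; [apply pow_le; lra|].
  now apply pow_le_1.
Qed.

(** Row [j] of the double series is the series of [d], multiplied by the [j]-th term of [c] and
    delayed by [j]; then the columns are finite sums and give the convolution. *)
Lemma PS_conv c d q : radius1 c -> radius1 d -> unit_disc q ->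
  PS (conv c d) q = PS c q * PS d q.
Proof.
  intros Hc Hd Hq.
  destruct (radius1_geom c q Hc Hq) as (K & r1 & HK & Hr1 & HcB).
  destruct (radius1_geom d q Hd Hq) as (L & r2 & HL & Hr2 & HdB).
  set (r := Rmax r1 r2).
  assert (Hr : (0 <= r < 1)%R) by (unfold r; split; [apply Rle_trans with r1; [lra|apply Rmax_l]|apply Rmax_lub_lt; lra]).
  (* The natural bound K L r^n for n >= j is not of product form. Splitting r^n = rho^n rho^n and
     weakening one factor to rho^j makes it so. *)
  set (rho := sqrt r).
  assert (Hrho : (0 <= rho < 1)%R).
  { unfold rho. split; [apply sqrt_pos|]. rewrite <- sqrt_1. apply sqrt_lt_1; lra. }
  assert (Err : (rho * rho = r)%R) by (apply sqrt_sqrt; lra).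
  pose (a := fun j => delay j (fun m => c j * q ^ j * (d m * q ^ m))).
  assert (Ha : forall j n, (Cmod (a j n) <= (K * L) * rho ^ j * rho ^ n)%R).
  { intros j n. unfold a, delay. destruct (Nat.leb_spec j n).
    - rewrite Cmod_mult.
      apply Rle_trans with ((K * r ^ j) * (L * r ^ (n - j)))%R.
      + apply Rmult_le_compat; try apply Cmod_ge_0.
        * eapply Rle_trans; [apply HcB|]. apply Rmult_le_compat_l; trivial.
          apply pow_incr. unfold r. split; [lra|apply Rmax_l].
        * eapply Rle_trans; [apply HdB|]. apply Rmult_le_compat_l; trivial.
          apply pow_incr. unfold r. split; [lra|apply Rmax_r].
      + replace (K * r ^ j * (L * r ^ (n - j)))%R with (K * L * r ^ n)%R.
        2:{ replace n with (j + (n - j))%nat at 1 by lia. rewrite pow_add. ring. }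
        rewrite (Rmult_assoc (K * L)). apply Rmult_le_compat_l; [now apply Rmult_le_pos|].
        rewrite <- pow_add, <- Err, Rpow_mult_distr, <- pow_add.
        apply pow_decr; [lra|lia].
    - rewrite Cmod_0. apply Rmult_le_pos; [apply Rmult_le_pos; [now apply Rmult_le_pos|]|]; apply pow_le; lra. }
  destruct (fubini a (fun j => (K * L * rho ^ j)%R) (fun n => (rho ^ n)%R) Ha)
    as (_ & H2 & H3 & H4 & H5).
  - intros j. apply Rmult_le_pos; [now apply Rmult_le_pos|apply pow_le; lra].
  - intros j. apply pow_le; lra.
  - apply rsummable_scal; [now apply Rmult_le_pos|]. now apply rsummable_geom.
  - now apply rsummable_geom.
  - assert (E1 : forall j, CSeries (a j) = c j * q ^ j * PS d q).
    { intros j. apply csums_CSeries. apply csums_delay. apply csums_scal. now apply PS_csums. }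
    assert (E2 : forall n, CSeries (fun j => a j n) = conv c d n * q ^ n).
    { intros n. apply csums_CSeries.
      replace (conv c d n * q ^ n) with (csum (fun j => a j n) (S n)).
      - apply csums_finite. intros k Hk. unfold a, delay.
        destruct (Nat.leb_spec k n); [lia|trivial].
      - unfold conv. rewrite Cmult_comm, <- csum_scal. apply csum_ext. intros k Hk.
        unfold a, delay. destruct (Nat.leb_spec k n); [|lia].
        replace n with (k + (n - k))%nat at 3 by lia. rewrite Cpow_add_r. ring. }
    unfold PS at 1. rewrite <- (CSeries_ext _ _ E2), <- H5, (CSeries_ext _ _ E1).
    apply csums_CSeries.
    apply csums_ext with (fun n => PS d q * (c n * q ^ n)); [intros; ring|].
    rewrite Cmult_comm. apply csums_scal. now apply PS_csums.
Qed.

Lemma radius1_spread k c : (0 < k)%nat -> radius1 c -> radius1 (spread k c).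
Proof.
  intros Hk Hc r Hr. destruct (Hc (r ^ k)%R) as [K HK].
  { split; [apply pow_lt; lra|]. assert (H := unit_disc_pow (RtoC r) k Hk).
    unfold unit_disc in H. rewrite Cmod_pow, Cmod_R, Rabs_pos_eq in H by lra. apply H. lra. }
  exists K. intros n. unfold spread. destruct (Nat.eqb_spec (n mod k) 0) as [E|E].
  - rewrite (Nat.div_mod n k) at 2 by lia. rewrite E, Nat.add_0_r, pow_mult. apply HK.
  - rewrite Cmod_0, Rmult_0_l. apply Rle_trans with (2 := HK O).
    apply Rmult_le_pos; [apply Cmod_ge_0|simpl; lra].
Qed.

Lemma spread_pow k c q n : (0 < k)%nat ->
  spread k (fun m => c m * (q ^ k) ^ m) n = spread k c n * q ^ n.
Proof.
  intros Hk. unfold spread. destruct (Nat.eqb_spec (n mod k) 0) as [E|E]; [|ring].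
  rewrite (Nat.div_mod n k) at 4 by lia. rewrite E, Nat.add_0_r, Cpow_mult_r. reflexivity.
Qed.

Lemma PS_spread k c q : (0 < k)%nat -> radius1 c -> unit_disc q ->
  PS (spread k c) q = PS c (q ^ k).
Proof.
  intros Hk Hc Hq. apply csums_CSeries.
  apply csums_ext with (1 := fun n => spread_pow k c q n Hk).
  apply csums_spread; trivial. apply PS_csums; trivial. now apply unit_disc_pow.
Qed.

(* Coefficients of [exp (g * PS l)], from [E' = g * (PS l)' * E]; [exp_tab g l n] is
   correct up to index [n]. *)
Fixpoint exp_tab (g : C) (l : nat -> C) (n : nat) : nat -> C :=
  match n with
  | O => fun _ => 1
  | S p => fun m => if (m <=? p)%nat then exp_tab g l p m
                    else g / RtoC (INR (S p)) * conv (dcoef l) (exp_tab g l p) p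
  end.

Definition exp_coef g l n := exp_tab g l n n.

Lemma exp_tab_coef g l n m : (m <= n)%nat -> exp_tab g l n m = exp_coef g l m.
Proof.
  induction n; intros H.
  - now replace m with O by lia.
  - destruct (Nat.eq_dec m (S n)) as [->|Hm]; trivial.
    simpl. destruct (Nat.leb_spec m n); [|lia]. apply IHn. lia.
Qed.

Lemma INR_S_neq_0 n : RtoC (INR (S n)) <> 0.
Proof. intros E. injection E as E. now apply (not_0_INR (S n)) in E. Qed.

Lemma exp_coef_S g l n : dcoef (exp_coef g l) n = g * conv (dcoef l) (exp_coef g l) n.
Proof.
  unfold dcoef at 1. unfold exp_coef at 1.
  change (exp_tab g l (S n) (S n)) with (if (S n <=? n)%nat then exp_tab g l n (S n)
    else g / RtoC (INR (S n)) * conv (dcoef l) (exp_tab g l n) n).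
  destruct (Nat.leb_spec (S n) n); [lia|].
  replace (conv (dcoef l) (exp_tab g l n) n) with (conv (dcoef l) (exp_coef g l) n).
  - field. apply INR_S_neq_0.
  - apply csum_ext. intros k Hk. f_equal. symmetry. apply exp_tab_coef. lia.
Qed.

(** The recursion bounds n + 1 times the weighted coefficient [u (S n)] by a constant [A] times the
    sum of all earlier ones. Once n + 1 exceeds A / d, the partial sums grow by at most the factor 1
    + d per step, with d > 0 arbitrary. Thus no theory of composed power series is required. *)
Lemma radius1_exp_coef g l : radius1 l -> radius1 (exp_coef g l).
Proof.
  intros Hl r Hr. set (t := ((1 + r) / 2)%R).
  assert (Ht : (0 < t < 1)%R) by (unfold t; lra).
  destruct (radius1_dcoef l Hl t Ht) as [K HK].
  assert (HK0 : (0 <= K)%R).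
  { apply Rle_trans with (2 := HK O). apply Rmult_le_pos; [apply Cmod_ge_0|simpl; lra]. }
  set (e := exp_coef g l). set (A := (Cmod g * K)%R).
  assert (HA : (0 <= A)%R) by (apply Rmult_le_pos; trivial; apply Cmod_ge_0).
  set (u := fun n => (Cmod (e n) * t ^ n)%R).
  assert (Hu : forall n, (0 <= u n)%R).
  { intros n. apply Rmult_le_pos; [apply Cmod_ge_0|apply pow_le; lra]. }
  assert (Hrec : forall n, (INR (S n) * u (S n) <= A * rsum u (S n))%R).
  { intros n. unfold u at 1. rewrite <- Rmult_assoc.
    replace (INR (S n) * Cmod (e (S n)))%R with (Cmod (dcoef e n)).
    2:{ unfold dcoef. rewrite Cmod_mult, Cmod_R, Rabs_pos_eq; trivial. apply pos_INR. }
    unfold e at 1. rewrite exp_coef_S. fold e. rewrite Cmod_mult. unfold A.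
    rewrite !Rmult_assoc. apply Rmult_le_compat_l; [apply Cmod_ge_0|].
    unfold conv. apply Rle_trans with (rsum (fun k => Cmod (dcoef l k * e (n - k)%nat)) (S n) * t ^ n)%R.
    { apply Rmult_le_compat; try apply Cmod_ge_0; [apply pow_le; lra|apply Cmod_csum|].
      apply pow_decr; [lra|lia]. }
    rewrite Rmult_comm, <- rsum_scal.
    assert (Hrev : rsum u (S n) = rsum (fun k => u (n - k)%nat) (S n)).
    { clear. assert (H : forall f m, rsum f (S m) = (f O + rsum (fun k => f (S k)) m)%R).
      { intros f m. induction m; [simpl; ring|]. simpl in *. rewrite IHm. ring. }
      induction n; [reflexivity|]. simpl rsum at 1. rewrite H.
      change (rsum u n + u n)%R with (rsum u (S n)). rewrite IHn, Nat.sub_0_r.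
      rewrite Rplus_comm. f_equal. }
    rewrite Hrev, <- rsum_scal. apply rsum_le. intros k Hk.
    unfold u. rewrite Cmod_mult. replace (t ^ n)%R with (t ^ k * t ^ (n - k))%R.
    2:{ rewrite <- pow_add. f_equal. lia. }
    replace (t ^ k * t ^ (n - k) * (Cmod (dcoef l k) * Cmod (e (n - k)%nat)))%R
      with ((Cmod (dcoef l k) * t ^ k) * (Cmod (e (n - k)%nat) * t ^ (n - k)))%R by ring.
    apply Rmult_le_compat_r; auto. apply Hu. }
  (* Chosen so that 1 + d = t / r: growth like (1 + d)^n is exactly what passing from radius [t] to
     radius [r] compensates. *)
  set (d := (t / r - 1)%R).
  assert (Hd : (0 < d)%R).
  { unfold d. assert (1 < t / r)%R; [|lra]. apply Rlt_div_r; unfold t; lra. }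
  (* Beyond [N0] the quotient A / (n + 1) is at most [d]; the earlier partial sums are covered by
     the constant [Q]. *)
  destruct (nfloor_ex (A / d)%R) as [N0 HN0].
  { apply Rmult_le_pos; trivial. left. now apply Rinv_0_lt_compat. }
  set (Q := rsum u (S N0)).
  assert (HQ : forall n, (rsum u n <= Q * (1 + d) ^ n)%R).
  { assert (H1 : forall n, (1 <= (1 + d) ^ n)%R).
    { intros n. apply pow_R1_Rle. lra. }
    assert (HQ0 : (0 <= Q)%R) by (apply rsum_pos; trivial).
    assert (Hsm : forall n, (n <= S N0)%nat -> (rsum u n <= Q * (1 + d) ^ n)%R).
    { intros n Hn. rewrite <- (Rmult_1_r (rsum u n)). apply Rmult_le_compat; trivial; try lra.
      - now apply rsum_pos.
      - now apply rsum_mono. }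
    induction n; [apply Hsm; lia|].
    destruct (Nat.le_gt_cases (S n) (S N0)) as [Hle|Hgt]; [now apply Hsm|].
    destruct n; [lia|]. change (rsum u (S (S n))) with (rsum u (S n) + u (S n))%R.
    assert (Hx : (u (S n) <= d * rsum u (S n))%R).
    { assert (Hin : (0 < INR (S n))%R) by (apply lt_0_INR; lia).
      apply Rmult_le_reg_l with (INR (S n)); trivial.
      eapply Rle_trans; [apply Hrec|]. rewrite <- Rmult_assoc. apply Rmult_le_compat_r.
      - now apply rsum_pos.
      - assert (A / d < INR N0 + 1)%R by apply HN0.
        assert (INR N0 + 1 <= INR (S n))%R by (rewrite <- S_INR; apply le_INR; lia).
        apply Rlt_le. apply Rlt_div_l; trivial. lra. }
    rewrite <- tech_pow_Rmult. replace (Q * ((1 + d) * (1 + d) ^ S n))%R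
      with ((1 + d) * (Q * (1 + d) ^ S n))%R by ring.
    apply Rle_trans with ((1 + d) * rsum u (S n))%R; [lra|].
    apply Rmult_le_compat_l; [lra|apply IHn]. }
  exists (Q * (1 + d))%R. intros n.
  assert (Htn : (0 < (t / r) ^ n)%R) by (apply pow_lt; apply Rdiv_lt_0_compat; lra).
  apply Rmult_le_reg_r with ((t / r) ^ n)%R; trivial.
  replace (Cmod (e n) * r ^ n * (t / r) ^ n)%R with (u n).
  2:{ unfold u. rewrite Rmult_assoc, <- Rpow_mult_distr. f_equal. f_equal. field. lra. }
  replace (t / r)%R with (1 + d)%R by (unfold d; ring).
  apply Rle_trans with (rsum u (S n)).
  - simpl. generalize (rsum_pos u n Hu). lra.
  - eapply Rle_trans; [apply HQ|]. simpl. lra.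
Qed.

(** By [exp_coef_S], the series times Cexp (- g PS l) has derivative 0, and its value at 0 is 1
    because both [l O = 0] and the leading coefficient is 1. *)
Lemma PS_exp_coef g l q : radius1 l -> l O = 0 -> unit_disc q ->
  PS (exp_coef g l) q = Cexp (g * PS l q).
Proof.
  intros Hl H0 Hq. set (e := exp_coef g l).
  assert (He : radius1 e) by now apply radius1_exp_coef.
  assert (E : PS e q * Cexp (- (g * PS l q)) = PS e 0 * Cexp (- (g * PS l 0))).
  { apply (Cder_zero_const unit_disc (fun q => PS e q * Cexp (- (g * PS l q)))).
    - apply convex_unit_disc.
    - intros z Hz.
      apply Cder_eq with (PS (dcoef e) z * Cexp (- (g * PS l z)) +
         PS e z * (- (g * PS (dcoef l) z) * Cexp (- (g * PS l z)))).
      + unfold e at 1. rewrite (PS_ext _ _ z (exp_coef_S g l)), PS_scal, PS_conv; trivial.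
        * fold e. ring.
        * now apply radius1_dcoef.
        * apply radius1_conv; trivial. now apply radius1_dcoef.
      + apply (Cder_mult (PS e) (fun z => Cexp (- (g * PS l z)))); [now apply Cder_PS|].
        apply (Cder_Cexp_comp (fun z => - (g * PS l z))). apply Cder_opp, Cder_scal.
        now apply Cder_PS.
    - trivial.
    - apply unit_disc_0. }
  rewrite !PS_0, H0 in E. change (e O) with (RtoC 1) in E.
  replace (- (g * 0)) with (RtoC 0) in E by ring. rewrite Cexp_0, Cexp_opp in E.
  assert (Hn := Cexp_neq_0 (g * PS l q)).
  replace (PS e q) with (PS e q * / Cexp (g * PS l q) * Cexp (g * PS l q)) by (field; trivial).
  rewrite E. ring.
Qed.

Lemma radius1_subexponential c : radius1 c -> subexponential c.
Proof.
  intros Hc eps He. destruct (Hc (exp (- eps))) as [K HK].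
  { split; [apply exp_pos|]. rewrite <- exp_0. apply exp_increasing. lra. }
  exists K. exists O. intros n _. specialize (HK n).
  assert (E : (exp (- eps) ^ n * exp (eps * INR n) = 1)%R).
  { clear. induction n; [simpl; rewrite Rmult_0_r, exp_0; ring|].
    rewrite S_INR, Rmult_plus_distr_l, exp_plus. simpl pow.
    replace (exp (- eps) * exp (- eps) ^ n * (exp (eps * INR n) * exp (eps * 1)))%R
      with ((exp (- eps) * exp (eps * 1)) * (exp (- eps) ^ n * exp (eps * INR n)))%R by ring.
    rewrite IHn, <- exp_plus. replace (- eps + eps * 1)%R with 0%R by ring. rewrite exp_0. ring. }
  replace (Cmod (c n)) with (Cmod (c n) * exp (- eps) ^ n * exp (eps * INR n))%R
    by (rewrite Rmult_assoc, E; ring).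
  apply Rmult_le_compat_r; trivial. left. apply exp_pos.
Qed.

(** * Euler products and Jacobi's triple product *)

Lemma one_minus_neq_0 x : unit_disc x -> 1 - x <> 0.
Proof.
  intros Hx E. assert (x = 1) by (replace x with (1 - (1 - x)) by ring; rewrite E; ring).
  subst x. unfold unit_disc in Hx. rewrite Cmod_1 in Hx. lra.
Qed.

Lemma radius1_const a : radius1 (fun _ => a).
Proof.
  intros r Hr. exists (Cmod a). intros n. rewrite <- (Rmult_1_r (Cmod a)) at 2.
  apply Rmult_le_compat_l; [apply Cmod_ge_0|]. apply pow_le_1; lra.
Qed.

Lemma PS_one x : unit_disc x -> PS (fun _ => 1) x = / (1 - x).
Proof.
  intros Hx. assert (Hn := one_minus_neq_0 x Hx).
  assert (H := PS_csums _ x (radius1_const 1) Hx).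
  assert (E : PS (fun _ => 1) x = 1 + x * PS (fun _ => 1) x).
  { apply csums_CSeries. replace (1 + x * PS (fun _ => 1) x) with (1 * x ^ 0 + x * PS (fun _ => 1) x) by (simpl; ring).
    apply (csums_S (fun n => 1 * x ^ n)).
    apply csums_ext with (fun n => x * (1 * x ^ n)); [intros; simpl; ring|].
    now apply csums_scal. }
  replace (PS (fun _ => 1) x) with ((PS (fun _ => 1) x - x * PS (fun _ => 1) x) / (1 - x))
    by (field; trivial).
  rewrite E at 1. field; trivial.
Qed.

Lemma PS_dcoef_one x : unit_disc x -> PS (dcoef (fun _ => 1)) x = / ((1 - x) * (1 - x)).
Proof.
  intros Hx. assert (Hn := one_minus_neq_0 x Hx).
  rewrite (PS_ext _ (conv (fun _ => 1) (fun _ => 1))).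
  - rewrite PS_conv, PS_one by (trivial; apply radius1_const). field; trivial.
  - intros n. unfold dcoef, conv. generalize (S n). clear. intros n. induction n.
    + simpl; ring.
    + rewrite S_INR, RtoC_plus. simpl csum. rewrite <- IHn. ring.
Qed.

Definition log1m_coef (n : nat) : C :=
  match n with O => 0 | S _ => - / RtoC (INR n) end.

Lemma radius1_bounded c K : (forall n, (Cmod (c n) <= K)%R) -> radius1 c.
Proof.
  intros H r Hr. exists K. intros n.
  apply Rle_trans with (Cmod (c n) * 1)%R; [|rewrite Rmult_1_r; apply H].
  apply Rmult_le_compat_l; [apply Cmod_ge_0|]. apply pow_le_1; lra.
Qed.

Lemma Cmod_log1m_coef n : (Cmod (log1m_coef n) <= 1)%R.
Proof.
  destruct n; [simpl; rewrite Cmod_0; lra|].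
  unfold log1m_coef. rewrite Cmod_opp, Cmod_inv, Cmod_R, Rabs_pos_eq
    by (apply pos_INR || apply INR_S_neq_0).
  rewrite <- Rinv_1. apply Rinv_le_contravar; [lra|].
  rewrite S_INR. generalize (pos_INR n). lra.
Qed.

Lemma radius1_log1m : radius1 log1m_coef.
Proof. apply radius1_bounded with 1%R. apply Cmod_log1m_coef. Qed.

Lemma Cexp_log1m x : unit_disc x -> Cexp (PS log1m_coef x) = 1 - x.
Proof.
  intros Hx.
  assert (E : Cexp (- PS log1m_coef x) * (1 - x) = Cexp (- PS log1m_coef 0) * (1 - 0)).
  { apply (Cder_zero_const unit_disc (fun x => Cexp (- PS log1m_coef x) * (1 - x)));
      [apply convex_unit_disc| |trivial|apply unit_disc_0].
    intros z Hz. assert (Hn := one_minus_neq_0 z Hz).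
    assert (Hd : PS (dcoef log1m_coef) z = - / (1 - z)).
    { rewrite (PS_ext _ (fun _ => Copp 1 * 1)).
      - rewrite (PS_scal (Copp 1) (fun _ => RtoC 1) z (radius1_const 1) Hz), PS_one by trivial. ring.
      - intros n. unfold dcoef, log1m_coef. field. apply INR_S_neq_0. }
    apply Cder_eq with (- PS (dcoef log1m_coef) z * Cexp (- PS log1m_coef z) * (1 - z) +
                        Cexp (- PS log1m_coef z) * (0 - 1)).
    - rewrite Hd. field; trivial.
    - apply (Cder_mult (fun z => Cexp (- PS log1m_coef z)) (fun z => 1 - z)).
      + apply (Cder_Cexp_comp (fun z => - PS log1m_coef z)). apply Cder_opp.
        apply Cder_PS; trivial. apply radius1_log1m.
      + apply Cder_minus; [apply Cder_const|apply Cder_id]. }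
  rewrite PS_0 in E. simpl in E. replace (- 0) with (RtoC 0) in E by ring.
  rewrite Cexp_0, Cexp_opp in E. assert (Hn := Cexp_neq_0 (PS log1m_coef x)).
  replace (1 - x) with (/ Cexp (PS log1m_coef x) * (1 - x) * Cexp (PS log1m_coef x)) by (field; trivial).
  rewrite E. ring.
Qed.

(** The sum of the divisors of [n]; the candidate [S d] runs through 1, ..., n. *)
Definition sigma (n : nat) : C :=
  csum (fun d => if (n mod S d =? 0)%nat then RtoC (INR (S d)) else 0) n.

(* Coefficients of the logarithm of the Euler product [prod (1 - x^k)]. *)
Definition euler_log_coef (n : nat) : C := match n with O => 0 | S _ => - sigma n / RtoC (INR n) end.

Definition euler_log (x : C) : C := PS euler_log_coef x.

Lemma Cmod_sigma n : (Cmod (sigma n) <= INR n * INR n)%R.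
Proof.
  unfold sigma. eapply Rle_trans; [apply Cmod_csum|].
  rewrite <- rsum_const. apply rsum_le. intros k Hk.
  destruct (Nat.eqb_spec (n mod S k) 0).
  - rewrite Cmod_R, Rabs_pos_eq by apply pos_INR. apply le_INR. lia.
  - rewrite Cmod_0. apply pos_INR.
Qed.

Lemma radius1_euler_log : radius1 euler_log_coef.
Proof.
  intros r Hr. destruct (linear_geom_bound r Hr) as [K HK]. exists K.
  intros n. eapply Rle_trans; [|apply (HK n)]. apply Rmult_le_compat_r; [apply pow_le; lra|].
  destruct n; [simpl; rewrite Cmod_0; lra|].
  unfold euler_log_coef. rewrite Cmod_div, Cmod_opp, Cmod_R, Rabs_pos_eq
    by (apply pos_INR || apply INR_S_neq_0).
  assert (Hn : (0 < INR (S n))%R) by (apply lt_0_INR; lia).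
  apply Rle_div_l; trivial. eapply Rle_trans; [apply Cmod_sigma|].
  apply Rmult_le_compat_r; [lra|]. apply le_INR. lia.
Qed.

(** Writing |x|^n as rho^n rho^n provides one decaying factor for each index of a double series. *)
Lemma sqrt_geom x : unit_disc x -> exists rho, (0 <= rho < 1)%R /\ (rho * rho = Cmod x)%R.
Proof.
  intros Hx. exists (sqrt (Cmod x)). unfold unit_disc in Hx.
  assert (H0 := Cmod_ge_0 x). repeat split.
  - apply sqrt_pos.
  - rewrite <- sqrt_1. apply sqrt_lt_1; lra.
  - now apply sqrt_sqrt.
Qed.

Lemma spread_lt k (c : nat -> C) n : (n < k)%nat -> c O = 0 -> spread k c n = 0.
Proof.
  intros Hk H0. unfold spread. rewrite Nat.mod_small, Nat.div_small by trivial.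
  destruct (Nat.eqb_spec n 0); trivial.
Qed.

(** Lambert-type series are regrouped here by powers of [x]. The [k]-th inner series starts at
    exponent k + 1, so half of the decay in [n] may be traded for decay in [k], and in column [n]
    only the indices k < n contribute. *)
Lemma spread_resum (c : nat -> nat -> C) (K : nat -> R) x :
  unit_disc x -> (forall k, c k O = 0) -> (forall k n, (Cmod (c k n) <= K k)%R) ->
  (forall rho, (0 <= rho < 1)%R -> rsummable (fun k => (K k * rho ^ k)%R)) ->
  abs_summable (fun k => PS (c k) (x ^ S k)) /\
  CSeries (fun k => PS (c k) (x ^ S k)) = PS (fun n => csum (fun k => spread (S k) (c k) n) n) x.
Proof.
  intros Hx Hc0 HcK HK. destruct (sqrt_geom x Hx) as (rho & Hrho & Err).
  assert (HK0 : forall k, (0 <= K k)%R).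
  { intros k. eapply Rle_trans; [apply Cmod_ge_0|apply (HcK k O)]. }
  pose (a := fun k n => spread (S k) (c k) n * x ^ n).
  assert (Ha : forall k n, (Cmod (a k n) <= K k * rho ^ k * rho ^ n)%R).
  { intros k n. unfold a. rewrite Cmod_mult, Cmod_pow, <- Err, Rpow_mult_distr, Rmult_assoc.
    assert (0 <= rho ^ n)%R by (apply pow_le; lra).
    assert (0 <= rho ^ k)%R by (apply pow_le; lra).
    destruct (Nat.le_gt_cases (S k) n) as [H1|H1].
    - apply Rmult_le_compat.
      + apply Cmod_ge_0.
      + now apply Rmult_le_pos.
      + unfold spread. destruct (_ =? _)%nat; [apply HcK|]. rewrite Cmod_0. apply HK0.
      + apply Rmult_le_compat_r; trivial. apply pow_decr; [lra|lia].
    - rewrite spread_lt by trivial. rewrite Cmod_0, Rmult_0_l.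
      apply Rmult_le_pos; trivial. now apply Rmult_le_pos. }
  destruct (fubini a (fun k => (K k * rho ^ k)%R) (fun n => (rho ^ n)%R) Ha) as (_ & _ & H3 & _ & H5).
  - intros k. apply Rmult_le_pos; trivial. apply pow_le; lra.
  - intros n. apply pow_le; lra.
  - now apply HK.
  - now apply rsummable_geom.
  - assert (Hr : forall k, radius1 (c k)) by (intros k; now apply radius1_bounded with (K k)).
    assert (E1 : forall k, CSeries (a k) = PS (c k) (x ^ S k)).
    { intros k. apply (PS_spread (S k) (c k) x); trivial. lia. }
    assert (E2 : forall n, CSeries (fun k => a k n) = csum (fun k => spread (S k) (c k) n) n * x ^ n).
    { intros n. apply csums_CSeries. rewrite Cmult_comm, <- csum_scal.
      rewrite (csum_ext _ (fun k => a k n)) by (intros; unfold a; ring).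
      apply csums_finite. intros k Hk. unfold a. rewrite spread_lt; [ring|lia|trivial]. }
    split.
    + eapply rsummable_le; [|apply H3]. intros k. simpl. rewrite E1. apply Rle_refl.
    + rewrite <- (CSeries_ext _ _ E1), H5. apply CSeries_ext, E2.
Qed.

Lemma rsummable_linear_geom rho : (0 <= rho < 1)%R -> rsummable (fun k => (INR (S k) * rho ^ k)%R).
Proof.
  intros Hr.
  destruct (PS_abs (dcoef (fun _ => 1)) (RtoC rho)) as [B HB].
  - apply radius1_dcoef, radius1_const.
  - unfold unit_disc. rewrite Cmod_R, Rabs_pos_eq; lra.
  - exists B. intros n. eapply Rle_trans; [|apply (HB n)]. right. apply rsum_ext.
    intros k _. unfold dcoef. rewrite !Cmod_mult, Cmod_pow, !Cmod_R, Rabs_R1, !Rabs_pos_eq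
      by (apply pos_INR || lra). ring.
Qed.

(** A divisor k of n = k d contributes -1 / d = - k / n to the coefficient of x^n, in total -
    sigma(n) / n. *)
Lemma euler_log_sum x : unit_disc x ->
  csums (fun k => PS log1m_coef (x ^ S k)) (euler_log x).
Proof.
  intros Hx.
  destruct (spread_resum (fun _ => log1m_coef) (fun _ => 1%R) x) as [H1 H2]; trivial.
  - intros _. apply Cmod_log1m_coef.
  - intros rho Hr. apply rsummable_scal; [lra|]. now apply rsummable_geom.
  - replace (euler_log x) with (CSeries (fun k => PS log1m_coef (x ^ S k))).
    + now apply abs_summable_csums.
    + rewrite H2. apply PS_ext. intros [|n]; [reflexivity|].
      unfold euler_log_coef, sigma.
      replace (- csum (fun d => if (S n mod S d =? 0)%nat then RtoC (INR (S d)) else 0) (S n)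
        / RtoC (INR (S n))) with ((- / RtoC (INR (S n))) *
         csum (fun d => if (S n mod S d =? 0)%nat then RtoC (INR (S d)) else 0) (S n))
        by (field; apply INR_S_neq_0).
      rewrite <- csum_scal. apply csum_ext. intros k Hk. unfold spread.
      destruct (Nat.eqb_spec (S n mod S k) 0) as [E|E]; [|ring].
      pose proof (Nat.div_mod (S n) (S k) ltac:(lia)) as D. rewrite E, Nat.add_0_r in D.
      destruct (S n / S k)%nat as [|d]; [lia|]. unfold log1m_coef. rewrite D, mult_INR, RtoC_mult.
      field. split; apply INR_S_neq_0.
Qed.

Lemma PS_ncoef c x : radius1 c -> unit_disc x -> PS (ncoef c) x = x * PS (dcoef c) x.
Proof.
  intros Hc Hx. apply csums_CSeries.
  apply csums_ext with (fun n => x * (ncoef c n * x ^ pred n)).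
  - intros [|n]; unfold ncoef; simpl; ring.
  - apply csums_scal. now apply PS_dcoef.
Qed.

(** Two evaluations of the sum of k x^(k m) over k, m >= 1: summing over k first gives x^m / (1 -
    x^m)^2, while grouping by n = k m gives sigma(n) x^n. The first is the form in which
    [lipschitz_sqr] produces exponentials. *)
Lemma euler_log_deriv_sum x : unit_disc x ->
  csums (fun m => x ^ S m / ((1 - x ^ S m) * (1 - x ^ S m))) (- (x * PS (dcoef euler_log_coef) x)).
Proof.
  intros Hx. assert (H0 := Cmod_ge_0 x).
  pose (c := fun k n => match n with O => RtoC 0 | S _ => RtoC (INR (S k)) end).
  destruct (spread_resum c (fun k => INR (S k)) x) as [_ H2]; trivial.
  - intros k [|n]; unfold c.
    + rewrite Cmod_0. apply pos_INR.
    + rewrite Cmod_R, Rabs_pos_eq by apply pos_INR. lra.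
  - apply rsummable_linear_geom.
  - pose (a := fun k m => RtoC (INR (S k)) * (x ^ S m) ^ S k).
    assert (Ha : forall k m, (Cmod (a k m) <= INR (S k) * Cmod x ^ k * Cmod x ^ m)%R).
    { intros k m. unfold a. rewrite Cmod_mult, Cmod_R, Rabs_pos_eq by apply pos_INR.
      rewrite Rmult_assoc. apply Rmult_le_compat_l; [apply pos_INR|].
      rewrite <- Cpow_mult_r, Cmod_pow, <- pow_add.
      apply pow_decr; [unfold unit_disc in Hx; lra|]. lia. }
    destruct (fubini a (fun k => (INR (S k) * Cmod x ^ k)%R) (fun m => (Cmod x ^ m)%R) Ha)
      as (F1 & _ & _ & F4 & F5).
    + intros k. apply Rmult_le_pos; [apply pos_INR|now apply pow_le].
    + intros k. now apply pow_le.
    + now apply rsummable_linear_geom.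
    + now apply rsummable_geom.
    + assert (E1 : forall k, CSeries (a k) = PS (c k) (x ^ S k)).
      { intros k. symmetry. apply csums_CSeries.
        replace (CSeries (a k)) with (c k O * (x ^ S k) ^ 0 + CSeries (a k)) by (simpl; ring).
        apply (csums_S (fun n => c k n * (x ^ S k) ^ n)).
        apply csums_ext with (a k); [|apply abs_summable_csums, F1].
        intros m. unfold a, c. rewrite <- !Cpow_mult_r. do 2 f_equal. lia. }
      assert (E2 : forall m, CSeries (fun k => a k m) = x ^ S m / ((1 - x ^ S m) * (1 - x ^ S m))).
      { intros m. assert (Hm : unit_disc (x ^ S m)) by (apply unit_disc_pow; trivial; lia).
        apply csums_CSeries. unfold Cdiv. rewrite <- PS_dcoef_one by trivial.
        apply csums_ext with (fun k => x ^ S m * (dcoef (fun _ => 1) k * (x ^ S m) ^ k)).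
        - intros k. unfold a, dcoef. rewrite (Cpow_S (x ^ S m) k). ring.
        - apply csums_scal, PS_csums; trivial. apply radius1_dcoef, radius1_const. }
      replace (- (x * PS (dcoef euler_log_coef) x)) with (CSeries (fun m => CSeries (fun k => a k m))).
      * apply csums_ext with (1 := E2). apply (abs_summable_csums (fun m => CSeries (fun k => a k m))), F4.
      * rewrite <- F5, (CSeries_ext _ _ E1), H2, <- PS_ncoef by (trivial; apply radius1_euler_log).
        replace (- PS (ncoef euler_log_coef) x) with (- 1 * PS (ncoef euler_log_coef) x) by ring.
        rewrite <- PS_scal by (trivial; apply radius1_ncoef, radius1_euler_log).
        apply PS_ext. intros [|n]; [unfold ncoef; simpl; ring|].
        unfold ncoef, euler_log_coef.
        replace (- 1 * (RtoC (INR (S n)) * (- sigma (S n) / RtoC (INR (S n))))) with (sigma (S n))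
          by (field; apply INR_S_neq_0).
        apply csum_ext. intros k Hk. unfold spread, c.
        destruct (Nat.eqb_spec (S n mod S k) 0) as [E|E]; [|ring].
        pose proof (Nat.div_mod (S n) (S k) ltac:(lia)) as D.
        destruct (S n / S k)%nat as [|d]; [lia|reflexivity].
Qed.

(** * The finite triple product and its limit *)

Fixpoint cprod (u : nat -> C) (n : nat) : C :=
  match n with O => 1 | S m => cprod u m * u m end.

(** The q-Pochhammer symbol (x; x)_n. *)
Definition euler (x : C) (n : nat) : C := cprod (fun k => 1 - x ^ S k) n.

Lemma euler_S x n : euler x (S n) = euler x n * (1 - x ^ S n).
Proof. reflexivity. Qed.

Lemma euler_neq_0 x n : unit_disc x -> euler x n <> 0.
Proof.
  intros Hx. induction n.
  - unfold euler; simpl. exact C1_nz.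
  - rewrite euler_S. apply Cmult_neq_0; trivial. apply one_minus_neq_0, unit_disc_pow; trivial. lia.
Qed.

Lemma euler_lim x : unit_disc x -> Clim (euler x) (Cexp (euler_log x)).
Proof.
  intros Hx. apply Clim_ext with (fun n => Cexp (csum (fun k => PS log1m_coef (x ^ S k)) n)).
  - intros n. induction n; [apply Cexp_0|].
    change (Cexp (csum (fun k => PS log1m_coef (x ^ S k)) n + PS log1m_coef (x ^ S n)) = euler x (S n)).
    rewrite Cexp_add, IHn.
    rewrite Cexp_log1m by (apply unit_disc_pow; trivial; lia). reflexivity.
  - apply Clim_Cexp. now apply euler_log_sum.
Qed.

Lemma Clim_bounded u l : Clim u l -> exists B, forall n, (Cmod (u n) <= B)%R.
Proof.
  intros H. destruct (proj1 (Clim_eps u l) H 1%R Rlt_0_1) as [N HN].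
  exists (Cmod l + 1 + rsum (fun k => Cmod (u k)) N)%R. intros n.
  assert (HS := rsum_pos (fun k => Cmod (u k)) N (fun k => Cmod_ge_0 (u k))).
  destruct (Nat.le_gt_cases N n) as [Hn|Hn].
  - specialize (HN n Hn). generalize (Cmod_triangle (u n - l) l).
    replace (u n - l + l) with (u n) by ring. lra.
  - assert (Cmod (u n) <= rsum (fun k => Cmod (u k)) N)%R.
    { eapply Rle_trans; [|apply (rsum_mono (fun k => Cmod (u k)) (S n) N); [intros; apply Cmod_ge_0|lia]].
      simpl. generalize (rsum_pos (fun k => Cmod (u k)) n (fun k => Cmod_ge_0 (u k))). lra. }
    generalize (Cmod_ge_0 l). lra.
Qed.

(* The coefficient of [z^j] in [prod_(k<n) (1 + z q^(2k+1)) (1 + q^(2k+1)/z)]. *)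
Definition triple_coef (q : C) (n j : nat) : C :=
  if (j <=? n)%nat
  then q ^ (j * j) * euler (q ^ 2) (2 * n) / (euler (q ^ 2) (n + j) * euler (q ^ 2) (n - j))
  else 0.

(** Passing from n to n + 1 multiplies the product by (1 + z q^(2n+1)) (1 + q^(2n+1) / z) = 1 +
    q^(4n+2) + q^(2n+1) (z + 1 / z); this is the resulting relation between coefficients. *)
Lemma triple_coef_S q n j : unit_disc q -> (j <= n)%nat ->
  triple_coef q (S n) (S j) = (1 + q ^ (4 * n + 2)) * triple_coef q n (S j)
    + q ^ (2 * n + 1) * (triple_coef q n j + triple_coef q n (S (S j))).
Proof.
  intros Hq Hj. assert (Hp : unit_disc (q ^ 2)) by (apply unit_disc_pow; trivial; lia).
  assert (HE := fun k => euler_neq_0 (q ^ 2) k Hp).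
  assert (HF := fun k => one_minus_neq_0 ((q ^ 2) ^ S k) (unit_disc_pow (q ^ 2) (S k) (Nat.lt_0_succ k) Hp)).
  unfold triple_coef.
  destruct (Nat.leb_spec (S j) (S n)); [|lia]. destruct (Nat.leb_spec j n); [|lia].
  destruct (Nat.leb_spec (S j) n) as [H1|H1].
  - destruct (Nat.leb_spec (S (S j)) n) as [H2|H2].
    (* With n = m + j + 2 every truncated subtraction disappears, and the claim becomes a rational
       identity in x = q^j and y = q^m. *)
    + destruct (Nat.le_exists_sub _ _ H2) as (m & Hm & _).
      replace (S j * S j)%nat with (j * j + (j + j + 1))%nat by lia.
      replace (S (S j) * S (S j))%nat with (j * j + (j + j + j + j + 4))%nat by lia.
      replace (2 * S n)%nat with (S (S (2 * n))) by lia.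
      replace (S n + S j)%nat with (S (S (n + j))) by lia.
      replace (n + S j)%nat with (S (n + j)) by lia.
      replace (n + S (S j))%nat with (S (S (n + j))) by lia.
      replace (S n - S j)%nat with (S (S m)) by lia.
      replace (n - S j)%nat with (S m) by lia.
      replace (n - j)%nat with (S (S m)) by lia.
      replace (n - S (S j))%nat with m by lia.
      assert (F1 := HF m). assert (F2 := HF (S m)).
      assert (F3 := HF (n + j)%nat). assert (F4 := HF (S (n + j))).
      rewrite !euler_S. assert (G1 := HE m). assert (G2 := HE (n + j)%nat).
      revert F1 F2 F3 F4.
      rewrite <- !Cpow_mult_r.
      replace (2 * S m)%nat with (m + m + 2)%nat by lia.
      replace (2 * S (S m))%nat with (m + m + 4)%nat by lia.
      replace (2 * S (2 * n))%nat with (j + j + j + j + (m + m + m + m) + 10)%nat by lia.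
      replace (2 * S (S (2 * n)))%nat with (j + j + j + j + (m + m + m + m) + 12)%nat by lia.
      replace (2 * S (n + j))%nat with (j + j + j + j + (m + m) + 6)%nat by lia.
      replace (2 * S (S (n + j)))%nat with (j + j + j + j + (m + m) + 8)%nat by lia.
      replace (4 * n + 2)%nat with (j + j + j + j + (m + m + m + m) + 10)%nat by lia.
      replace (2 * n + 1)%nat with (j + j + (m + m) + 5)%nat by lia.
      rewrite !Cpow_add_r. set (x := q ^ j). set (y := q ^ m).
      set (A := euler (q ^ 2) (n + j)) in *. set (B := euler (q ^ 2) m) in *.
      intros. field. repeat split; trivial.
    (* Boundary case n = j + 1, where the coefficient of index j + 2 is 0 by definition; for n = j
       below, the one of index j + 1 vanishes too. *)
    + replace n with (S j) by lia.
      replace (S j * S j)%nat with (j * j + (j + j + 1))%nat by lia.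
      replace (2 * S (S j))%nat with (S (S (2 * S j))) by lia.
      replace (S (S j) + S j)%nat with (S (2 * S j)) by lia.
      replace (S j + S j)%nat with (2 * S j)%nat by lia.
      replace (S j + j)%nat with (S (2 * j)) by lia.
      replace (S (S j) - S j)%nat with 1%nat by lia.
      replace (S j - S j)%nat with O by lia.
      replace (S j - j)%nat with 1%nat by lia.
      replace (2 * S j)%nat with (S (S (2 * j))) by lia.
      assert (F1 := HF O). assert (F2 := HF (S (2 * j))). assert (F3 := HF (S (S (2 * j)))).
      rewrite !euler_S. assert (G2 := HE (S (2 * j))). rewrite !euler_S in G2.
      change (euler (q ^ 2) 0) with (RtoC 1).
      revert F1 F2 F3 G2.
      rewrite <- !Cpow_mult_r.
      replace (2 * S (2 * j))%nat with (j + j + j + j + 2)%nat by lia.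
      replace (2 * S (S (2 * j)))%nat with (j + j + j + j + 4)%nat by lia.
      replace (2 * S (S (S (2 * j))))%nat with (j + j + j + j + 6)%nat by lia.
      replace (2 * S (S (S (S (2 * j)))))%nat with (j + j + j + j + 8)%nat by lia.
      replace (4 * S j + 2)%nat with (j + j + j + j + 6)%nat by lia.
      replace (S (S (2 * j)) + 1)%nat with (j + j + 3)%nat by lia.
      rewrite !Cpow_add_r. change (q ^ (2 * 1)) with (q ^ 2). set (x := q ^ j).
      set (A := euler (q ^ 2) (2 * j)) in *.
      intros. assert (HA : A <> 0) by apply HE.
      assert (F4 : 1 - x * x * x * x * q ^ 2 <> 0).
      { intros E. apply G2. rewrite E. ring. }
      field. repeat split; trivial.
  - replace n with j by lia. destruct (Nat.leb_spec (S (S j)) j); [lia|].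
    replace (S j - S j)%nat with O by lia. replace (j - j)%nat with O by lia.
    replace (S j + S j)%nat with (2 * S j)%nat by lia. replace (j + j)%nat with (2 * j)%nat by lia.
    replace (S j * S j)%nat with (j * j + (2 * j + 1))%nat by lia. rewrite Cpow_add_r.
    change (euler (q ^ 2) 0) with (RtoC 1).
    field. split; apply HE.
Qed.

(** The product is symmetric under z -> 1 / z, so both neighbours of the constant coefficient equal
    the one of index 1; hence the factor 2. *)
Lemma triple_coef_0 q n : unit_disc q ->
  triple_coef q (S n) 0 = (1 + q ^ (4 * n + 2)) * triple_coef q n 0
    + 2 * q ^ (2 * n + 1) * triple_coef q n 1.
Proof.
  intros Hq. assert (Hp : unit_disc (q ^ 2)) by (apply unit_disc_pow; trivial; lia).
  assert (HE := fun k => euler_neq_0 (q ^ 2) k Hp).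
  assert (HF := fun k => one_minus_neq_0 ((q ^ 2) ^ S k) (unit_disc_pow (q ^ 2) (S k) (Nat.lt_0_succ k) Hp)).
  unfold triple_coef. destruct n.
  - simpl. unfold euler; simpl. field. intros E. apply (HF O). simpl. rewrite <- E. ring.
  - simpl (0 <=? _)%nat. simpl (1 <=? S n)%nat. cbv iota.
    replace (2 * S (S n))%nat with (S (S (2 * S n))) by lia.
    replace (S (S n) + 0)%nat with (S (S n)) by lia. replace (S (S n) - 0)%nat with (S (S n)) by lia.
    replace (S n + 0)%nat with (S n) by lia. replace (S n - 0)%nat with (S n) by lia.
    replace (S n + 1)%nat with (S (S n)) by lia. replace (S n - 1)%nat with n by lia.
    assert (F1 := HF n). assert (F2 := HF (S n)). assert (G := HE n).
    rewrite !euler_S. revert F1 F2. rewrite <- !Cpow_mult_r.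
    replace (2 * S (2 * S n))%nat with (n + n + n + n + 6)%nat by lia.
    replace (2 * S (S (2 * S n)))%nat with (n + n + n + n + 8)%nat by lia.
    replace (2 * S (S n))%nat with (n + n + 4)%nat by lia.
    replace (2 * S n + 1)%nat with (n + n + 3)%nat by lia.
    replace (4 * S n + 2)%nat with (n + n + n + n + 6)%nat by lia.
    set (B := euler (q ^ 2) (2 * S n)).
    replace (2 * S n)%nat with (n + n + 2)%nat by lia.
    rewrite !Cpow_add_r. set (x := q ^ n). set (A := euler (q ^ 2) n) in *.
    simpl (0 * 0)%nat. simpl (1 * 1)%nat.
    intros. field. repeat split; trivial.
Qed.

(** At z = 1 the coefficients of z^j and z^(-j) merge into twice one of them. Summed over all
    indices, the recurrence multiplies the total by (1 + q^(2n+1))^2. *)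
Lemma triple_sum q n : unit_disc q ->
  triple_coef q n 0 + 2 * csum (fun j => triple_coef q n (S j)) n =
  cprod (fun k => (1 + q ^ (2 * k + 1)) * (1 + q ^ (2 * k + 1))) n.
Proof.
  intros Hq. induction n.
  - unfold triple_coef, euler; simpl. field.
  - change (cprod (fun k => (1 + q ^ (2 * k + 1)) * (1 + q ^ (2 * k + 1))) (S n)) with
      (cprod (fun k => (1 + q ^ (2 * k + 1)) * (1 + q ^ (2 * k + 1))) n *
        ((1 + q ^ (2 * n + 1)) * (1 + q ^ (2 * n + 1)))).
    rewrite <- IHn, triple_coef_0 by trivial.
    rewrite (csum_ext _ (fun j => (1 + q ^ (4 * n + 2)) * triple_coef q n (S j)
       + q ^ (2 * n + 1) * (triple_coef q n j + triple_coef q n (S (S j)))))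
      by (intros; apply triple_coef_S; trivial; lia).
    rewrite csum_plus, !csum_scal, csum_plus.
    assert (E0 : forall m, (n < m)%nat -> triple_coef q n m = 0).
    { intros m Hm. unfold triple_coef. destruct (Nat.leb_spec m n); [lia|trivial]. }
    set (T := csum (fun j => triple_coef q n (S j)) n).
    assert (E1 : csum (fun j => triple_coef q n (S j)) (S n) = T).
    { simpl. rewrite E0 by lia. fold T. ring. }
    assert (E2 : csum (triple_coef q n) (S n) = triple_coef q n 0 + T).
    { now rewrite csum_S_l. }
    assert (E3 : csum (fun j => triple_coef q n (S (S j))) (S n) = T - triple_coef q n 1).
    { assert (H := csum_S_l (fun j => triple_coef q n (S j)) (S n)).
      simpl csum at 1 in H. fold T in H. rewrite (E0 (S n)), (E0 (S (S n))) in H by lia.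
      replace T with (T + 0 + 0) by ring. rewrite H. ring. }
    rewrite E1, E2, E3.
    replace (4 * n + 2)%nat with ((2 * n + 1) + (2 * n + 1))%nat by lia.
    rewrite Cpow_add_r. ring.
Qed.

(** Odd exponents are isolated by quotients of Euler products. Free of denominators, each step
    reduces to (1 + X) (1 - X) = 1 - X^2 with X = q^(2n+1). *)
Lemma odd_product q n :
  cprod (fun k => 1 + q ^ (2 * k + 1)) n * (euler q (2 * n) * euler (q ^ 4) n) =
  euler (q ^ 2) (2 * n) * euler (q ^ 2) n.
Proof.
  induction n; [unfold euler; simpl; ring|].
  replace (2 * S n)%nat with (S (S (2 * n))) by lia. rewrite !euler_S.
  change (cprod (fun k => 1 + q ^ (2 * k + 1)) (S n)) with
    (cprod (fun k => 1 + q ^ (2 * k + 1)) n * (1 + q ^ (2 * n + 1))).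
  rewrite <- !Cpow_mult_r.
  replace (S (2 * n))%nat with (2 * n + 1)%nat by lia.
  replace (S (2 * n + 1))%nat with (2 * n + 2)%nat by lia.
  replace (4 * S n)%nat with ((2 * n + 2) + (2 * n + 2))%nat by lia.
  replace (2 * (2 * n + 1))%nat with ((2 * n + 1) + (2 * n + 1))%nat by lia.
  replace (2 * (2 * n + 2))%nat with ((2 * n + 2) + (2 * n + 2))%nat by lia.
  replace (2 * S n)%nat with (2 * n + 2)%nat by lia.
  rewrite (Cpow_add_r q (2 * n + 2) (2 * n + 2)), (Cpow_add_r q (2 * n + 1) (2 * n + 1)).
  set (X := q ^ (2 * n + 1)). set (Y := q ^ (2 * n + 2)).
  replace (cprod (fun k => 1 + q ^ (2 * k + 1)) n * (1 + X) *
    (euler q (2 * n) * (1 - X) * (1 - Y) * (euler (q ^ 4) n * (1 - Y * Y))))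
  with ((cprod (fun k => 1 + q ^ (2 * k + 1)) n * (euler q (2 * n) * euler (q ^ 4) n)) *
     ((1 + X) * (1 - X) * (1 - Y) * (1 - Y * Y))) by ring.
  rewrite IHn. ring.
Qed.

Lemma cprod_sqr u n : cprod (fun k => u k * u k) n = cprod u n * cprod u n.
Proof. induction n; simpl; [ring|]. rewrite IHn; ring. Qed.

(** Logarithm of P(q^2)^5 / (P(q)^2 P(q^4)^2) with Euler's product P, the classical eta quotient for
    theta00. *)
Definition theta_log (q : C) : C :=
  5 * euler_log (q ^ 2) - 2 * euler_log q - 2 * euler_log (q ^ 4).

(* Jacobi's triple product at [z = 1]. *)
Lemma theta_product q : unit_disc q ->
  csums (fun j => q ^ (j * j)) ((1 + Cexp (theta_log q)) / 2).
Proof.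
  intros Hq.
  assert (Hq2 : unit_disc (q ^ 2)) by (apply unit_disc_pow; trivial; lia).
  assert (Hq4 : unit_disc (q ^ 4)) by (apply unit_disc_pow; trivial; lia).
  set (P := Cexp (euler_log (q ^ 2))).
  assert (HP : P <> 0) by apply Cexp_neq_0.
  assert (L2 : Clim (euler (q ^ 2)) P) by now apply euler_lim.
  assert (Hsub : forall f, (forall N, exists K, forall n, (K <= n)%nat -> (N <= f n)%nat) ->
     Clim (fun n => euler (q ^ 2) (f n)) P).
  { intros f Hf. now apply Clim_subseq with (phi := f). }
  assert (Hdbl : forall N, exists K, forall n, (K <= n)%nat -> (N <= 2 * n)%nat)
    by (intros N; exists N; lia).
  (* The Euler products converge to a nonzero limit, so they and their inverses are bounded
     uniformly. This turns [triple_coef] into something dominated by a geometric sequence. *)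
  destruct (Clim_bounded _ _ L2) as [B1 HB1].
  destruct (Clim_bounded _ _ (Clim_inv _ _ L2 HP)) as [B2 HB2].
  assert (HB10 : (0 <= B1)%R) by (eapply Rle_trans; [apply Cmod_ge_0|apply (HB1 O)]).
  assert (HB20 : (0 <= B2)%R) by (eapply Rle_trans; [apply Cmod_ge_0|apply (HB2 O)]).
  assert (H0 := Cmod_ge_0 q).
  assert (Hl : forall j, Clim (fun n => triple_coef q n j) (q ^ (j * j) / P)).
  { intros j. apply Clim_ext_ev with (fun n => q ^ (j * j) * euler (q ^ 2) (2 * n) /
        (euler (q ^ 2) (n + j) * euler (q ^ 2) (n - j))) j.
    - intros n Hn. unfold triple_coef. destruct (Nat.leb_spec j n); [trivial|lia].
    - replace (q ^ (j * j) / P) with (q ^ (j * j) * P / (P * P)) by (field; trivial).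
      apply Clim_div; [apply Clim_scal|apply Clim_mult|now apply Cmult_neq_0];
        apply Hsub; trivial; intros N; exists (N + j)%nat; lia. }
  destruct (tannery (fun n j => triple_coef q n (S j)) (fun j => q ^ (S j * S j) / P)
     (fun j => (B1 * (B2 * B2) * Cmod q ^ j)%R)) as [Hs Ht].
  - intros n j. unfold triple_coef. destruct (Nat.leb_spec (S j) n).
    + unfold Cdiv. rewrite Cmod_mult, Cmod_inv, !Cmod_mult
        by (apply Cmult_neq_0; now apply euler_neq_0).
      rewrite Rinv_mult, <- !Cmod_inv by now apply euler_neq_0.
      rewrite Cmod_pow.
      replace (Cmod q ^ (S j * S j) * Cmod (euler (q ^ 2) (2 * n)) *
        (Cmod (/ euler (q ^ 2) (n + S j)) * Cmod (/ euler (q ^ 2) (n - S j))))%R with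
       ((Cmod (euler (q ^ 2) (2 * n)) *
        (Cmod (/ euler (q ^ 2) (n + S j)) * Cmod (/ euler (q ^ 2) (n - S j)))) *
         Cmod q ^ (S j * S j))%R by ring.
      apply Rmult_le_compat.
      * repeat apply Rmult_le_pos; apply Cmod_ge_0.
      * now apply pow_le.
      * apply Rmult_le_compat; trivial; try apply Cmod_ge_0.
        -- apply Rmult_le_pos; apply Cmod_ge_0.
        -- apply Rmult_le_compat; trivial; apply Cmod_ge_0.
      * apply pow_decr; [unfold unit_disc in Hq; lra|lia].
    + rewrite Cmod_0. apply Rmult_le_pos; [repeat apply Rmult_le_pos; trivial|now apply pow_le].
  - apply rsummable_scal; [repeat apply Rmult_le_pos; trivial|]. now apply rsummable_geom.
  - intros j. apply Hl.
  - set (s := CSeries (fun j => q ^ (S j * S j) / P)) in *.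
    assert (L1 : Clim (fun n => cprod (fun k => (1 + q ^ (2 * k + 1)) * (1 + q ^ (2 * k + 1))) n)
                   (1 / P + 2 * s)).
    { apply Clim_ext with (fun n => triple_coef q n 0 + 2 * CSeries (fun j => triple_coef q n (S j))).
      - intros n. rewrite <- triple_sum by trivial. do 2 f_equal. apply csums_CSeries.
        apply csums_finite. intros k Hk. unfold triple_coef.
        destruct (Nat.leb_spec (S k) n); [lia|trivial].
      - apply Clim_plus; [apply (Hl O)|now apply Clim_scal]. }
    set (P1 := Cexp (euler_log q)). set (P4 := Cexp (euler_log (q ^ 4))).
    assert (HP1 : P1 <> 0) by apply Cexp_neq_0. assert (HP4 : P4 <> 0) by apply Cexp_neq_0.
    assert (L3 : Clim (fun n => cprod (fun k => 1 + q ^ (2 * k + 1)) n) (P * P / (P1 * P4))).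
    { apply Clim_ext with (fun n => euler (q ^ 2) (2 * n) * euler (q ^ 2) n /
         (euler q (2 * n) * euler (q ^ 4) n)).
      - intros n. rewrite <- odd_product. field. split; now apply euler_neq_0.
      - apply Clim_div; [apply Clim_mult|apply Clim_mult|now apply Cmult_neq_0].
        + now apply Hsub.
        + trivial.
        + apply Clim_subseq with (phi := fun n => (2 * n)%nat); trivial. now apply euler_lim.
        + now apply euler_lim. }
    assert (E : 1 / P + 2 * s = P * P / (P1 * P4) * (P * P / (P1 * P4))).
    { apply Clim_unique with (1 := L1).
      apply Clim_ext with (2 := Clim_mult _ _ _ _ L3 L3). intros n. now rewrite <- cprod_sqr. }
    (* Multiplying [E] by [P] gives 1 + 2 (q + q^4 + q^9 + ...) = P^5 / (P1 P4)^2. *)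
    assert (EL : Cexp (theta_log q) = 1 + 2 * (P * s)).
    { replace (1 + 2 * (P * s)) with (P * (1 / P + 2 * s)) by (field; trivial). rewrite E.
      unfold theta_log. set (a := euler_log (q ^ 2)) in *. set (b := euler_log q) in *.
      set (c := euler_log (q ^ 4)) in *.
      replace (5 * a - 2 * b - 2 * c) with (a + (a + a + (a + a)) - (b + c + (b + c))) by ring.
      rewrite Cexp_minus, !Cexp_add. fold P P1 P4. field. split; trivial. }
    rewrite EL. replace ((1 + (1 + 2 * (P * s))) / 2) with (q ^ (0 * 0) + P * s) by (simpl; field).
    apply (csums_S (fun j => q ^ (j * j))).
    apply csums_ext with (fun j => P * (q ^ (S j * S j) / P)); [intros; field; trivial|].
    apply csums_scal. now apply abs_summable_csums.
Qed.

(** * Lipschitz' partial fraction formulas *)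

Definition twopii : C := 2 * RtoC PI * Ci.

(** Finite stand-in for the exponential: N (1 - Eroot N w) tends to - 2 pi i w, so exact partial
    fractions over the N-th roots of unity turn into Lipschitz' series as N grows. *)
Definition Eroot (N : nat) (w : C) : C := Cexp (twopii * w / RtoC (INR N)).

Lemma twopii_neq_0 : twopii <> 0.
Proof.
  assert (H := PI_RGT_0).
  unfold twopii. repeat apply Cmult_neq_0; try apply Ci_nz; intros E; injection E; lra.
Qed.

Lemma Cexp_twopii : Cexp twopii = 1.
Proof.
  unfold twopii, Cexp. apply C_ext; simpl.
  - replace ((2 * PI - 0 * 0) * 0 - (2 * 0 + 0 * PI) * 1)%R with 0%R by ring.
    replace ((2 * PI - 0 * 0) * 1 + (2 * 0 + 0 * PI) * 0)%R with (2 * PI)%R by ring.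
    rewrite exp_0, cos_2PI. ring.
  - replace ((2 * PI - 0 * 0) * 0 - (2 * 0 + 0 * PI) * 1)%R with 0%R by ring.
    replace ((2 * PI - 0 * 0) * 1 + (2 * 0 + 0 * PI) * 0)%R with (2 * PI)%R by ring.
    rewrite exp_0, sin_2PI. ring.
Qed.

Lemma Re_twopii w : Re (twopii * w) = (- (2 * PI * Im w))%R.
Proof. unfold twopii. simpl. unfold Im. ring. Qed.

Lemma Cmod_twopii : Cmod twopii = (2 * PI)%R.
Proof.
  unfold twopii. rewrite !Cmod_mult, Cmod_Ci, !Cmod_R, !Rabs_pos_eq; [ring|generalize PI_RGT_0; lra|lra].
Qed.

Lemma Cmod_one_minus_Cexp_i (t : R) : Cmod (1 - Cexp (Ci * RtoC t)) = (2 * Rabs (sin (t / 2)))%R.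
Proof.
  unfold Cmod. simpl fst; simpl snd.
  replace (0 * t - 1 * 0)%R with 0%R by ring. replace (0 * 0 + 1 * t)%R with t by ring.
  rewrite exp_0. apply sqrt_lem_1.
  - apply Rplus_le_le_0_compat; apply pow2_ge_0.
  - generalize (Rabs_pos (sin (t / 2))). lra.
  - replace (2 * Rabs (sin (t / 2)) * (2 * Rabs (sin (t / 2))))%R
      with (4 * (Rabs (sin (t / 2)) * Rabs (sin (t / 2))))%R by ring.
    rewrite <- Rabs_mult, Rabs_pos_eq by nra.
    assert (Hc : (cos t = 1 - 2 * sin (t / 2) * sin (t / 2))%R)
      by (rewrite <- cos_2a_sin; f_equal; field).
    assert (H1 : (Rsqr (sin t) + Rsqr (cos t) = 1)%R) by apply sin2_cos2.
    unfold Rsqr in H1.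
    replace ((1 + - (1 * cos t)) ^ 2 + (0 + - (1 * sin t)) ^ 2)%R
      with (1 - 2 * cos t + (sin t * sin t + cos t * cos t))%R by ring.
    rewrite H1, Hc. ring.
Qed.

Lemma INR_pos_neq_0 N : (0 < N)%nat -> RtoC (INR N) <> 0.
Proof. destruct N; [lia|]. intros _. apply INR_S_neq_0. Qed.

Lemma Eroot_add N w v : Eroot N (w + v) = Eroot N w * Eroot N v.
Proof. unfold Eroot. rewrite <- Cexp_add. f_equal. unfold Cdiv. ring. Qed.

Lemma Eroot_INR N w k : Eroot N (RtoC (INR k) * w) = Eroot N w ^ k.
Proof. unfold Eroot. rewrite <- Cexp_INR. f_equal. unfold Cdiv. ring. Qed.

Lemma Eroot_N N w : (0 < N)%nat -> Eroot N (RtoC (INR N) * w) = Cexp (twopii * w).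
Proof. intros HN. unfold Eroot. f_equal. field. now apply INR_pos_neq_0. Qed.

Lemma Eroot_period N w : (0 < N)%nat -> Eroot N (w + RtoC (INR N)) = Eroot N w.
Proof.
  intros HN. rewrite Eroot_add. replace (RtoC (INR N)) with (RtoC (INR N) * 1) by ring.
  rewrite Eroot_N, Cmult_1_r, Cexp_twopii by trivial. ring.
Qed.

Lemma Cmod_one_minus_root N (k : R) : (0 < N)%nat ->
  Cmod (1 - Eroot N (RtoC k)) = (2 * Rabs (sin (PI * k / INR N)))%R.
Proof.
  intros HN. unfold Eroot, twopii.
  assert (INR N <> 0)%R by (apply not_0_INR; lia).
  replace (2 * RtoC PI * Ci * RtoC k / RtoC (INR N)) with (Ci * RtoC (2 * (PI * k / INR N))).
  2:{ rewrite RtoC_mult, RtoC_div, RtoC_mult by trivial. field. now apply INR_pos_neq_0. }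
  rewrite Cmod_one_minus_Cexp_i. do 3 f_equal. field. trivial.
Qed.

Lemma csum_geom (w : C) n : (1 - w) * csum (fun k => w ^ k) n = 1 - w ^ n.
Proof. induction n; simpl; [ring|]. rewrite Cmult_plus_distr_l, IHn. ring. Qed.

Lemma root_power_sum N j : (0 < j < N)%nat -> csum (fun k => (Eroot N 1 ^ j) ^ k) N = 0.
Proof.
  intros Hj. assert (HN : (0 < N)%nat) by lia.
  assert (H := csum_geom (Eroot N 1 ^ j) N).
  assert (Hr : (Eroot N 1 ^ j) ^ N = 1).
  { rewrite <- Cpow_mult_r, Nat.mul_comm, Cpow_mult_r, <- Eroot_INR, Eroot_N by trivial.
    rewrite Cmult_1_r, Cexp_twopii. apply Cpow_1_l. }
  rewrite Hr in H.
  assert (Hne : 1 - Eroot N 1 ^ j <> 0).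
  { apply Cmod_gt_0. rewrite <- Eroot_INR, Cmult_1_r, Cmod_one_minus_root by trivial.
    assert (0 < sin (PI * INR j / INR N))%R.
    { assert (H1 : (0 < INR j)%R) by (apply lt_0_INR; lia).
      assert (H2 : (INR j < INR N)%R) by (apply lt_INR; lia).
      assert (H3 := PI_RGT_0).
      apply sin_gt_0.
      - apply Rdiv_lt_0_compat; [now apply Rmult_lt_0_compat|lra].
      - apply Rlt_div_l; [lra|]. now apply Rmult_lt_compat_l. }
    rewrite Rabs_pos_eq; lra. }
  replace (csum (fun k => (Eroot N 1 ^ j) ^ k) N) with
    (/ (1 - Eroot N 1 ^ j) * ((1 - Eroot N 1 ^ j) * csum (fun k => (Eroot N 1 ^ j) ^ k) N)) by (field; trivial).
  rewrite H. ring.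
Qed.

Lemma Cmod_root N k : Cmod (Eroot N 1 ^ k) = 1%R.
Proof.
  rewrite Cmod_pow. unfold Eroot. rewrite Cmod_Cexp. unfold Cdiv.
  rewrite <- Cmult_assoc, Re_twopii, Cmult_1_l.
  destruct N.
  - simpl. unfold Rdiv. rewrite Ropp_0, !Rmult_0_l, Rmult_0_r, Ropp_0, exp_0. apply pow1.
  - rewrite <- RtoC_inv by (apply not_0_INR; lia). rewrite im_RtoC, Rmult_0_r, Ropp_0, exp_0. apply pow1.
Qed.

Lemma unit_disc_root N k y : unit_disc y -> unit_disc (y * Eroot N 1 ^ k).
Proof. unfold unit_disc. now rewrite Cmod_mult, Cmod_root, Rmult_1_r. Qed.

(** Each u = y zeta^k satisfies u^N = y^N, hence 1 / (1 - u) = (1 + u + ... + u^(N-1)) / (1 - y^N);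
    the sum over the roots of unity kills every power except u^0. *)
Lemma root_partial_fractions N y : (0 < N)%nat -> unit_disc y ->
  csum (fun k => / (1 - y * Eroot N 1 ^ k)) N = RtoC (INR N) / (1 - y ^ N).
Proof.
  intros HN Hy.
  assert (HyN : 1 - y ^ N <> 0) by (apply one_minus_neq_0; now apply unit_disc_pow).
  assert (HrN : forall k, (Eroot N 1 ^ k) ^ N = 1).
  { intros k. rewrite <- Cpow_mult_r, Nat.mul_comm, Cpow_mult_r, <- Eroot_INR, Eroot_N by trivial.
    rewrite Cmult_1_r, Cexp_twopii. apply Cpow_1_l. }
  rewrite (csum_ext _ (fun k => / (1 - y ^ N) * csum (fun j => y ^ j * (Eroot N 1 ^ j) ^ k) N)).
  - rewrite csum_scal, <- csum_swap.
    rewrite (csum_ext _ (fun j => if (j =? 0)%nat then RtoC (INR N) else 0)).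
    + destruct N as [|N]; [lia|]. rewrite csum_S_l. simpl Nat.eqb. cbv iota.
      rewrite csum_zero. field. trivial.
    + intros j Hj. rewrite csum_scal. destruct (Nat.eqb_spec j 0) as [->|E].
      * simpl. rewrite (csum_ext _ (fun _ => 1)) by (intros; apply Cpow_1_l).
        clear. induction N; [simpl; ring|]. rewrite S_INR, RtoC_plus. simpl csum.
        rewrite Cmult_plus_distr_l, IHN. ring.
      * rewrite root_power_sum by lia. ring.
  - intros k _. set (u := y * Eroot N 1 ^ k).
    assert (Hu : 1 - u <> 0) by (apply one_minus_neq_0; now apply unit_disc_root).
    rewrite (csum_ext _ (fun j => u ^ j)).
    + assert (H := csum_geom u N). replace (u ^ N) with (y ^ N) in H.
      2:{ unfold u. rewrite Cpow_mult_l, HrN. ring. }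
      rewrite <- H. field. split; trivial.
      intros E. apply HyN. rewrite <- H, E. ring.
    + intros j _. unfold u. rewrite Cpow_mult_l, <- !Cpow_mult_r. now rewrite (Nat.mul_comm k j).
Qed.

Lemma Cder_csum (f : nat -> C -> C) (d : nat -> C) z n :
  (forall k, (k < n)%nat -> Cder (f k) z (d k)) ->
  Cder (fun w => csum (fun k => f k w) n) z (csum d n).
Proof.
  induction n; intros H; simpl; [apply Cder_const|].
  apply (Cder_plus (fun w => csum (fun k => f k w) n)); auto.
Qed.

Lemma Cder_pow n z : Cder (fun w => w ^ n) z (RtoC (INR n) * z ^ pred n).
Proof.
  induction n.
  - simpl. apply Cder_eq with (RtoC 0); [ring|apply Cder_const].
  - apply Cder_eq with (1 * z ^ n + z * (RtoC (INR n) * z ^ pred n)).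
    + rewrite S_INR, RtoC_plus. destruct n; simpl; ring.
    + apply (Cder_mult (fun w => w) (fun w => w ^ n)); trivial. apply Cder_id.
Qed.

Lemma Cder_inv_comp f z l : Cder f z l -> f z <> 0 -> Cder (fun w => / f w) z (- l / (f z * f z)).
Proof.
  intros H Hz. apply Cder_eq with (l * - / (f z * f z)); [unfold Cdiv; ring|].
  apply (Cder_comp Cinv); trivial. now apply Cder_inv.
Qed.

(** The derivative in [y] of [root_partial_fractions], multiplied by [y]. *)
Lemma root_partial_fractions_sqr N y : (0 < N)%nat -> unit_disc y ->
  csum (fun k => (y * Eroot N 1 ^ k) / ((1 - y * Eroot N 1 ^ k) * (1 - y * Eroot N 1 ^ k))) N =
  RtoC (INR N) * RtoC (INR N) * y ^ N / ((1 - y ^ N) * (1 - y ^ N)).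
Proof.
  intros HN Hy. assert (HyN : 1 - y ^ N <> 0) by (apply one_minus_neq_0; now apply unit_disc_pow).
  assert (D1 : Cder (fun y => csum (fun k => / (1 - y * Eroot N 1 ^ k)) N) y
     (csum (fun k => Eroot N 1 ^ k / ((1 - y * Eroot N 1 ^ k) * (1 - y * Eroot N 1 ^ k))) N)).
  { apply (Cder_csum (fun k y => / (1 - y * Eroot N 1 ^ k))). intros k Hk.
    assert (Hu : 1 - y * Eroot N 1 ^ k <> 0)
      by (apply one_minus_neq_0; now apply unit_disc_root).
    apply Cder_eq with (- (0 - (1 * Eroot N 1 ^ k + y * 0)) /
       ((1 - y * Eroot N 1 ^ k) * (1 - y * Eroot N 1 ^ k))).
    - field; trivial.
    - apply (Cder_inv_comp (fun y => 1 - y * Eroot N 1 ^ k)); trivial.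
      apply Cder_minus; [apply Cder_const|].
      apply (Cder_mult (fun y => y) (fun _ => Eroot N 1 ^ k)); [apply Cder_id|apply Cder_const]. }
  assert (D2 : Cder (fun y => csum (fun k => / (1 - y * Eroot N 1 ^ k)) N) y
     (RtoC (INR N) * (- (0 - RtoC (INR N) * y ^ pred N) / ((1 - y ^ N) * (1 - y ^ N))))).
  { apply Cder_ext_loc with (fun y => RtoC (INR N) * / (1 - y ^ N)) (1 - Cmod y)%R.
    - unfold unit_disc in Hy. lra.
    - intros w Hw. symmetry. apply root_partial_fractions; trivial.
      unfold unit_disc. generalize (Cmod_triangle (w - y) y).
      replace (w - y + y) with w by ring. lra.
    - apply Cder_scal. apply (Cder_inv_comp (fun y => 1 - y ^ N)); trivial.
      apply Cder_minus; [apply Cder_const|apply Cder_pow]. }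
  assert (E := Cder_unique _ _ _ _ D1 D2).
  rewrite (csum_ext _ (fun k => y * (Eroot N 1 ^ k / ((1 - y * Eroot N 1 ^ k) * (1 - y * Eroot N 1 ^ k))))).
  - rewrite csum_scal, E. destruct N; [lia|]. simpl pred. simpl in HyN |- *. field. trivial.
  - intros k _. unfold Cdiv. ring.
Qed.

Lemma csum_rev (u : nat -> C) n : csum u n = csum (fun k => u (n - S k)%nat) n.
Proof.
  induction n; trivial. rewrite (csum_S_l (fun k => u (S n - S k)%nat)).
  change (csum u (S n)) with (csum u n + u n). rewrite IHn.
  replace (S n - 1)%nat with n by lia. rewrite Cplus_comm. reflexivity.
Qed.

Lemma csum_odd_symmetric (u : nat -> C) n :
  csum u (2 * n + 1) = u O + csum (fun k => u (S k) + u (2 * n - k)%nat) n.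
Proof.
  replace (2 * n + 1)%nat with (S (n + n)) by lia.
  rewrite csum_S_l, csum_add, csum_plus. f_equal. f_equal.
  rewrite csum_rev. apply csum_ext. intros k Hk. f_equal. lia.
Qed.

(** An odd modulus has the symmetric residue system 0, 1, -1, ..., n, -n, which matches the pairing
    of k with -k in the limit. *)
Definition Nodd (n : nat) : nat := (2 * n + 1)%nat.

Lemma Eroot_sum_symmetric (F : C -> C) z n :
  csum (fun k => F (Eroot (Nodd n) z * Eroot (Nodd n) 1 ^ k)) (Nodd n) =
  F (Eroot (Nodd n) z) +
  csum (fun k => F (Eroot (Nodd n) (z + RtoC (INR (S k)))) + F (Eroot (Nodd n) (z - RtoC (INR (S k))))) n.
Proof.
  unfold Nodd at 3. rewrite csum_odd_symmetric. f_equal; [f_equal; simpl; ring|].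
  apply csum_ext. intros k Hk. f_equal; f_equal; rewrite <- Eroot_INR, <- Eroot_add.
  - f_equal. ring.
  (* The index 2n - k represents -(k + 1) modulo 2n + 1. *)
  - rewrite <- (Eroot_period _ (z - _)) by (unfold Nodd; lia). f_equal.
    replace (Nodd n) with ((2 * n - k) + S k)%nat by (unfold Nodd; lia).
    rewrite plus_INR, RtoC_plus. ring.
Qed.

Lemma upper_Eroot N z : (0 < N)%nat -> upper z -> unit_disc (Eroot N z).
Proof.
  intros HN Hz. unfold unit_disc, Eroot. rewrite Cmod_Cexp. rewrite <- exp_0. apply exp_increasing.
  unfold Cdiv. rewrite <- RtoC_inv by (apply not_0_INR; lia).
  rewrite re_scal_r, Re_twopii.
  assert (0 < / INR N)%R by (apply Rinv_0_lt_compat, lt_0_INR; lia).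
  assert (H1 := PI_RGT_0). unfold upper in Hz.
  assert (0 < PI * Im z)%R by now apply Rmult_lt_0_compat. nra.
Qed.

(** For |w| <= 1 / 2 the quadratic bound gives 11 |w|; otherwise the trivial bound 2 is below 4
    |w|. *)
Lemma Cmod_one_minus_Cexp_le w : (Re w <= 0)%R -> (Cmod (1 - Cexp w) <= 12 * Cmod w)%R.
Proof.
  intros Hw. destruct (Rle_dec (Cmod w) (1 / 2)) as [H|H].
  - assert (Hq := Cexp_quad w H). replace (1 - Cexp w) with (- (Cexp w - 1 - w) + - w) by ring.
    eapply Rle_trans; [apply Cmod_triangle|]. rewrite !Cmod_opp.
    generalize (Cmod_ge_0 w). nra.
  - eapply Rle_trans; [apply Cmod_triangle|]. rewrite Cmod_opp, Cmod_1, Cmod_Cexp.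
    assert (exp (Re w) <= 1)%R; [|lra]. rewrite <- exp_0. destruct Hw as [Hw| ->]; [|lra].
    left. now apply exp_increasing.
Qed.

Lemma Eroot_near_1 N z : (0 < N)%nat -> upper z ->
  (INR N * Cmod (1 - Eroot N z) <= 24 * PI * Cmod z)%R.
Proof.
  intros HN Hz. assert (Hi : (0 < INR N)%R) by (apply lt_0_INR; lia).
  assert (Hre : (Re (twopii * z / RtoC (INR N)) <= 0)%R).
  { unfold Cdiv. rewrite <- RtoC_inv by lra. rewrite re_scal_r, Re_twopii.
    assert (0 < / INR N)%R by now apply Rinv_0_lt_compat.
    assert (H1 := PI_RGT_0). unfold upper in Hz.
    assert (0 < PI * Im z)%R by now apply Rmult_lt_0_compat. nra. }
  assert (H := Cmod_one_minus_Cexp_le _ Hre).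
  rewrite Cmod_div, Cmod_mult, Cmod_twopii, Cmod_R, Rabs_pos_eq in H by (lra || now apply INR_pos_neq_0).
  apply Rle_trans with (INR N * (12 * (2 * PI * Cmod z / INR N)))%R.
  - apply Rmult_le_compat_l; [lra|exact H].
  - right. field. lra.
Qed.

Lemma Eroot_real N (k : R) : (0 < N)%nat -> Cmod (Eroot N (RtoC k)) = 1%R.
Proof.
  intros HN. unfold Eroot. rewrite Cmod_Cexp. unfold Cdiv.
  rewrite <- RtoC_inv by (apply not_0_INR; lia).
  rewrite re_scal_r, Re_twopii, im_RtoC, Rmult_0_r, Ropp_0, Rmult_0_l. apply exp_0.
Qed.

(** Uniform growth for Tannery's theorem. The modulus of [Eroot] alone keeps the quantity above the
    constant [c]; the distance of a root of unity from 1 gives 3 / 2 [INR (S m)] - [B], where [B]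
    bounds the effect of [z]. The second bound serves when [INR (S m) >= B], the first in the
    remaining cases. The condition [S m <= n] keeps the angle within PI / 2, where [sin_lower]
    applies. *)
Lemma Eroot_far_from_1 z : upper z -> exists d, (0 < d)%R /\
  forall n m (s : R), (S m <= n)%nat -> Rabs s = INR (S m) ->
    (d * INR (S m) <= INR (Nodd n) * Cmod (1 - Eroot (Nodd n) (z + RtoC s)))%R.
Proof.
  intros Hz. assert (HPI := PI_RGT_0). assert (HPI3 : (3 < PI)%R) by (generalize PI2_3_2; lra).
  set (t := (2 * PI * Im z)%R).
  assert (Ht : (0 < t)%R) by (unfold t, upper in *; nra).
  (* Since exp (- t / N) <= 1 / (1 + t / N), the quantity N (1 - exp (- t / N)) is at least t / (1 +
     t / N) >= t / (1 + t). *)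
  set (c := (t / (1 + t))%R). assert (Hc : (0 < c)%R) by (apply Rdiv_lt_0_compat; lra).
  set (B := (24 * PI * Cmod z)%R).
  assert (HB : (0 < B)%R).
  { unfold B. assert (0 < Cmod z)%R; [|nra]. apply Rlt_le_trans with (2 := Im_le_Cmod z).
    unfold upper in Hz. rewrite Rabs_pos_eq; lra. }
  exists (Rmin (1 / 2) (c / B)). split.
  { apply Rmin_pos; [lra|]. now apply Rdiv_lt_0_compat. }
  intros n m s Hm Hs.
  assert (HN : (0 < Nodd n)%nat) by (unfold Nodd; lia).
  set (N := Nodd n) in *. assert (Hi : (1 <= INR N)%R) by (apply (le_INR 1); lia).
  assert (HM : (0 < INR (S m))%R) by (apply lt_0_INR; lia).
  assert (L1 : (c <= INR N * Cmod (1 - Eroot N (z + RtoC s)))%R).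
  { assert (Hd := Cmod_triangle_rev 1 (- Eroot N (z + RtoC s))).
    rewrite Cmod_opp, Cmod_1, Eroot_add, Cmod_mult, Eroot_real, Rmult_1_r in Hd by trivial.
    assert (Hm2 : Cmod (Eroot N z) = exp (- (t / INR N))).
    { unfold Eroot. rewrite Cmod_Cexp. f_equal. unfold Cdiv. rewrite <- RtoC_inv by lra.
      rewrite re_scal_r, Re_twopii. unfold t. field. lra. }
    rewrite Hm2 in Hd. set (a := (t / INR N)%R) in *.
    assert (Ha : (0 < a)%R) by (apply Rdiv_lt_0_compat; lra).
    assert (Hexp : (exp (- a) <= / (1 + a))%R).
    { rewrite exp_Ropp. apply Rinv_le_contravar; [lra|]. apply exp_ineq1_le. }
    apply Rle_trans with (INR N * (1 - / (1 + a)))%R.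
    - unfold c. replace (INR N * (1 - / (1 + a)))%R with (t / (1 + a))%R by (unfold a; field; split; [lra|nra]).
      unfold Rdiv. apply Rmult_le_compat_l; [lra|]. apply Rinv_le_contravar; [lra|].
      apply Rplus_le_compat_l. unfold a. apply Rle_div_l; [lra|nra].
    - apply Rmult_le_compat_l; [lra|]. rewrite Eroot_add.
      unfold Cminus. eapply Rle_trans; [|apply Hd]. lra. }
  assert (L2 : (INR (S m) * (3 / 2) - B <= INR N * Cmod (1 - Eroot N (z + RtoC s)))%R).
  { replace (1 - Eroot N (z + RtoC s)) with
      ((1 - Eroot N (RtoC s)) + Eroot N (RtoC s) * (1 - Eroot N z))
      by (rewrite Eroot_add; ring).
    assert (H1 := Cmod_triangle_rev (1 - Eroot N (RtoC s)) (Eroot N (RtoC s) * (1 - Eroot N z))).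
    rewrite Cmod_mult, Eroot_real, Rmult_1_l, Cmod_one_minus_root in H1 by trivial.
    assert (H2 := Eroot_near_1 N z HN Hz). fold B in H2.
    assert (H3 : (INR (S m) * (3 / 2) <= INR N * (2 * Rabs (sin (PI * s / INR N))))%R).
    { assert (Ea : Rabs (sin (PI * s / INR N)) = Rabs (sin (PI * INR (S m) / INR N))).
      { rewrite <- Hs. destruct (Rcase_abs s) as [Hneg|Hpos].
        - rewrite (Rabs_left s) by trivial.
          replace (PI * - s / INR N)%R with (- (PI * s / INR N))%R by (field; lra).
          now rewrite sin_neg, Rabs_Ropp.
        - rewrite (Rabs_right s) by trivial. reflexivity. }
      rewrite Ea. set (x := (PI * INR (S m) / INR N)%R).
      assert (Hx0 : (0 < x)%R).
      { apply Rdiv_lt_0_compat; [now apply Rmult_lt_0_compat|lra]. }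
      assert (Hx1 : (x <= PI / 2)%R).
      { apply Rle_div_l; [lra|]. assert (2 * INR (S m) <= INR N)%R; [|nra].
        rewrite <- (mult_INR 2). apply le_INR. unfold N, Nodd. lia. }
      assert (Hsin := sin_lower x ltac:(lra)).
      rewrite Rabs_pos_eq by lra.
      apply Rle_trans with (INR N * (2 * (x / 4)))%R.
      - unfold x. replace (INR N * (2 * (PI * INR (S m) / INR N / 4)))%R with (INR (S m) * (PI / 2))%R
          by (field; lra). apply Rmult_le_compat_l; lra.
      - apply Rmult_le_compat_l; lra. }
    apply Rle_trans with (INR N * (2 * Rabs (sin (PI * s / INR N)) - Cmod (1 - Eroot N z)))%R.
    - rewrite Rmult_minus_distr_l. lra.
    - apply Rmult_le_compat_l; lra. }
  destruct (Rle_dec B (INR (S m))) as [Hle|Hgt].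
  - eapply Rle_trans; [|apply L2].
    apply Rle_trans with (1 / 2 * INR (S m))%R; [|lra].
    apply Rmult_le_compat_r; [lra|apply Rmin_l].
  - eapply Rle_trans; [|apply L1].
    apply Rle_trans with (c / B * B)%R; [|right; field; lra].
    apply Rmult_le_compat; try lra; [|apply Rmin_r].
    left. apply Rmin_pos; [lra|]. now apply Rdiv_lt_0_compat.
Qed.

Lemma Clim_inv_Nodd : Clim (fun n => / RtoC (INR (Nodd n))) 0.
Proof.
  apply Clim_eps. intros eps He. destruct (nfloor_ex (/ eps)) as [K HK].
  { left. now apply Rinv_0_lt_compat. }
  exists K. intros n Hn.
  assert (Hi : (0 < INR (Nodd n))%R) by (apply lt_0_INR; unfold Nodd; lia).
  replace (/ RtoC (INR (Nodd n)) - 0) with (/ RtoC (INR (Nodd n))) by ring.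
  rewrite Cmod_inv, Cmod_R, Rabs_pos_eq by (lra || apply INR_pos_neq_0; unfold Nodd; lia).
  rewrite <- (Rinv_inv eps). apply Rinv_lt_contravar.
  - apply Rmult_lt_0_compat; trivial. now apply Rinv_0_lt_compat.
  - destruct HK as [_ HK]. eapply Rlt_le_trans; [apply HK|].
    rewrite <- S_INR. apply le_INR. unfold Nodd. lia.
Qed.

Lemma Eroot_lim w : Clim (fun n => Eroot (Nodd n) w) 1.
Proof.
  rewrite <- Cexp_0. unfold Eroot. apply Clim_Cexp.
  replace (RtoC 0) with (twopii * w * 0) by ring. apply Clim_scal. apply Clim_inv_Nodd.
Qed.

(** The derivative of the exponential at 0: with h = 2 pi i w / N, the error N |h|^2 from
    [Cexp_quad] is of order 1 / N. *)
Lemma Eroot_slope_lim w :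
  Clim (fun n => RtoC (INR (Nodd n)) * (1 - Eroot (Nodd n) w)) (- (twopii * w)).
Proof.
  apply Clim_eps. intros eps He.
  set (M := Cmod (twopii * w)). assert (HM : (0 <= M)%R) by apply Cmod_ge_0.
  destruct (proj1 (Clim_eps _ _) Clim_inv_Nodd (Rmin (/ (2 * (M + 1))) (eps / (20 * (M + 1) * (M + 1)))))%R
    as [K HK].
  { apply Rmin_pos; [apply Rinv_0_lt_compat; lra|apply Rdiv_lt_0_compat; trivial; nra]. }
  exists K. intros n Hn. specialize (HK n Hn).
  set (N := Nodd n) in *.
  assert (Hi : (0 < INR N)%R) by (apply lt_0_INR; unfold N, Nodd; lia).
  assert (HN0 : RtoC (INR N) <> 0) by (apply INR_pos_neq_0; unfold N, Nodd; lia).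
  replace (/ RtoC (INR N) - 0) with (/ RtoC (INR N)) in HK by ring.
  rewrite Cmod_inv, Cmod_R, Rabs_pos_eq in HK by (trivial; lra).
  assert (H1 : (/ INR N < / (2 * (M + 1)))%R) by (eapply Rlt_le_trans; [apply HK|apply Rmin_l]).
  assert (H2 : (/ INR N < eps / (20 * (M + 1) * (M + 1)))%R) by (eapply Rlt_le_trans; [apply HK|apply Rmin_r]).
  assert (H0 : (0 < / INR N)%R) by now apply Rinv_0_lt_compat.
  set (h := twopii * w / RtoC (INR N)).
  assert (Hh : Cmod h = (M * / INR N)%R).
  { unfold h. rewrite Cmod_div, Cmod_R, Rabs_pos_eq by (trivial; lra). reflexivity. }
  assert (Hh2 : (Cmod h <= 1 / 2)%R).
  { rewrite Hh. apply Rle_trans with ((M + 1) * / (2 * (M + 1)))%R; [|right; field; lra].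
    apply Rmult_le_compat; lra. }
  replace (RtoC (INR N) * (1 - Eroot N w) - - (twopii * w)) with (- (RtoC (INR N) * (Cexp h - 1 - h))).
  2:{ unfold Eroot. fold h. replace (twopii * w) with (RtoC (INR N) * h) by (unfold h; field; trivial). ring. }
  rewrite Cmod_opp, Cmod_mult, Cmod_R, Rabs_pos_eq by lra.
  apply Rle_lt_trans with (INR N * (20 * (Cmod h * Cmod h)))%R.
  - apply Rmult_le_compat_l; [lra|]. now apply Cexp_quad.
  - rewrite Hh. replace (INR N * (20 * (M * / INR N * (M * / INR N))))%R
      with (20 * M * M * / INR N)%R by (field; lra).
    apply Rle_lt_trans with (20 * (M + 1) * (M + 1) * / INR N)%R.
    + apply Rmult_le_compat_r; nra.
    + apply Rlt_le_trans with (20 * (M + 1) * (M + 1) * (eps / (20 * (M + 1) * (M + 1))))%R.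
      * apply Rmult_lt_compat_l; trivial. nra.
      * right. field. lra.
Qed.

Lemma rsummable_inv_sqr : rsummable (fun k => / (INR (S k) * INR (S k)))%R.
Proof.
  assert (H : forall n, (rsum (fun k => / (INR (S k) * INR (S k))) (S n) <= 2 - / INR (S n))%R).
  { induction n.
    - simpl. rewrite Rmult_1_r, Rinv_1. lra.
    - change (rsum (fun k => / (INR (S k) * INR (S k))) (S (S n)))%R with
       (rsum (fun k => / (INR (S k) * INR (S k))) (S n) + / (INR (S (S n)) * INR (S (S n))))%R.
      assert (H1 : (0 < INR (S n))%R) by (apply lt_0_INR; lia).
      rewrite (S_INR (S n)). set (x := INR (S n)) in *.
      apply Rle_trans with (2 - / x + / (x * (x + 1)))%R.
      + apply Rplus_le_compat; trivial. apply Rinv_le_contravar; nra.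
      + right. field. lra. }
  exists 2%R. intros [|n]; [simpl; lra|]. eapply Rle_trans; [apply H|].
  assert (0 < / INR (S n))%R by (apply Rinv_0_lt_compat, lt_0_INR; lia). lra.
Qed.

Lemma upper_shift_neq_0 z (s : R) : upper z -> z + RtoC s <> 0.
Proof. intros Hz E. unfold upper in Hz. apply (f_equal Im) in E. simpl in E. unfold Im in Hz. lra. Qed.

Lemma upper_shift_minus_neq_0 z (s : R) : upper z -> z - RtoC s <> 0.
Proof. intros Hz E. unfold upper in Hz. apply (f_equal Im) in E. simpl in E. unfold Im in Hz. lra. Qed.

Lemma upper_neq_0 z : upper z -> z <> 0.
Proof. intros Hz E. unfold upper in Hz. rewrite E in Hz. simpl in Hz. lra. Qed.

Lemma upper_shift z (s : R) : upper z -> upper (z + RtoC s).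
Proof. unfold upper. rewrite Im_plus, im_RtoC. lra. Qed.

Lemma upper_Cexp z : upper z -> unit_disc (Cexp (twopii * z)).
Proof.
  intros Hz. rewrite <- (Eroot_N 1) by lia. replace (RtoC (INR 1) * z) with z by (simpl; ring).
  apply upper_Eroot; trivial. lia.
Qed.

(* The value of the series is [pi^2 / sin (pi z)^2] minus the term of index 0. *)
Lemma lipschitz_sqr z : upper z ->
  csums (fun k => / ((z + RtoC (INR (S k))) * (z + RtoC (INR (S k)))) +
                  / ((z - RtoC (INR (S k))) * (z - RtoC (INR (S k)))))
   (twopii * twopii * (Cexp (twopii * z) / ((1 - Cexp (twopii * z)) * (1 - Cexp (twopii * z)))) - / (z * z)).
Proof.
  intros Hz. set (X := Cexp (twopii * z)).
  set (h := fun n w => / (RtoC (INR (Nodd n)) * (1 - Eroot (Nodd n) w))).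
  (* With u = Eroot N w this is u / (N^2 (1 - u)^2), the term of [root_partial_fractions_sqr] scaled
     so as to converge to 1 / (2 pi i w)^2. *)
  set (G := fun n w => Eroot (Nodd n) w * (h n w * h n w)).
  assert (HG : forall w : C, w <> 0 -> Clim (fun n => G n w) (/ (twopii * twopii) * / (w * w))).
  { intros w Hw.
    assert (Ht := twopii_neq_0).
    replace (/ (twopii * twopii) * / (w * w)) with (1 * (/ - (twopii * w) * / - (twopii * w))).
    2:{ field. split; trivial. }
    apply Clim_mult; [apply Eroot_lim|].
    assert (Clim (fun n => h n w) (/ - (twopii * w))).
    { apply Clim_inv; [apply Eroot_slope_lim|].
      intros E. apply (Cmult_neq_0 _ _ Ht Hw). replace (twopii * w) with (- - (twopii * w)) by ring.
      rewrite E. ring. }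
    now apply Clim_mult. }
  destruct (Eroot_far_from_1 z Hz) as (d & Hd & Hfar).
  assert (Hid : (0 < / d)%R) by now apply Rinv_0_lt_compat.
  assert (HGb : forall n m (s : R), (S m <= n)%nat -> Rabs s = INR (S m) ->
     (Cmod (G n (z + RtoC s)%C) <= / d * / d * / (INR (S m) * INR (S m)))%R).
  { intros n m s Hm Hs. assert (H1 := Hfar n m s Hm Hs).
    assert (HN : (0 < Nodd n)%nat) by (unfold Nodd; lia).
    assert (HM : (0 < INR (S m))%R) by (apply lt_0_INR; lia).
    assert (Hu := upper_Eroot (Nodd n) _ HN (upper_shift z s Hz)).
    assert (Hne := one_minus_neq_0 _ Hu).
    assert (H2 : (Cmod (h n (z + RtoC s)%C) <= / d * / INR (S m))%R).
    { unfold h. rewrite Cmod_inv by (apply Cmult_neq_0; trivial; now apply INR_pos_neq_0).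
      rewrite Cmod_mult, Cmod_R, Rabs_pos_eq by apply pos_INR.
      rewrite <- Rinv_mult. apply Rinv_le_contravar; trivial. now apply Rmult_lt_0_compat. }
    unfold G. rewrite !Cmod_mult. unfold unit_disc in Hu.
    replace (/ d * / d * / (INR (S m) * INR (S m)))%R with
      (1 * ((/ d * / INR (S m)) * (/ d * / INR (S m))))%R by (field; lra).
    apply Rmult_le_compat; try apply Cmod_ge_0; try lra.
    - apply Rmult_le_pos; apply Cmod_ge_0.
    - apply Rmult_le_compat; trivial; apply Cmod_ge_0. }
  set (a := fun n k => if (S k <=? n)%nat then G n (z + RtoC (INR (S k))) + G n (z - RtoC (INR (S k))) else 0).
  set (b := fun k => / (twopii * twopii) * (/ ((z + RtoC (INR (S k))) * (z + RtoC (INR (S k)))) +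
                  / ((z - RtoC (INR (S k))) * (z - RtoC (INR (S k)))))).
  destruct (tannery a b (fun k => (2 * (/ d * / d) * / (INR (S k) * INR (S k)))%R)) as [T1 T2].
  - intros n k. assert (HM : (0 < INR (S k))%R) by (apply lt_0_INR; lia).
    assert (0 < / (INR (S k) * INR (S k)))%R by (apply Rinv_0_lt_compat; nra).
    unfold a. destruct (Nat.leb_spec (S k) n).
    + eapply Rle_trans; [apply Cmod_triangle|].
      assert (H1 := HGb n k (INR (S k)) H0). assert (H2 := HGb n k (- INR (S k))%R H0).
      rewrite Rabs_Ropp in H2. rewrite RtoC_opp in H2.
      rewrite Rabs_pos_eq in H1, H2 by lra.
      specialize (H1 eq_refl). specialize (H2 eq_refl). unfold Cminus. lra.
    + rewrite Cmod_0. nra.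
  - apply rsummable_scal; [nra|apply rsummable_inv_sqr].
  - intros k. apply Clim_ext_ev with (fun n => G n (z + RtoC (INR (S k))) + G n (z - RtoC (INR (S k)))) (S k).
    + intros n Hn. unfold a. destruct (Nat.leb_spec (S k) n); [trivial|lia].
    + unfold b. rewrite Cmult_plus_distr_l.
      apply Clim_plus; apply HG; [now apply upper_shift_neq_0|now apply upper_shift_minus_neq_0].
  (* An exact identity at every finite level: the sum over all roots of unity, minus its term of
     index 0. *)
  - assert (E : forall n, CSeries (a n) = X / ((1 - X) * (1 - X)) - G n z).
    { intros n. assert (HN : (0 < Nodd n)%nat) by (unfold Nodd; lia).
      assert (HN0 := INR_pos_neq_0 _ HN).
      assert (HX : Eroot (Nodd n) z ^ Nodd n = X) by (rewrite <- Eroot_INR; now apply Eroot_N).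
      assert (HX1 : 1 - X <> 0) by (apply one_minus_neq_0; now apply upper_Cexp).
      assert (R := root_partial_fractions_sqr (Nodd n) (Eroot (Nodd n) z) HN (upper_Eroot _ _ HN Hz)).
      rewrite HX in R.
      rewrite (Eroot_sum_symmetric (fun u => u / ((1 - u) * (1 - u)))) in R.
      assert (HGu : forall w, upper w -> Eroot (Nodd n) w / ((1 - Eroot (Nodd n) w) * (1 - Eroot (Nodd n) w)) =
                 RtoC (INR (Nodd n)) * RtoC (INR (Nodd n)) * G n w).
      { intros w Hw. unfold G, h. field. split; trivial.
        apply one_minus_neq_0. now apply upper_Eroot. }
      assert (HS : csum (a n) n = / (RtoC (INR (Nodd n)) * RtoC (INR (Nodd n))) *
         csum (fun k => Eroot (Nodd n) (z + RtoC (INR (S k))) / ((1 - Eroot (Nodd n) (z + RtoC (INR (S k)))) * (1 - Eroot (Nodd n) (z + RtoC (INR (S k))))) +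
           Eroot (Nodd n) (z - RtoC (INR (S k))) / ((1 - Eroot (Nodd n) (z - RtoC (INR (S k)))) * (1 - Eroot (Nodd n) (z - RtoC (INR (S k)))))) n).
      { rewrite <- csum_scal. apply csum_ext. intros k Hk. rewrite !HGu.
        - unfold a. destruct (Nat.leb_spec (S k) n); [|lia]. field. trivial.
        - unfold Cminus. rewrite <- RtoC_opp. now apply upper_shift.
        - now apply upper_shift. }
      transitivity (csum (a n) n).
      - apply csums_CSeries, csums_finite. intros k Hk. unfold a. destruct (Nat.leb_spec (S k) n); [lia|trivial].
      - rewrite HS. rewrite HGu in R by trivial.
        match type of R with _ + ?s = _ => set (Sm := s) in * end.
        replace Sm with (RtoC (INR (Nodd n)) * RtoC (INR (Nodd n)) * G n z + Sm
           - RtoC (INR (Nodd n)) * RtoC (INR (Nodd n)) * G n z) by ring.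
        rewrite R. field. split; trivial. }
    assert (L : CSeries b = X / ((1 - X) * (1 - X)) - / (twopii * twopii) * / (z * z)).
    { apply Clim_unique with (1 := T2). apply Clim_ext with (fun n => X / ((1 - X) * (1 - X)) - G n z).
      - intros n. now rewrite E.
      - apply Clim_minus; [apply Clim_const|]. apply HG. now apply upper_neq_0. }
    assert (Ht := twopii_neq_0). assert (Hz0 := upper_neq_0 z Hz).
    replace (twopii * twopii * (X / ((1 - X) * (1 - X))) - / (z * z)) with
      (twopii * twopii * (X / ((1 - X) * (1 - X)) - / (twopii * twopii) * / (z * z))).
    2:{ unfold Cdiv. set (Y := X * / ((1 - X) * (1 - X))). field. split; trivial. }
    rewrite <- L.
    apply csums_ext with (fun k => twopii * twopii * b k).
    + intros k. unfold b. set (v := _ + / _). field. trivial.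
    + apply csums_scal. now apply abs_summable_csums.
Qed.

Lemma C2_neq_0 : RtoC 2 <> 0.
Proof. intros E; injection E; lra. Qed.

(* The value of the series is [pi cot (pi z)] minus the term of index 0. *)
Lemma lipschitz_cot z : upper z ->
  csums (fun k => / (z + RtoC (INR (S k))) + / (z - RtoC (INR (S k))))
   (- (twopii / 2 * ((1 + Cexp (twopii * z)) / (1 - Cexp (twopii * z)))) - / z).
Proof.
  intros Hz. set (X := Cexp (twopii * z)).
  assert (Ht := twopii_neq_0). assert (Hz0 := upper_neq_0 z Hz). assert (H2 := C2_neq_0).
  set (h := fun n w => / (RtoC (INR (Nodd n)) * (1 - Eroot (Nodd n) w))).
  assert (Hh : forall w : C, w <> 0 -> Clim (fun n => h n w) (/ - (twopii * w))).
  { intros w Hw. apply Clim_inv; [apply Eroot_slope_lim|].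
    intros E. apply (Cmult_neq_0 _ _ Ht Hw). replace (twopii * w) with (- - (twopii * w)) by ring.
    rewrite E. ring. }
  destruct (Eroot_far_from_1 z Hz) as (d & Hd & Hfar).
  assert (Hid : (0 < / d)%R) by now apply Rinv_0_lt_compat.
  assert (Hhb : forall n m (s : R), (S m <= n)%nat -> Rabs s = INR (S m) ->
     (Cmod (h n (z + RtoC s)%C) <= / d * / INR (S m))%R).
  { intros n m s Hm Hs. assert (H1 := Hfar n m s Hm Hs).
    assert (HN : (0 < Nodd n)%nat) by (unfold Nodd; lia).
    assert (HM : (0 < INR (S m))%R) by (apply lt_0_INR; lia).
    assert (Hne := one_minus_neq_0 _ (upper_Eroot (Nodd n) _ HN (upper_shift z s Hz))).
    unfold h. rewrite Cmod_inv by (apply Cmult_neq_0; trivial; now apply INR_pos_neq_0).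
    rewrite Cmod_mult, Cmod_R, Rabs_pos_eq by apply pos_INR.
    rewrite <- Rinv_mult. apply Rinv_le_contravar; trivial. now apply Rmult_lt_0_compat. }
  (* Pairing produces quadratic decay: (1 + u) / (1 - u) + (1 + v) / (1 - v) = 2 (1 - u v) / ((1 -
     u) (1 - v)), and u v belongs to 2 z whatever [k] is, so the scaled numerator [D] stays
     bounded. *)
  set (D := fun n => RtoC (INR (Nodd n)) * (1 - Eroot (Nodd n) (z + z))).
  set (B := (24 * PI * Cmod (z + z)%C)%R).
  assert (Hzz : upper (z + z)) by (unfold upper in *; rewrite Im_plus; lra).
  assert (HDb : forall n, (Cmod (D n) <= B)%R).
  { intros n. unfold D. rewrite Cmod_mult, Cmod_R, Rabs_pos_eq by apply pos_INR.
    apply Eroot_near_1; trivial. unfold Nodd; lia. }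
  assert (HB : (0 <= B)%R) by (eapply Rle_trans; [apply Cmod_ge_0|apply (HDb O)]).
  set (a := fun n k => if (S k <=? n)%nat
     then 2 * (D n * (h n (z + RtoC (INR (S k))) * h n (z - RtoC (INR (S k))))) else 0).
  set (b := fun k => - (2 / twopii) * (/ (z + RtoC (INR (S k))) + / (z - RtoC (INR (S k))))).
  destruct (tannery a b (fun k => (2 * (B * (/ d * / d)) * / (INR (S k) * INR (S k)))%R)) as [T1 T2].
  - intros n k. assert (HM : (0 < INR (S k))%R) by (apply lt_0_INR; lia).
    assert (Hip : (0 < / (INR (S k) * INR (S k)))%R) by (apply Rinv_0_lt_compat; nra).
    assert (Hdd : (0 <= B * (/ d * / d))%R) by (apply Rmult_le_pos; nra).
    unfold a. destruct (Nat.leb_spec (S k) n) as [Hk|Hk].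
    + assert (H1 := Hhb n k (INR (S k)) Hk). assert (H3 := Hhb n k (- INR (S k))%R Hk).
      rewrite Rabs_Ropp, RtoC_opp in H3. rewrite Rabs_pos_eq in H1, H3 by lra.
      specialize (H1 eq_refl). specialize (H3 eq_refl). fold (z - RtoC (INR (S k))) in H3.
      rewrite !Cmod_mult, Cmod_R, (Rabs_pos_eq 2) by lra.
      replace (2 * (B * (/ d * / d)) * / (INR (S k) * INR (S k)))%R with
        (2 * (B * ((/ d * / INR (S k)) * (/ d * / INR (S k)))))%R by (field; lra).
      apply Rmult_le_compat_l; [lra|].
      apply Rmult_le_compat; trivial; try apply Cmod_ge_0.
      * apply Rmult_le_pos; apply Cmod_ge_0.
      * apply Rmult_le_compat; trivial; apply Cmod_ge_0.
    + rewrite Cmod_0. nra.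
  - apply rsummable_scal; [|apply rsummable_inv_sqr].
    apply Rmult_le_pos; [lra|]. apply Rmult_le_pos; nra.
  - intros k. assert (N1 := upper_shift_neq_0 z (INR (S k)) Hz).
    assert (N2 := upper_shift_minus_neq_0 z (INR (S k)) Hz).
    apply Clim_ext_ev with (fun n => 2 * (D n * (h n (z + RtoC (INR (S k))) * h n (z - RtoC (INR (S k)))))) (S k).
    + intros n Hn. unfold a. destruct (Nat.leb_spec (S k) n); [trivial|lia].
    + unfold b. set (s := RtoC (INR (S k))) in *.
      replace (- (2 / twopii) * (/ (z + s) + / (z - s))) with
        (2 * (- (twopii * (z + z)) * (/ - (twopii * (z + s)) * / - (twopii * (z - s))))).
      2:{ field. repeat split; trivial. }
      apply Clim_scal, Clim_mult; [apply Eroot_slope_lim|].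
      apply Clim_mult; now apply Hh.
  - assert (HX1 : 1 - X <> 0) by (apply one_minus_neq_0; now apply upper_Cexp).
    assert (E : forall n, CSeries (a n) = (1 + X) / (1 - X) - (1 + Eroot (Nodd n) z) * h n z).
    { intros n. assert (HN : (0 < Nodd n)%nat) by (unfold Nodd; lia).
      assert (HN0 := INR_pos_neq_0 _ HN).
      assert (HX : Eroot (Nodd n) z ^ Nodd n = X) by (rewrite <- Eroot_INR; now apply Eroot_N).
      assert (Hu := upper_Eroot _ _ HN Hz).
      assert (R := root_partial_fractions (Nodd n) (Eroot (Nodd n) z) HN Hu).
      rewrite HX in R.
      (* The odd function (1 + u) / (1 - u) = 2 / (1 - u) - 1 is the discrete cotangent; with it the
         pairs for k and -k cancel to leading order. *)
      assert (R2 : csum (fun k => (1 + Eroot (Nodd n) z * Eroot (Nodd n) 1 ^ k) /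
           (1 - Eroot (Nodd n) z * Eroot (Nodd n) 1 ^ k)) (Nodd n) =
           RtoC (INR (Nodd n)) * ((1 + X) / (1 - X))).
      { rewrite (csum_ext _ (fun k => 2 * / (1 - Eroot (Nodd n) z * Eroot (Nodd n) 1 ^ k) + - 1)).
        - rewrite csum_plus, csum_scal, R.
          assert (Hc : forall m, csum (fun _ => - 1) m = - RtoC (INR m)).
          { clear. induction m; [simpl; ring|]. rewrite S_INR, RtoC_plus. simpl csum. rewrite IHm. ring. }
          rewrite Hc. field. trivial.
        - intros k _. field. apply one_minus_neq_0. now apply unit_disc_root. }
      rewrite (Eroot_sum_symmetric (fun u => (1 + u) / (1 - u))) in R2.
      assert (HS : csum (a n) n = / RtoC (INR (Nodd n)) *
         csum (fun k => (1 + Eroot (Nodd n) (z + RtoC (INR (S k)))) / (1 - Eroot (Nodd n) (z + RtoC (INR (S k)))) +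
           (1 + Eroot (Nodd n) (z - RtoC (INR (S k)))) / (1 - Eroot (Nodd n) (z - RtoC (INR (S k))))) n).
      { rewrite <- csum_scal. apply csum_ext. intros k Hk.
        assert (M1 := one_minus_neq_0 _ (upper_Eroot (Nodd n) _ HN (upper_shift z (INR (S k)) Hz))).
        assert (M2 := one_minus_neq_0 _ (upper_Eroot (Nodd n) _ HN (upper_shift z (- INR (S k)) Hz))).
        rewrite RtoC_opp in M2. fold (z - RtoC (INR (S k))) in M2.
        unfold a. destruct (Nat.leb_spec (S k) n); [|lia]. unfold D, h.
        replace (z + z) with ((z + RtoC (INR (S k))) + (z - RtoC (INR (S k)))) by ring.
        rewrite Eroot_add. field. repeat split; trivial. }
      transitivity (csum (a n) n).
      - apply csums_CSeries, csums_finite. intros k Hk. unfold a. destruct (Nat.leb_spec (S k) n); [lia|trivial].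
      - rewrite HS.
        match type of R2 with _ + ?s = _ => set (Sm := s) in * end.
        replace Sm with ((1 + Eroot (Nodd n) z) / (1 - Eroot (Nodd n) z) + Sm
           - (1 + Eroot (Nodd n) z) / (1 - Eroot (Nodd n) z)) by ring.
        rewrite R2. unfold h. field. repeat split; trivial. now apply one_minus_neq_0. }
    assert (L : CSeries b = (1 + X) / (1 - X) - (1 + 1) * / - (twopii * z)).
    { apply Clim_unique with (1 := T2).
      apply Clim_ext with (fun n => (1 + X) / (1 - X) - (1 + Eroot (Nodd n) z) * h n z).
      - intros n. now rewrite E.
      - apply Clim_minus; [apply Clim_const|]. apply Clim_mult; [|now apply Hh].
        apply Clim_plus; [apply Clim_const|apply Eroot_lim]. }
    replace (- (twopii / 2 * ((1 + X) / (1 - X))) - / z) with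
      (- (twopii / 2) * ((1 + X) / (1 - X) - (1 + 1) * / - (twopii * z))).
    2:{ field. repeat split; trivial. }
    rewrite <- L.
    apply csums_ext with (fun k => - (twopii / 2) * b k).
    + intros k. unfold b. set (v := _ + / _). field. repeat split; trivial.
    + apply csums_scal. now apply abs_summable_csums.
Qed.

(** * The Eisenstein double series and its behaviour under inversion *)

Lemma upper_inv tau : upper tau -> upper (- (1) / tau).
Proof.
  intros H. unfold upper in *. unfold Cdiv.
  assert (Hd : (0 < Re tau ^ 2 + Im tau ^ 2)%R) by nra.
  rewrite Im_mult. unfold Cinv. unfold Re, Im in *. simpl fst; simpl snd.
  match goal with |- (0 < ?x)%R =>
    replace x with (snd tau / (fst tau ^ 2 + snd tau ^ 2))%R by (field; simpl in Hd; lra) end.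
  now apply Rdiv_lt_0_compat.
Qed.

Lemma upper_scal (r : R) tau : (0 < r)%R -> upper tau -> upper (RtoC r * tau).
Proof. unfold upper. intros. rewrite im_scal_l. now apply Rmult_lt_0_compat. Qed.

(** The imaginary part controls [m], hence |m tau| is at most |tau| / Im tau times the modulus of
    the lattice point, and the triangle inequality then controls [s]. Mixing both bounds yields
    majorants of product form. *)
Lemma lattice_lower_bound tau : upper tau -> exists d, (0 < d <= 1)%R /\
  forall (m s : R), (0 < m)%R ->
    (d * m <= Cmod (RtoC m * tau + RtoC s))%R /\ (d * Rabs s <= Cmod (RtoC m * tau + RtoC s))%R.
Proof.
  intros H. unfold upper in H. set (y := Im tau) in *.
  assert (Ht := Cmod_ge_0 tau).
  assert (Hc : (0 < / (1 + Cmod tau / y))%R).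
  { apply Rinv_0_lt_compat. assert (0 <= Cmod tau / y)%R; [|lra].
    apply Rmult_le_pos; trivial. left. now apply Rinv_0_lt_compat. }
  exists (Rmin 1 (Rmin y (/ (1 + Cmod tau / y))))%R. split.
  - split; [repeat apply Rmin_pos; lra|apply Rmin_l].
  - intros m s Hm. set (d := Rmin 1 (Rmin y (/ (1 + Cmod tau / y)))%R).
    assert (Hd1 : (d <= y)%R) by (eapply Rle_trans; [apply Rmin_r|apply Rmin_l]).
    assert (Hd2 : (d <= / (1 + Cmod tau / y))%R) by (eapply Rle_trans; [apply Rmin_r|apply Rmin_r]).
    assert (L1 : (y * m <= Cmod (RtoC m * tau + RtoC s))%R).
    { eapply Rle_trans; [|apply Im_le_Cmod]. rewrite Im_plus, im_scal_l, im_RtoC, Rplus_0_r.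
      rewrite Rabs_pos_eq; fold y; nra. }
    split.
    + apply Rle_trans with (2 := L1). apply Rmult_le_compat_r; lra.
    + set (Z := Cmod (RtoC m * tau + RtoC s)) in *.
      assert (L2 : (Rabs s <= Z * (1 + Cmod tau / y))%R).
      { assert (Ht2 := Cmod_triangle (RtoC m * tau + RtoC s) (- (RtoC m * tau))).
        replace (RtoC m * tau + RtoC s + - (RtoC m * tau)) with (RtoC s) in Ht2 by ring.
        rewrite Cmod_opp, Cmod_mult, !Cmod_R, (Rabs_pos_eq m) in Ht2 by lra. fold Z in Ht2.
        rewrite Rmult_plus_distr_l, Rmult_1_r.
        apply Rle_trans with (1 := Ht2). apply Rplus_le_compat_l.
        replace (m * Cmod tau)%R with (y * m * (Cmod tau / y))%R by (field; lra).
        apply Rmult_le_compat_r; trivial. apply Rmult_le_pos; trivial. left. now apply Rinv_0_lt_compat. }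
      apply Rle_trans with (/ (1 + Cmod tau / y) * Rabs s)%R.
      * apply Rmult_le_compat_r; trivial. apply Rabs_pos.
      * apply Rle_trans with (/ (1 + Cmod tau / y) * (Z * (1 + Cmod tau / y)))%R.
        -- apply Rmult_le_compat_l; lra.
        -- right. field. lra.
Qed.

(** The offset [s] is real, not an integer, since the comparison terms sit at half-integers; row [m]
    has the multiple m + 1 of [tau]. *)
Definition lat (tau : C) (m : nat) (s : R) : C := RtoC (INR (S m)) * tau + RtoC s.

Definition eis_term (tau : C) (m n : nat) : C :=
  / (lat tau m (INR (S n)) * lat tau m (INR (S n))) + / (lat tau m (- INR (S n)) * lat tau m (- INR (S n))).

(** Because 1 / (w^2 - 1/4) is 1 / (w - 1/2) minus 1 / (w + 1/2), differences of this term at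
    consecutive half-integers approximate [eis_term] and telescope. Its sum over [m] is a
    cotangent. *)
Definition cot_term (tau : C) (m : nat) (a : R) : C := / lat tau m a - / lat tau m (- a).

Lemma lat_neq_0 tau m s : upper tau -> lat tau m s <> 0.
Proof.
  intros H. apply upper_shift_neq_0. apply upper_scal; trivial. apply lt_0_INR. lia.
Qed.

(* Subtracting a telescoping double series from the conditionally convergent one
   leaves an absolutely convergent remainder, which may be summed in any order. *)
Lemma eis_remainder_bound tau : upper tau -> exists K, (0 <= K)%R /\ forall m n,
  (Cmod (eis_term tau m n - (cot_term tau m (INR (S n) - 1 / 2) - cot_term tau m (INR (S n) + 1 / 2))) <=
     K * / (INR (S m) * INR (S m)) * / (INR (S n) * INR (S n)))%R.
Proof.
  intros Ht. destruct (lattice_lower_bound tau Ht) as (d & Hd & Hl).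
  assert (Hq : forall m n s, Rabs s = INR (S n) ->
    (Cmod (/ (lat tau m s * lat tau m s) - / (lat tau m (s - 1 / 2) * lat tau m (s + 1 / 2))) <=
     / (d * d * d * d) * / (INR (S m) * INR (S m)) * / (INR (S n) * INR (S n)) * / 2)%R).
  { intros m n s Hs.
    set (M := INR (S m)). set (N := INR (S n)) in *.
    assert (HM : (0 < M)%R) by (apply lt_0_INR; lia).
    assert (HN : (1 <= N)%R) by (apply (le_INR 1); lia).
    assert (Hl' : forall x, (d * M <= Cmod (lat tau m x))%R /\ (d * Rabs x <= Cmod (lat tau m x))%R)
      by (intros x; now apply Hl).
    destruct (Hl' s) as [A1 A2]. destruct (Hl' (s - 1 / 2)%R) as [B1 B2].
    destruct (Hl' (s + 1 / 2)%R) as [C1 C2].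
    assert (N0 := lat_neq_0 tau m s Ht). assert (N1 := lat_neq_0 tau m (s - 1 / 2) Ht).
    assert (N2 := lat_neq_0 tau m (s + 1 / 2) Ht).
    rewrite Hs in A2.
    assert (C3 : (d * (N / 2) <= Cmod (lat tau m (s + 1 / 2)))%R).
    { apply Rle_trans with (2 := C2). apply Rmult_le_compat_l; [lra|].
      generalize (Rabs_triang (s + 1 / 2) (- (1 / 2))).
      replace (s + 1 / 2 + - (1 / 2))%R with s by ring. rewrite Hs, Rabs_Ropp, (Rabs_pos_eq (1 / 2)) by lra.
      lra. }
    set (z0 := lat tau m s) in *. set (z1 := lat tau m (s - 1 / 2)) in *.
    set (z2 := lat tau m (s + 1 / 2)) in *.
    (* The difference of the reciprocals is therefore -1/4 divided by z0^2 z1 z2. Two of these four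
       factors are bounded below through [M], two through [N] (one of them with N / 2), so each sign
       costs half of 1 / (d^4 M^2 N^2). *)
    assert (E : z1 * z2 - z0 * z0 = - / (2 * 2)).
    { unfold z0, z1, z2, lat. rewrite RtoC_minus, RtoC_plus.
      replace (RtoC (1 / 2)) with (/ 2) by (rewrite RtoC_div by lra; field; apply C2_neq_0).
      field. }
    replace (/ (z0 * z0) - / (z1 * z2)) with ((z1 * z2 - z0 * z0) * (/ (z0 * z0) * / (z1 * z2)))
      by (field; repeat split; trivial).
    rewrite E, Cmod_mult, Cmod_opp, Cmod_mult, !Cmod_inv, !Cmod_mult, !Cmod_R, !(Rabs_pos_eq 2)
      by (try lra; repeat apply Cmult_neq_0; trivial; apply C2_neq_0).
    assert (HdM : (0 < d * M)%R) by nra. assert (HdN : (0 < d * N)%R) by nra.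
    replace (/ (d * d * d * d) * / (M * M) * / (N * N) * / 2)%R with
      (/ (2 * 2) * (/ ((d * M) * (d * N)) * / ((d * M) * (d * (N / 2)))))%R by (field; lra).
    apply Rmult_le_compat_l; [lra|].
    assert (HP1 : (0 < d * M * (d * N))%R) by now apply Rmult_lt_0_compat.
    assert (HP2 : (0 < d * M * (d * (N / 2)))%R) by (apply Rmult_lt_0_compat; nra).
    assert (Q1 : (d * M * (d * N) <= Cmod z0 * Cmod z0)%R) by (apply Rmult_le_compat; lra).
    assert (Q2 : (d * M * (d * (N / 2)) <= Cmod z1 * Cmod z2)%R) by (apply Rmult_le_compat; try lra; nra).
    apply Rmult_le_compat.
    - left. apply Rinv_0_lt_compat. lra.
    - left. apply Rinv_0_lt_compat. lra.
    - apply Rinv_le_contravar; lra.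
    - apply Rinv_le_contravar; lra. }
  exists (/ (d * d * d * d))%R. split.
  { left. apply Rinv_0_lt_compat. repeat apply Rmult_lt_0_compat; lra. }
  intros m n. set (s := INR (S n)).
  assert (Hs : (0 < s)%R) by (apply lt_0_INR; lia).
  replace (eis_term tau m n - (cot_term tau m (s - 1 / 2) - cot_term tau m (s + 1 / 2))) with
   ((/ (lat tau m s * lat tau m s) - / (lat tau m (s - 1 / 2) * lat tau m (s + 1 / 2))) +
    (/ (lat tau m (- s) * lat tau m (- s)) - / (lat tau m (- s - 1 / 2) * lat tau m (- s + 1 / 2)))).
  - eapply Rle_trans; [apply Cmod_triangle|].
    assert (H1 := Hq m n s (Rabs_pos_eq s (Rlt_le _ _ Hs))).
    assert (H2 := Hq m n (- s)%R). rewrite Rabs_Ropp in H2.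
    specialize (H2 (Rabs_pos_eq s (Rlt_le _ _ Hs))). fold s in H1, H2. lra.
  - unfold eis_term, cot_term. fold s.
    replace (- (s - 1 / 2))%R with (- s + 1 / 2)%R by ring.
    replace (- (s + 1 / 2))%R with (- s - 1 / 2)%R by ring.
    assert (N1 := fun s => lat_neq_0 tau m s Ht).
    assert (D : forall x, / (lat tau m (x - 1 / 2) * lat tau m (x + 1 / 2)) =
              / lat tau m (x - 1 / 2) - / lat tau m (x + 1 / 2)).
    { intros x. assert (E : lat tau m (x + 1 / 2) - lat tau m (x - 1 / 2) = 1).
      { unfold lat. rewrite RtoC_minus, RtoC_plus.
        replace (RtoC (1 / 2)) with (/ 2) by (rewrite RtoC_div by lra; field; apply C2_neq_0).
        field. }
      replace (/ (lat tau m (x - 1 / 2) * lat tau m (x + 1 / 2))) with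
       ((lat tau m (x + 1 / 2) - lat tau m (x - 1 / 2)) * / (lat tau m (x - 1 / 2) * lat tau m (x + 1 / 2)))
       by (rewrite E; ring).
      field. split; apply N1. }
    rewrite !D. ring.
Qed.

Lemma csum_telescope (f : nat -> C) n : csum (fun k => f k - f (S k)) n = f O - f n.
Proof. induction n; simpl; [ring|]. rewrite IHn; ring. Qed.

Lemma csums_telescope (f : nat -> C) l : Clim f l -> csums (fun k => f k - f (S k)) (f O - l).
Proof.
  intros H. apply Clim_ext with (fun n => f O - f n).
  - intros n. now rewrite csum_telescope.
  - apply Clim_minus; trivial. apply Clim_const.
Qed.

Lemma half_shift k : (INR (S k) - 1 / 2 = INR k + 1 / 2)%R.
Proof. rewrite S_INR. field. Qed.

Lemma is_lim_seq_half_inv (c : R) : (0 < c)%R -> is_lim_seq (fun n => (/ (c * (INR n + 1 / 2)))%R) 0.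
Proof.
  intros Hc.
  apply (is_lim_seq_inv _ p_infty); [|discriminate].
  assert (is_lim_seq (fun n => (c * INR n)%R) p_infty).
  { assert (H := is_lim_seq_scal_l _ c p_infty is_lim_seq_INR).
    replace p_infty with (Rbar_mult c p_infty); trivial.
    simpl. destruct (Rle_dec 0 c) as [Hle|]; [|lra]. destruct (Rle_lt_or_eq_dec 0 c Hle); [trivial|lra]. }
  apply (is_lim_seq_le_p_loc (fun n => (c * INR n)%R)); trivial.
  exists O. intros n _. apply Rmult_le_compat_l; lra.
Qed.

Lemma Clim_squeeze u (v : nat -> R) : (forall n, (Cmod (u n) <= v n)%R) -> is_lim_seq v 0 -> Clim u 0.
Proof.
  intros H Hv. apply Clim_mod.
  apply is_lim_seq_le_le with (fun _ => 0%R) v; trivial; [|apply is_lim_seq_const].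
  intros n. replace (u n - 0) with (u n) by ring. split; trivial. apply Cmod_ge_0.
Qed.

Lemma cot_term_lim tau m : upper tau -> Clim (fun n => cot_term tau m (INR n + 1 / 2)) 0.
Proof.
  intros Ht. destruct (lattice_lower_bound tau Ht) as (d & Hd & Hl).
  assert (HM : (0 < INR (S m))%R) by (apply lt_0_INR; lia).
  assert (Hs : forall f : nat -> R, (forall n, Rabs (f n) = (INR n + 1 / 2)%R) -> Clim (fun n => / lat tau m (f n)) 0).
  { intros f Hf. apply Clim_squeeze with (fun n => (/ (d * (INR n + 1 / 2)))%R).
    - intros n. rewrite Cmod_inv by now apply lat_neq_0. apply Rinv_le_contravar.
      + generalize (pos_INR n). nra.
      + rewrite <- Hf. apply Hl. trivial.
    - apply is_lim_seq_half_inv. lra. }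
  unfold cot_term. replace (RtoC 0) with (0 - 0) by ring.
  apply Clim_minus; apply Hs; intros n; rewrite ?Rabs_Ropp, ?Rabs_pos_eq; trivial; generalize (pos_INR n); lra.
Qed.

Lemma eis_row_sum tau m : upper tau ->
  csums (eis_term tau m) (twopii * twopii * (Cexp (twopii * tau) ^ S m /
     ((1 - Cexp (twopii * tau) ^ S m) * (1 - Cexp (twopii * tau) ^ S m)))
   - / (RtoC (INR (S m)) * RtoC (INR (S m)) * (tau * tau))).
Proof.
  intros Ht. assert (Hz : upper (RtoC (INR (S m)) * tau)).
  { apply upper_scal; trivial. apply lt_0_INR; lia. }
  assert (L := lipschitz_sqr _ Hz).
  replace (twopii * (RtoC (INR (S m)) * tau)) with (RtoC (INR (S m)) * (twopii * tau)) in L by ring.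
  rewrite Cexp_INR in L.
  replace (RtoC (INR (S m)) * tau * (RtoC (INR (S m)) * tau)) with
   (RtoC (INR (S m)) * RtoC (INR (S m)) * (tau * tau)) in L by ring.
  apply csums_ext with (2 := L). intros k. unfold eis_term, lat. rewrite RtoC_opp. reflexivity.
Qed.

(** With sigma = -1 / tau, the lattice point m tau + n equals - tau (n sigma - m); a column at tau
    is thus tau^(-2) times a row at sigma. *)
Lemma eis_col_sum tau n : upper tau ->
  csums (fun m => eis_term tau m n) (/ (tau * tau) * (twopii * twopii *
     (Cexp (twopii * (- (1) / tau)) ^ S n / ((1 - Cexp (twopii * (- (1) / tau)) ^ S n) * (1 - Cexp (twopii * (- (1) / tau)) ^ S n))))
   - / (RtoC (INR (S n)) * RtoC (INR (S n)))).
Proof.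
  intros Ht. assert (Ht0 := upper_neq_0 tau Ht).
  set (sg := - (1) / tau). assert (Hsg : upper sg) by now apply upper_inv.
  assert (L := eis_row_sum sg n Hsg).
  apply (csums_scal (/ (tau * tau))) in L.
  match type of L with csums _ ?a => match goal with |- csums _ ?b => replace b with a end end.
  - apply csums_ext with (2 := L). intros m. unfold eis_term.
    assert (N1 := lat_neq_0 tau m (INR (S n)) Ht). assert (N2 := lat_neq_0 tau m (- INR (S n)) Ht).
    assert (M1 := lat_neq_0 sg n (INR (S m)) Hsg). assert (M2 := lat_neq_0 sg n (- INR (S m)) Hsg).
    assert (E1 : lat tau m (INR (S n)) = - tau * lat sg n (- INR (S m))).
    { unfold lat, sg. rewrite RtoC_opp. field. trivial. }
    assert (E2 : lat tau m (- INR (S n)) = tau * lat sg n (INR (S m))).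
    { unfold lat, sg. rewrite RtoC_opp. field. trivial. }
    rewrite E1, E2. field. repeat split; trivial.
  - set (Y := _ / _). unfold sg. field.
    split; trivial. apply INR_S_neq_0.
Qed.

(** The same substitution turns the terms into - 1 / tau times the pairs of the cotangent series at
    a (-1 / tau). *)
Lemma cot_sum tau a : upper tau -> (0 < a)%R ->
  csums (fun m => cot_term tau m a)
    (/ tau * (twopii / 2 * ((1 + Cexp (twopii * (RtoC a * (- (1) / tau)))) / (1 - Cexp (twopii * (RtoC a * (- (1) / tau))))))
     - / RtoC a).
Proof.
  intros Ht Ha. assert (Ht0 := upper_neq_0 tau Ht).
  set (sg := - (1) / tau). assert (Hsg : upper sg) by now apply upper_inv.
  assert (Hz : upper (RtoC a * sg)) by now apply upper_scal.
  assert (Ha0 : RtoC a <> 0) by (intros E; injection E; lra).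
  assert (L := lipschitz_cot _ Hz).
  apply (csums_scal (- / tau)) in L.
  match type of L with csums _ ?u => match goal with |- csums _ ?v => replace v with u end end.
  - apply csums_ext with (2 := L). intros m. unfold cot_term.
    assert (N1 := lat_neq_0 tau m a Ht). assert (N2 := lat_neq_0 tau m (- a) Ht).
    assert (M1 := upper_shift_neq_0 _ (INR (S m)) Hz). assert (M2 := upper_shift_minus_neq_0 _ (INR (S m)) Hz).
    assert (E1 : lat tau m a = - tau * (RtoC a * sg - RtoC (INR (S m)))).
    { unfold lat, sg. field. trivial. }
    assert (E2 : lat tau m (- a) = tau * (RtoC a * sg + RtoC (INR (S m)))).
    { unfold lat, sg. rewrite RtoC_opp. field. trivial. }
    rewrite E1, E2. field. repeat split; trivial.
  - set (Y := (1 + _) / (1 - _)). unfold sg. field. repeat split; trivial.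
Qed.

(** The exponentials die out as the argument moves up the half-plane, which leaves pi i / tau. Each
    single [cot_term] tends to 0 by [cot_term_lim], so limit and sum over [m] do not commute: this
    is the origin of the anomaly. *)
Lemma cot_sum_lim tau : upper tau ->
  Clim (fun n => / tau * (twopii / 2 * ((1 + Cexp (twopii * (RtoC (INR n + 1 / 2) * (- (1) / tau)))) /
       (1 - Cexp (twopii * (RtoC (INR n + 1 / 2) * (- (1) / tau))))))
     - / RtoC (INR n + 1 / 2)) (/ tau * (twopii / 2)).
Proof.
  intros Ht. set (sg := - (1) / tau). assert (Hsg : upper sg) by now apply upper_inv.
  assert (Hex : Clim (fun n => Cexp (twopii * (RtoC (INR n + 1 / 2) * sg))) 0).
  { unfold upper in Hsg. assert (HPI := PI_RGT_0).
    assert (Hc : (0 < 2 * PI * Im sg)%R) by (apply Rmult_lt_0_compat; lra).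
    apply Clim_squeeze with (fun n => (/ (2 * PI * Im sg * (INR n + 1 / 2)))%R).
    - intros n. rewrite Cmod_Cexp, Re_twopii, im_scal_l.
      set (t := (2 * PI * Im sg * (INR n + 1 / 2))%R).
      replace (- (2 * PI * ((INR n + 1 / 2) * Im sg)))%R with (- t)%R by (unfold t; ring).
      assert (Htp : (0 < t)%R).
      { apply Rmult_lt_0_compat; trivial. generalize (pos_INR n). lra. }
      rewrite exp_Ropp. apply Rinv_le_contravar; trivial. generalize (exp_ineq1_le t). lra.
    - now apply is_lim_seq_half_inv. }
  replace (/ tau * (twopii / 2)) with (/ tau * (twopii / 2 * ((1 + 0) / (1 - 0))) - 0).
  2:{ field. now apply upper_neq_0. }
  apply Clim_minus.
  - apply Clim_scal, Clim_scal, Clim_div.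
    + apply Clim_plus; trivial. apply Clim_const.
    + apply Clim_minus; trivial. apply Clim_const.
    + replace (1 - 0) with (RtoC 1) by ring. exact C1_nz.
  - apply Clim_squeeze with (fun n => (/ (1 * (INR n + 1 / 2)))%R); [|apply is_lim_seq_half_inv; lra].
    intros n. assert (0 < INR n + 1 / 2)%R by (generalize (pos_INR n); lra).
    rewrite Cmod_inv, Cmod_R, Rabs_pos_eq, Rmult_1_l; try lra. intros E. injection E. lra.
Qed.

(** For the remainder [W] the order is free. Along rows the comparison terms telescope to [cot_term]
    at 1/2, with sum [beta 0]; along columns they telescope to [beta 0] minus the nonzero limit of
    [beta], and that limit is the whole discrepancy. *)
Lemma eisenstein_swap tau : upper tau -> exists r,
  csums (fun m => CSeries (eis_term tau m)) (r + / tau * (twopii / 2)) /\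
  csums (fun n => CSeries (fun m => eis_term tau m n)) r.
Proof.
  intros Ht. destruct (eis_remainder_bound tau Ht) as (K & HK & Hb).
  set (W := fun m n => eis_term tau m n - (cot_term tau m (INR (S n) - 1 / 2) - cot_term tau m (INR (S n) + 1 / 2))).
  assert (Hi : forall k, (0 <= / (INR (S k) * INR (S k)))%R).
  { intros k. left. apply Rinv_0_lt_compat. assert (0 < INR (S k))%R by (apply lt_0_INR; lia). nra. }
  destruct (fubini W (fun m => (K * / (INR (S m) * INR (S m)))%R) (fun n => (/ (INR (S n) * INR (S n)))%R) Hb)
    as (F1 & F2 & F3 & F4 & F5); trivial.
  { intros m. now apply Rmult_le_pos. }
  { apply rsummable_scal; trivial. apply rsummable_inv_sqr. }
  { apply rsummable_inv_sqr. }
  set (beta := fun n => / tau * (twopii / 2 * ((1 + Cexp (twopii * (RtoC (INR n + 1 / 2) * (- (1) / tau)))) /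
       (1 - Cexp (twopii * (RtoC (INR n + 1 / 2) * (- (1) / tau))))))
     - / RtoC (INR n + 1 / 2)).
  assert (Hbeta : forall n, csums (fun m => cot_term tau m (INR n + 1 / 2)) (beta n)).
  { intros n. apply cot_sum; trivial. generalize (pos_INR n). lra. }
  set (w := CSeries (fun m => CSeries (W m))).
  exists (w + beta O - / tau * (twopii / 2)). split.
  - replace (w + beta O - / tau * (twopii / 2) + / tau * (twopii / 2)) with (w + beta O) by ring.
    apply csums_ext with (fun m => CSeries (W m) + cot_term tau m (INR 0 + 1 / 2)).
    + intros m. symmetry. apply csums_CSeries.
      apply csums_ext with (fun n => W m n + (cot_term tau m (INR n + 1 / 2) - cot_term tau m (INR (S n) + 1 / 2))).
      * intros n. unfold W. rewrite half_shift. ring.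
      * apply csums_plus; [now apply abs_summable_csums|].
        replace (cot_term tau m (INR 0 + 1 / 2)) with (cot_term tau m (INR 0 + 1 / 2) - 0) by ring.
        apply (csums_telescope (fun n => cot_term tau m (INR n + 1 / 2))). now apply cot_term_lim.
    + apply csums_plus; [|apply Hbeta]. now apply (abs_summable_csums (fun m => CSeries (W m))).
  - replace (w + beta O - / tau * (twopii / 2)) with (w + (beta O - / tau * (twopii / 2))) by ring.
    apply csums_ext with (fun n => CSeries (fun m => W m n) + (beta n - beta (S n))).
    + intros n. symmetry. apply csums_CSeries.
      apply csums_ext with (fun m => W m n + (cot_term tau m (INR n + 1 / 2) - cot_term tau m (INR (S n) + 1 / 2))).
      * intros m. unfold W. rewrite half_shift. ring.
      * apply csums_plus; [apply (abs_summable_csums (fun m => W m n)), F2|].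
        apply csums_minus; apply Hbeta.
    + apply csums_plus.
      * unfold w. rewrite F5. now apply (abs_summable_csums (fun n => CSeries (fun m => W m n))).
      * apply csums_telescope. now apply cot_sum_lim.
Qed.

(** * The inversion formula for theta00 *)

Lemma upper_ball tau w : upper tau -> (Cmod (w - tau) < Im tau)%R -> upper w.
Proof.
  unfold upper. intros Ht Hw. generalize (Im_le_Cmod (w - tau)). rewrite Im_minus.
  intros Hi. assert (Hlt : (Rabs (Im w - Im tau) < Im tau)%R) by lra.
  apply Rabs_lt_between in Hlt. lra.
Qed.

Definition euler_phi (tau : C) : C := euler_log (Cexp (twopii * tau)).

Definition euler_phi' (tau : C) : C :=
  Cexp (twopii * tau) * PS (dcoef euler_log_coef) (Cexp (twopii * tau)).

Lemma Cder_linear a z : Cder (fun w => a * w) z a.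
Proof. apply Cder_eq with (a * 1); [ring|]. apply Cder_scal, Cder_id. Qed.

Lemma Cder_euler_phi tau : upper tau -> Cder euler_phi tau (twopii * euler_phi' tau).
Proof.
  intros H. apply Cder_eq with (twopii * Cexp (twopii * tau) * PS (dcoef euler_log_coef) (Cexp (twopii * tau))).
  - unfold euler_phi'. ring.
  - apply (Cder_comp euler_log (fun w => Cexp (twopii * w))).
    + apply Cder_PS; [apply radius1_euler_log|now apply upper_Cexp].
    + apply (Cder_Cexp_comp (fun w => twopii * w)). apply Cder_linear.
Qed.

Definition zeta2 : C := CSeries (fun k => / (RtoC (INR (S k)) * RtoC (INR (S k)))).

Lemma zeta2_csums : csums (fun k => / (RtoC (INR (S k)) * RtoC (INR (S k)))) zeta2.
Proof.
  apply abs_summable_csums. apply abs_summable_le with (2 := rsummable_inv_sqr).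
  intros k. rewrite Cmod_inv, Cmod_mult, Cmod_R, Rabs_pos_eq; [lra|apply pos_INR|].
  apply Cmult_neq_0; apply INR_S_neq_0.
Qed.

(** Rows give the Lambert series at tau, columns the one at -1 / tau, and the terms of index 0
    absent from [lipschitz_sqr] add up to the multiples of [zeta2]. This is the quasimodularity of
    the Eisenstein series of weight 2. *)
Lemma euler_phi'_inversion tau : upper tau ->
  twopii * (/ (tau * tau) * euler_phi' (- (1) / tau) - euler_phi' tau) =
  / (2 * tau) + zeta2 / twopii * (/ (tau * tau) - 1).
Proof.
  intros Ht. assert (Ht0 := upper_neq_0 tau Ht). assert (Htw := twopii_neq_0).
  set (sg := - (1) / tau). assert (Hsg : upper sg) by now apply upper_inv.
  destruct (eisenstein_swap tau Ht) as (r & H1 & H2).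
  assert (E1 : r + / tau * (twopii / 2) = twopii * twopii * - euler_phi' tau - / (tau * tau) * zeta2).
  { apply Clim_unique with (1 := H1).
    apply csums_ext with (fun m => twopii * twopii * (Cexp (twopii * tau) ^ S m /
     ((1 - Cexp (twopii * tau) ^ S m) * (1 - Cexp (twopii * tau) ^ S m)))
       - / (tau * tau) * / (RtoC (INR (S m)) * RtoC (INR (S m)))).
    - intros m. symmetry. rewrite (csums_CSeries _ _ (eis_row_sum tau m Ht)). f_equal. f_equal.
      field. split; trivial. apply INR_S_neq_0.
    - apply csums_minus; apply csums_scal; [|apply zeta2_csums].
      apply euler_log_deriv_sum. now apply upper_Cexp. }
  assert (E2 : r = / (tau * tau) * (twopii * twopii * - euler_phi' sg) - zeta2).
  { apply Clim_unique with (1 := H2).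
    apply csums_ext with (fun n => / (tau * tau) * (twopii * twopii *
     (Cexp (twopii * sg) ^ S n / ((1 - Cexp (twopii * sg) ^ S n) * (1 - Cexp (twopii * sg) ^ S n))))
      - / (RtoC (INR (S n)) * RtoC (INR (S n)))).
    - intros n. symmetry. apply (csums_CSeries _ _ (eis_col_sum tau n Ht)).
    - apply csums_minus; [apply csums_scal, csums_scal|apply zeta2_csums].
      apply euler_log_deriv_sum. now apply upper_Cexp. }
  assert (E3 : twopii * twopii * (/ (tau * tau) * euler_phi' sg - euler_phi' tau) =
     / tau * (twopii / 2) + / (tau * tau) * zeta2 - zeta2).
  { replace (/ tau * (twopii / 2)) with ((r + / tau * (twopii / 2)) - r) by ring.
    rewrite E1, E2. ring. }
  replace (twopii * (/ (tau * tau) * euler_phi' sg - euler_phi' tau)) with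
    (/ twopii * (twopii * twopii * (/ (tau * tau) * euler_phi' sg - euler_phi' tau)))
    by (field; split; trivial).
  rewrite E3. field. repeat split; trivial.
Qed.

Lemma Cder_neg_inv (tau : C) : tau <> 0 -> Cder (fun w => - (1) / w) tau (/ (tau * tau)).
Proof.
  intros H. apply Cder_eq with (- (1) * - / (tau * tau)); [ring|].
  apply (Cder_scal (- (1)) Cinv). now apply Cder_inv.
Qed.

(* This is the logarithm of Dedekind's eta function, since [zeta2 = pi^2 / 6]; the value
   of the constant is irrelevant because it cancels in [Ltheta_eta]. *)
Definition eta_log (tau : C) : C := euler_phi tau - zeta2 / twopii * tau.

(** The linear part of [eta_log] is chosen so that its derivative absorbs the [zeta2] terms; only
    the anomaly remains. *)
Lemma Cder_eta_log_inversion tau : upper tau ->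
  Cder (fun w => eta_log (- (1) / w) - eta_log w) tau (/ (2 * tau)).
Proof.
  intros Ht. assert (Ht0 := upper_neq_0 tau Ht). assert (Hs := upper_inv tau Ht).
  assert (Hd : forall w, upper w -> Cder eta_log w (twopii * euler_phi' w - zeta2 / twopii)).
  { intros w Hw. apply (Cder_minus euler_phi (fun w => zeta2 / twopii * w));
      [now apply Cder_euler_phi|apply Cder_linear]. }
  apply Cder_eq with (/ (tau * tau) * (twopii * euler_phi' (- (1) / tau) - zeta2 / twopii)
     - (twopii * euler_phi' tau - zeta2 / twopii)).
  - assert (E := euler_phi'_inversion tau Ht).
    replace (/ (2 * tau)) with (/ (2 * tau) + zeta2 / twopii * (/ (tau * tau) - 1)
      - zeta2 / twopii * (/ (tau * tau) - 1)) by ring.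
    rewrite <- E. ring.
  - apply Cder_minus; [|now apply Hd].
    apply (Cder_comp eta_log (fun w => - (1) / w)); [now apply Hd|now apply Cder_neg_inv].
Qed.

Definition nome (tau : C) : C := Cexp (Ci * RtoC PI * tau).

Definition Ltheta (tau : C) : C := theta_log (nome tau).

Lemma nome_twopii tau : nome tau = Cexp (twopii * (tau / 2)).
Proof. unfold nome, twopii. f_equal. field. Qed.

Lemma nome_pow2 tau : nome tau ^ 2 = Cexp (twopii * tau).
Proof. unfold nome. rewrite <- Cexp_INR. f_equal. unfold twopii. simpl INR. rewrite RtoC_plus. ring. Qed.

Lemma nome_pow4 tau : nome tau ^ 4 = Cexp (twopii * (2 * tau)).
Proof.
  unfold nome. rewrite <- Cexp_INR. f_equal. unfold twopii. simpl INR. rewrite !RtoC_plus. ring.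
Qed.

Lemma upper_half tau : upper tau -> upper (tau / 2).
Proof.
  intros H. replace (tau / 2) with (RtoC (/ 2) * tau) by (rewrite RtoC_inv by lra; field).
  apply upper_scal; trivial. lra.
Qed.

Lemma upper_nome tau : upper tau -> unit_disc (nome tau).
Proof. intros H. rewrite nome_twopii. apply upper_Cexp. now apply upper_half. Qed.

(** The eta quotient eta(tau)^5 / (eta(tau/2)^2 eta(2 tau)^2); the linear terms enter with total
    weight 5 - 1 - 4 = 0. *)
Lemma Ltheta_eta tau : Ltheta tau = 5 * eta_log tau - 2 * eta_log (tau / 2) - 2 * eta_log (2 * tau).
Proof.
  unfold Ltheta, theta_log, eta_log, euler_phi. rewrite nome_pow2, nome_pow4, <- nome_twopii.
  set (c := zeta2 / twopii). field.
Qed.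

(** Inversion exchanges the arguments tau / 2 and 2 tau, so only [Lam] at w, 2 w and w / 2 occurs.
    Each of the three has derivative 1 / (2 w), and the weights 5 - 2 - 2 = 1 with the outer factor
    2 leave 1 / w. *)
Lemma Cder_Ltheta_inversion tau : upper tau ->
  Cder (fun w => 2 * (Ltheta (- (1) / w) - Ltheta w)) tau (/ tau).
Proof.
  intros Ht. assert (Ht0 := upper_neq_0 tau Ht).
  set (Lam := fun w => eta_log (- (1) / w) - eta_log w).
  assert (HL : forall w, upper w -> Cder Lam w (/ (2 * w))) by (intros; now apply Cder_eta_log_inversion).
  apply Cder_ext_loc with (fun w => 2 * (5 * Lam w - 2 * Lam (2 * w) - 2 * Lam (/ 2 * w))) (Im tau); trivial.
  - intros w Hw. assert (w <> 0).
    { apply upper_neq_0. now apply upper_ball with tau. }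
    rewrite !Ltheta_eta. unfold Lam.
    replace (- (1) / w / 2) with (- (1) / (2 * w)) by (field; trivial).
    replace (2 * (- (1) / w)) with (- (1) / (/ 2 * w)) by (field; trivial).
    replace (w / 2) with (/ 2 * w) by (unfold Cdiv; ring). ring.
  - apply Cder_eq with (2 * (5 * / (2 * tau) - 2 * (2 * / (2 * (2 * tau))) - 2 * (/ 2 * / (2 * (/ 2 * tau))))).
    + field. repeat split; trivial.
    + apply Cder_scal. apply Cder_minus; [apply Cder_minus|]; apply Cder_scal.
      * now apply HL.
      * apply (Cder_comp Lam (fun w => 2 * w)); [|apply Cder_linear].
        apply HL. apply upper_scal; trivial. lra.
      * apply (Cder_comp Lam (fun w => / 2 * w)); [|apply Cder_linear].
        apply HL. replace (/ 2 * tau) with (tau / 2) by (unfold Cdiv; ring). now apply upper_half.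
Qed.

(** * From the derivative to the logarithm: constant and branch *)

Lemma upper_Ci : upper Ci.
Proof. unfold upper. simpl. lra. Qed.

(** Cexp (M w) / w has derivative 0, and M vanishes at i, the fixed point of the inversion.
    Comparing exponentials avoids differentiating [Clog]. *)
Lemma Cexp_Ltheta_inversion tau : upper tau ->
  Cexp (2 * (Ltheta (- (1) / tau) - Ltheta tau)) = tau / Ci.
Proof.
  intros Ht. set (M := fun w => 2 * (Ltheta (- (1) / w) - Ltheta w)).
  assert (E : Cexp (M tau) * / tau = Cexp (M Ci) * / Ci).
  { apply (Cder_zero_const upper (fun w => Cexp (M w) * / w)); trivial.
    - apply convex_upper.
    - intros w Hw. assert (Hw0 := upper_neq_0 w Hw).
      apply Cder_eq with (/ w * Cexp (M w) * / w + Cexp (M w) * - / (w * w)); [field; trivial|].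
      apply (Cder_mult (fun w => Cexp (M w)) Cinv); [|now apply Cder_inv].
      apply Cder_Cexp_comp. now apply Cder_Ltheta_inversion.
    - apply upper_Ci. }
  assert (EM : M Ci = 0).
  { unfold M. replace (- (1) / Ci) with Ci; [ring|].
    replace (- (1)) with (Ci * Ci) by (apply C_ext; simpl; ring). field. apply Ci_nz. }
  rewrite EM, Cexp_0 in E. assert (Ht0 := upper_neq_0 tau Ht).
  fold (M tau). replace (Cexp (M tau)) with (Cexp (M tau) * / tau * tau) by (field; trivial).
  rewrite E. field. apply Ci_nz.
Qed.

(** A continuous path that starts at 0 and never meets a zero of the cosine cannot reach PI / 2. *)
Lemma cos_pos_interval (g : R -> R) :
  (forall t, (0 <= t <= 1)%R -> continuity_pt g t) -> g 0%R = 0%R ->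
  (forall t, (0 <= t <= 1)%R -> (0 < cos (g t))%R) -> (g 1 < PI / 2)%R.
Proof.
  intros Hc H0 Hp. apply Rnot_le_lt. intros Hge.
  assert (HPI := PI_RGT_0).
  assert (H1 := Hp 1%R ltac:(lra)).
  destruct (Ranalysis5.IVT_interv (fun t => g t - PI / 2)%R 0 1) as [t [Ht Hg]].
  - intros t Ht. apply continuity_pt_minus; [now apply Hc|apply continuity_pt_const; easy].
  - lra.
  - rewrite H0. lra.
  - destruct Hge as [Hge|Hge]; [lra|]. rewrite <- Hge, cos_PI2 in H1. lra.
  - specialize (Hp t Ht). replace (g t) with (PI / 2)%R in Hp by lra. rewrite cos_PI2 in Hp. lra.
Qed.

Lemma Clog_Cexp z : (Rabs (Im z) < PI / 2)%R -> Clog (Cexp z) = z.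
Proof.
  intros Hz. apply Rabs_lt_between in Hz. assert (HPI := PI_RGT_0).
  assert (He := exp_pos (Re z)).
  unfold Clog. rewrite Cmod_Cexp, ln_exp. apply C_ext; simpl; [reflexivity|].
  unfold Carg. rewrite Cmod_Cexp.
  change (Re (Cexp z)) with (exp (Re z) * cos (Im z))%R.
  change (Im (Cexp z)) with (exp (Re z) * sin (Im z))%R.
  replace (exp (Re z) * cos (Im z) / exp (Re z))%R with (cos (Im z)) by (field; lra).
  destruct (Rle_dec 0 (exp (Re z) * sin (Im z))) as [H|H].
  - rewrite acos_cos; [reflexivity|]. split; [|lra]. apply Rnot_lt_le. intros Hn.
    assert (sin (Im z) < 0)%R by (apply sin_lt_0_var; lra). nra.
  - rewrite <- cos_neg, acos_cos; [ring|]. split; [|lra].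
    assert (Im z <= 0)%R; [|lra]. apply Rnot_lt_le. intros Hn.
    assert (0 < sin (Im z))%R by (apply sin_gt_0; lra). nra.
Qed.

Lemma Re_div_Ci tau : Re (tau / Ci) = Im tau.
Proof. simpl. unfold Im. field. Qed.

(** Only the branch is left to fix. On the segment from i to tau the real part of w / i is positive,
    hence so is cos (Im M). As Im M starts at 0, it stays between - PI / 2 and PI / 2, where [Clog]
    inverts [Cexp]. *)
Lemma Ltheta_inversion tau : upper tau ->
  2 * (Ltheta (- (1) / tau) - Ltheta tau) = Clog (tau / Ci).
Proof.
  intros Ht. set (M := fun w => 2 * (Ltheta (- (1) / w) - Ltheta w)).
  assert (EM : M Ci = 0).
  { unfold M. replace (- (1) / Ci) with Ci; [ring|].
    replace (- (1)) with (Ci * Ci) by (apply C_ext; simpl; ring). field. apply Ci_nz. }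
  set (p := fun t : R => Ci + RtoC t * (tau - Ci)).
  assert (Hp : forall t, (0 <= t <= 1)%R -> upper (p t)).
  { intros t Htt. apply convex_upper; trivial. apply upper_Ci. }
  assert (Hcos : forall t, (0 <= t <= 1)%R -> (0 < cos (Im (M (p t))))%R).
  { intros t Htt. assert (E := Cexp_Ltheta_inversion _ (Hp t Htt)). fold (M (p t)) in E.
    apply (f_equal Re) in E. rewrite Re_div_Ci in E.
    change (Re (Cexp (M (p t)))) with (exp (Re (M (p t))) * cos (Im (M (p t))))%R in E.
    assert (Hu := Hp t Htt). unfold upper in Hu. rewrite <- E in Hu.
    assert (He := exp_pos (Re (M (p t)))).
    apply Rmult_lt_reg_l with (exp (Re (M (p t)))); trivial. lra. }
  assert (Hcont : forall t, (0 <= t <= 1)%R -> continuity_pt (fun t => Im (M (p t))) t).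
  { intros t Htt. apply derivable_continuous_pt. eexists.
    apply (proj2 (Cder_line M Ci (tau - Ci) t _ (Cder_Ltheta_inversion _ (Hp t Htt)))). }
  assert (E0 : p 0%R = Ci) by (unfold p; ring).
  assert (E1 : p 1%R = tau) by (unfold p; ring).
  assert (B1 := cos_pos_interval (fun t => Im (M (p t))) Hcont).
  assert (B2 := cos_pos_interval (fun t => - Im (M (p t)))%R).
  cbv beta in B1, B2. rewrite E0, E1, EM, im_RtoC in B1, B2.
  specialize (B1 eq_refl Hcos).
  assert (B3 : (- Im (M tau) < PI / 2)%R).
  { apply B2.
    - intros t Htt. now apply continuity_pt_opp, Hcont.
    - ring.
    - intros t Htt. rewrite cos_neg. now apply Hcos. }
  change (M tau = Clog (tau / Ci)).
  rewrite <- Cexp_Ltheta_inversion by trivial. fold (M tau). symmetry. apply Clog_Cexp.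
  apply Rabs_lt_between. lra.
Qed.

(** * The logarithm of theta00 as a power series in the nome *)

Definition Ltheta_coef (n : nat) : C :=
  (5 * spread 2 euler_log_coef n + - (2) * euler_log_coef n) + - (2) * spread 4 euler_log_coef n.

Lemma radius1_Ltheta : radius1 Ltheta_coef.
Proof.
  assert (H := radius1_euler_log).
  apply radius1_plus; [apply radius1_plus|]; apply radius1_scal; trivial;
    apply radius1_spread; trivial; lia.
Qed.

Lemma Ltheta_coef_0 : Ltheta_coef 0 = 0.
Proof. unfold Ltheta_coef, spread. simpl. ring. Qed.

Lemma PS_Ltheta q : unit_disc q -> PS Ltheta_coef q = theta_log q.
Proof.
  intros Hq. assert (H := radius1_euler_log).
  assert (H2 : radius1 (spread 2 euler_log_coef)) by (apply radius1_spread; trivial; lia).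
  assert (H4 : radius1 (spread 4 euler_log_coef)) by (apply radius1_spread; trivial; lia).
  unfold Ltheta_coef, theta_log, euler_log.
  rewrite (PS_plus (fun n => 5 * spread 2 euler_log_coef n + - (2) * euler_log_coef n)
     (fun n => - (2) * spread 4 euler_log_coef n)), PS_plus, !PS_scal, !PS_spread;
    trivial; try lia; try ring; repeat apply radius1_plus; try apply radius1_scal; trivial.
Qed.

Lemma Cder_Ltheta tau : upper tau -> exists l, Cder Ltheta tau l.
Proof.
  intros Ht. exists (Ci * RtoC PI * nome tau * PS (dcoef Ltheta_coef) (nome tau)).
  apply Cder_ext_loc with (fun w => PS Ltheta_coef (nome w)) (Im tau); trivial.
  - intros w Hw. apply PS_Ltheta, upper_nome. now apply upper_ball with tau.
  - apply (Cder_comp (PS Ltheta_coef) nome).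
    + apply Cder_PS; [apply radius1_Ltheta|now apply upper_nome].
    + apply (Cder_Cexp_comp (fun w => Ci * RtoC PI * w)). apply Cder_linear.
Qed.

Lemma theta00_nome tau : upper tau ->
  theta00 tau = Cexp (Ltheta tau) /\ csums (fun j => nome tau ^ (j * j)) ((1 + theta00 tau) / 2).
Proof.
  intros Ht. assert (H := theta_product (nome tau) (upper_nome tau Ht)). fold (Ltheta tau) in H.
  assert (E : theta00 tau = Cexp (Ltheta tau)); [|now rewrite E].
  assert (HT : forall k n, IZR k = INR n \/ IZR k = (- INR n)%R ->
     Cexp (Ci * RtoC PI * RtoC (IZR k) ^ 2 * tau) = nome tau ^ (n * n)).
  { intros k n Hk. unfold nome. rewrite <- Cexp_INR. f_equal. rewrite mult_INR, RtoC_mult.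
    destruct Hk as [-> | ->]; rewrite ?RtoC_opp; ring. }
  unfold theta00, CSeriesZ.
  rewrite (CSeries_ext (fun n => Cexp (Ci * RtoC PI * RtoC (IZR (Z.of_nat n)) ^ 2 * tau)) (fun j => nome tau ^ (j * j))).
  2:{ intros n. apply HT. left. symmetry. apply INR_IZR_INZ. }
  rewrite (CSeries_ext (fun n => Cexp (Ci * RtoC PI * RtoC (IZR (- Z.of_nat (S n))) ^ 2 * tau)) (fun j => nome tau ^ (S j * S j))).
  2:{ intros n. apply HT. right. rewrite opp_IZR. now rewrite <- INR_IZR_INZ. }
  rewrite (csums_CSeries _ _ H).
  rewrite (csums_CSeries (fun j => nome tau ^ (S j * S j)) ((1 + Cexp (Ltheta tau)) / 2 - 1)).
  - field.
  - apply (csums_S (fun j => nome tau ^ (j * j))).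
    replace (nome tau ^ (0 * 0) + ((1 + Cexp (Ltheta tau)) / 2 - 1)) with ((1 + Cexp (Ltheta tau)) / 2); trivial.
    simpl. ring.
Qed.

Lemma csum_real (u : nat -> C) n : (forall k, Im (u k) = 0%R) -> Im (csum u n) = 0%R.
Proof. intros H. induction n; simpl; trivial. change (Im (csum u n) + Im (u n) = 0)%R. rewrite IHn, H. ring. Qed.

Lemma csums_real (u : nat -> C) l : csums u l -> (forall k, Im (u k) = 0%R) -> Im l = 0%R.
Proof.
  intros [_ H2] H. apply is_lim_seq_unique in H2.
  rewrite (Lim_seq_ext _ (fun _ => 0%R)), Lim_seq_const in H2.
  - now injection H2.
  - intros n. now apply csum_real.
Qed.

Lemma Im_real_mult z w : Im z = 0%R -> Im w = 0%R -> Im (z * w) = 0%R.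
Proof. intros H1 H2. rewrite Im_mult, H1, H2. ring. Qed.

Lemma real_RtoC z : Im z = 0%R -> z = RtoC (Re z).
Proof. intros H. apply C_ext; simpl; trivial. Qed.

Lemma euler_log_coef_real n : Im (euler_log_coef n) = 0%R.
Proof.
  destruct n; [reflexivity|]. unfold euler_log_coef.
  assert (H : Im (sigma (S n)) = 0%R).
  { apply csum_real. intros k. destruct (_ =? _)%nat; reflexivity. }
  rewrite (real_RtoC _ H), <- RtoC_opp, <- RtoC_div by (apply not_0_INR; lia). reflexivity.
Qed.

Lemma euler_log_real (r : R) : unit_disc (RtoC r) -> Im (euler_log (RtoC r)) = 0%R.
Proof.
  intros Hr. apply (csums_real _ _ (PS_csums _ _ radius1_euler_log Hr)).
  intros k. apply Im_real_mult; [apply euler_log_coef_real|]. rewrite <- RtoC_pow. reflexivity.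
Qed.

Lemma nome_axis (y : R) : nome (Ci * RtoC y) = RtoC (exp (- (PI * y))).
Proof.
  unfold nome. rewrite <- Cexp_R. f_equal. rewrite RtoC_opp, RtoC_mult.
  replace (Ci * RtoC PI * (Ci * RtoC y)) with (Ci * Ci * (RtoC PI * RtoC y)) by ring.
  replace (Ci * Ci) with (- (1)) by (apply C_ext; simpl; ring). ring.
Qed.

Lemma upper_axis (y : R) : (0 < y)%R -> upper (Ci * RtoC y).
Proof. intros Hy. unfold upper. simpl. lra. Qed.

Lemma Im_Ltheta_axis (y : R) : (0 < y)%R -> Im (Ltheta (Ci * RtoC y)) = 0%R.
Proof.
  intros Hy. assert (Hq := upper_nome _ (upper_axis y Hy)).
  unfold Ltheta, theta_log. rewrite nome_axis in *.
  rewrite <- !RtoC_pow.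
  assert (H2 : unit_disc (RtoC (exp (- (PI * y)) ^ 2))) by (rewrite RtoC_pow; apply unit_disc_pow; trivial; lia).
  assert (H4 : unit_disc (RtoC (exp (- (PI * y)) ^ 4))) by (rewrite RtoC_pow; apply unit_disc_pow; trivial; lia).
  rewrite !Im_minus, !im_scal_l, !euler_log_real by trivial. ring.
Qed.

Lemma Re_Ltheta_axis (y : R) : (0 < y)%R -> (0 < Re (Ltheta (Ci * RtoC y)))%R.
Proof.
  intros Hy. assert (Hu := upper_axis y Hy).
  destruct (theta00_nome _ Hu) as [H1 [H2 _]].
  assert (Hi := Im_Ltheta_axis y Hy).
  set (l := Ltheta (Ci * RtoC y)) in *. set (r := exp (- (PI * y))).
  assert (Hr : (0 < r)%R) by apply exp_pos.
  rewrite H1 in H2. rewrite (real_RtoC l Hi), Cexp_R in H2.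
  replace (Re ((1 + RtoC (exp (Re l))) / 2)) with ((1 + exp (Re l)) / 2)%R in H2.
  2:{ unfold Cdiv. rewrite <- RtoC_inv, <- RtoC_plus, <- RtoC_mult, re_RtoC by lra. reflexivity. }
  (* Two terms of a series with nonnegative terms already give (1 + theta00) / 2 >= 1 + r, so
     theta00 >= 1 + 2 r > 1. *)
  assert (Hge : (1 + r <= (1 + exp (Re l)) / 2)%R).
  { refine (is_lim_seq_le_loc (fun _ => (1 + r)%R) _ (Finite _) (Finite _) _ (is_lim_seq_const _) H2).
    exists 2%nat. intros n Hn. rewrite csum_Re, nome_axis. fold r.
    assert (Hpos : forall k, (0 <= Re (RtoC r ^ (k * k)))%R).
    { intros k. rewrite <- RtoC_pow, re_RtoC. apply pow_le. lra. }
    apply Rle_trans with (2 := rsum_mono _ 2 n Hpos Hn). simpl. lra. }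
  apply exp_lt_inv. rewrite exp_0. lra.
Qed.

Lemma is_log_theta00_Ltheta : is_log_theta00 Ltheta.
Proof.
  split; [|split].
  - intros tau Ht. destruct (Cder_Ltheta tau Ht) as [l Hl]. now exists l.
  - intros tau Ht. symmetry. now apply theta00_nome.
  - intros y Hy. split; [now apply Im_Ltheta_axis|now apply Re_Ltheta_axis].
Qed.

(** As a value of [epsilon], [log_theta00] is known only through its defining conditions, which
    [Ltheta] shows to be satisfiable. Equal exponentials force equal derivatives, and at i both
    functions are real, where exp is injective. *)
Lemma log_theta00_eq tau : upper tau -> log_theta00 tau = Ltheta tau.
Proof.
  intros Ht.
  assert (HL : is_log_theta00 log_theta00).
  { exact (epsilon_spec _ _ (ex_intro _ Ltheta is_log_theta00_Ltheta)). }
  destruct HL as (Hh & He & Ha).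
  assert (E : log_theta00 tau - Ltheta tau = log_theta00 (Ci * RtoC 1) - Ltheta (Ci * RtoC 1)).
  { apply (Cder_zero_const upper (fun w => log_theta00 w - Ltheta w)); trivial.
    - apply convex_upper.
    - intros w Hw. destruct (Hh w Hw) as [l Hl]. fold (Cder log_theta00 w l) in Hl.
      destruct (Cder_Ltheta w Hw) as [m Hm].
      assert (D1 := Cder_Cexp_comp _ _ _ Hl). assert (D2 := Cder_Cexp_comp _ _ _ Hm).
      assert (D3 : Cder (fun w => Cexp (log_theta00 w)) w (m * Cexp (Ltheta w))).
      { apply Cder_ext_loc with (fun w => Cexp (Ltheta w)) (Im w); trivial. intros v Hv.
        assert (Hvu := upper_ball w v Hw Hv).
        rewrite He by trivial. symmetry. now apply theta00_nome. }
      assert (Elm := Cder_unique _ _ _ _ D1 D3).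
      rewrite He, (proj1 (theta00_nome w Hw)) in Elm by trivial.
      apply Cder_eq with (l - m).
      + assert (Hn := Cexp_neq_0 (Ltheta w)).
        replace l with (l * Cexp (Ltheta w) / Cexp (Ltheta w)) by (field; trivial).
        rewrite Elm. field. trivial.
      + now apply Cder_minus.
    - apply upper_axis. lra. }
  destruct (Ha 1%R Rlt_0_1) as [I1 _]. assert (I2 := Im_Ltheta_axis 1 Rlt_0_1).
  assert (Ee : Cexp (log_theta00 (Ci * RtoC 1)) = Cexp (Ltheta (Ci * RtoC 1))).
  { rewrite He by (apply upper_axis; lra). apply theta00_nome. apply upper_axis; lra. }
  set (l0 := log_theta00 (Ci * RtoC 1)) in *. set (l1 := Ltheta (Ci * RtoC 1)) in *.
  assert (El : l0 = l1).
  { rewrite (real_RtoC l0 I1), (real_RtoC l1 I2) in Ee |- *. rewrite !Cexp_R in Ee.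
    f_equal. apply exp_inv. now injection Ee. }
  rewrite El in E. replace (log_theta00 tau) with (log_theta00 tau - Ltheta tau + Ltheta tau) by ring.
  rewrite E. ring.
Qed.

(** * Twisting Fourier coefficients by powers of theta00 *)

(** The entry 0, vacant in a Fourier coefficient sequence, receives the constant term, so that a
    whole expansion becomes one power series in the nome. *)
Definition with0 (s : C) (c : nat -> C) (n : nat) : C := match n with O => s | S _ => c n end.

Lemma fourier_term_nome c tau n : fourier_term c tau n = c (S n) * nome tau ^ S n.
Proof.
  unfold fourier_term, nome. f_equal. rewrite <- Cexp_INR. f_equal. ring.
Qed.

Lemma fourier_PS c tau : radius1 c -> upper tau ->
  csums (fourier_term c tau) (PS c (nome tau) - c O).
Proof.
  intros Hc Ht. apply csums_ext with (fun n => c (S n) * nome tau ^ S n).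
  - intros n. symmetry. apply fourier_term_nome.
  - apply (csums_S (fun n => c n * nome tau ^ n)).
    replace (c O * nome tau ^ 0 + (PS c (nome tau) - c O)) with (PS c (nome tau)) by (simpl; ring).
    apply PS_csums; trivial. now apply upper_nome.
Qed.

Lemma fourier_cvg_radius1 c : radius1 c -> fourier_cvg c.
Proof.
  intros Hc tau Ht. exists (PS c (nome tau) - c O). apply is_series_csums. now apply fourier_PS.
Qed.

Lemma fourier_sum_PS c tau : radius1 c -> upper tau -> fourier_sum c tau = PS c (nome tau) - c O.
Proof. intros. now apply csums_CSeries, fourier_PS. Qed.

(** Convergence at the single point i y with exp (- PI y) = r bounds the terms on the circle of
    radius [r]. *)
Lemma radius1_with0 s c : fourier_cvg c -> radius1 (with0 s c).
Proof.
  intros Hc r Hr. assert (HPI := PI_RGT_0). set (y := (- ln r / PI)%R).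
  assert (Hy : (0 < y)%R).
  { apply Rdiv_lt_0_compat; trivial. assert (ln r < ln 1)%R by (apply ln_increasing; lra).
    rewrite ln_1 in H. lra. }
  destruct (Hc _ (upper_axis y Hy)) as [l Hl]. apply is_series_csums, csums_term_0 in Hl.
  destruct (Clim_bounded _ _ Hl) as [B HB].
  exists (Rmax (Cmod s) B). intros [|n].
  - simpl. rewrite Rmult_1_r. apply Rmax_l.
  - apply Rle_trans with (2 := Rmax_r (Cmod s) B). eapply Rle_trans; [|apply (HB n)].
    rewrite fourier_term_nome, nome_axis, Cmod_mult, Cmod_pow, Cmod_R, Rabs_pos_eq by (left; apply exp_pos).
    replace (- (PI * y))%R with (ln r) by (unfold y; field; lra).
    rewrite exp_ln by lra. apply Rle_refl.
Qed.

Lemma subexponential_with0 s c : subexponential (with0 s c) -> subexponential c.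
Proof.
  intros H eps He. destruct (H eps He) as (K & N & HN). exists K, (S N).
  intros n Hn. destruct n; [lia|]. apply (HN (S n)). lia.
Qed.

Lemma fourier_cvg_subexponential c : fourier_cvg c -> subexponential c.
Proof.
  intros H. apply subexponential_with0 with (RtoC 0). now apply radius1_subexponential, radius1_with0.
Qed.

(* Fourier coefficients of [theta00 ^ gamma * (s + fourier_sum c) - s]. *)
Definition theta_twist (gamma s : C) (c : nat -> C) : nat -> C :=
  conv (exp_coef gamma Ltheta_coef) (with0 s c).

Lemma radius1_theta_twist gamma s c : fourier_cvg c -> radius1 (theta_twist gamma s c).
Proof.
  intros H. apply radius1_conv; [apply radius1_exp_coef, radius1_Ltheta|now apply radius1_with0].
Qed.

(** The series of theta00^gamma starts with 1, so the entry 0 of the twist is again [s], and the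
    constant of the expansion survives the multiplication. *)
Lemma fourier_sum_theta_twist gamma s c tau : fourier_cvg c -> upper tau ->
  fourier_sum (theta_twist gamma s c) tau = theta00_pow gamma tau * (s + fourier_sum c tau) - s.
Proof.
  intros H Ht. assert (Hq := upper_nome tau Ht). assert (Hc := radius1_with0 s c H).
  rewrite fourier_sum_PS by (trivial; now apply radius1_theta_twist).
  unfold theta_twist. rewrite PS_conv; trivial; [|apply radius1_exp_coef, radius1_Ltheta].
  rewrite PS_exp_coef; trivial; [|apply radius1_Ltheta|apply Ltheta_coef_0].
  unfold theta00_pow. rewrite log_theta00_eq, PS_Ltheta by trivial.
  change (fourier_sum c tau) with (fourier_sum (with0 s c) tau).
  rewrite (fourier_sum_PS (with0 s c)) by trivial.
  unfold Ltheta. replace (conv (exp_coef gamma Ltheta_coef) (with0 s c) O) with s.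
  - simpl (with0 s c O). ring.
  - unfold conv, exp_coef. simpl. ring.
Qed.

Lemma theta00_pow_opp gamma tau : theta00_pow (- gamma) tau * theta00_pow gamma tau = 1.
Proof.
  unfold theta00_pow. rewrite <- Cexp_add, <- Cexp_0. f_equal. ring.
Qed.

(** This is [Ltheta_inversion] times [beta]: an identity between logarithms survives a real
    exponent, and the skew factor cancels the automorphy factor exactly. *)
Lemma theta00_pow_inversion beta tau : upper tau ->
  Cpower (tau / Ci) (RtoC (- beta)) * theta00_pow (RtoC (2 * beta)) (- (1) / tau) =
  theta00_pow (RtoC (2 * beta)) tau.
Proof.
  intros Ht. unfold Cpower, theta00_pow. rewrite <- Cexp_add. f_equal.
  rewrite !log_theta00_eq by (trivial; now apply upper_inv).
  rewrite <- Ltheta_inversion by trivial. rewrite RtoC_opp, RtoC_mult. ring.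
Qed.

Theorem proposition3p9p1
  (beta : R) (f g : C -> C)
  (hf : holomorphic_upper f) (hg : holomorphic_upper g)
  (hfg : forall tau : C, upper tau ->
     g tau = (theta00_pow (RtoC (- (2 * beta))) tau * f tau)%C) :
  (forall (ta0 : C) (ta tb : nat -> C),
     hyperbolic_expansion g ta0 ta tb ->
     exists (a0 : C) (a b : nat -> C),
       power_skewed_expansion beta f a0 a b /\
       subexponential a /\ subexponential b /\
       subexponential ta /\ subexponential tb /\
       expansions_related beta a0 a b ta0 ta tb) /\
  (forall (a0 : C) (a b : nat -> C),
     power_skewed_expansion beta f a0 a b ->
     exists (ta0 : C) (ta tb : nat -> C),
       hyperbolic_expansion g ta0 ta tb /\
       subexponential a /\ subexponential b /\
       subexponential ta /\ subexponential tb /\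
       expansions_related beta a0 a b ta0 ta tb).
Proof.
  set (G := RtoC (2 * beta)).
  assert (HG : RtoC (- (2 * beta)) = - G) by apply RtoC_opp.
  rewrite HG in hfg.
  assert (Hinv : forall tau, theta00_pow (- G) tau * theta00_pow G tau = 1) by apply theta00_pow_opp.
  assert (Hskew : forall tau, upper tau ->
    Cpower (tau / Ci) (RtoC (- beta)) * theta00_pow G (- (1) / tau) = theta00_pow G tau)
    by apply theta00_pow_inversion.
  split.
  - intros ta0 ta tb (Hta & Htb & Hexp).
    assert (Ra := radius1_theta_twist G ta0 ta Hta). assert (Rb := radius1_theta_twist G 0 tb Htb).
    assert (Sa := fun tau => fourier_sum_theta_twist G ta0 ta tau Hta).
    assert (Sb := fun tau => fourier_sum_theta_twist G 0 tb tau Htb).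
    (* The constant goes entirely with the first sequence; twisting the second one with 0 leaves no
       constant beside the skew factor. *)
    exists ta0, (theta_twist G ta0 ta), (theta_twist G 0 tb).
    repeat split; try (now apply fourier_cvg_radius1); try (now apply radius1_subexponential);
      try (now apply fourier_cvg_subexponential).
    + intros tau Ht. assert (Hs := upper_inv tau Ht). rewrite Sa, Sb by trivial.
      assert (Hf : f tau = theta00_pow G tau * g tau).
      { rewrite hfg by trivial. rewrite Cmult_assoc, (Cmult_comm (theta00_pow G tau)), Hinv. ring. }
      rewrite Hf, Hexp by trivial.
      set (T := theta00_pow G tau) in *.
      replace (Cpower (tau / Ci) (RtoC (- beta)) * (theta00_pow G (- (1) / tau) * (0 + fourier_sum tb (- (1) / tau)) - 0))
        with (Cpower (tau / Ci) (RtoC (- beta)) * theta00_pow G (- (1) / tau) * fourier_sum tb (- (1) / tau)) by ring.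
      rewrite Hskew by trivial. fold T. ring.
    + intros tau Ht. rewrite Sa by trivial. fold G. ring.
    + intros tau Ht. rewrite Sb by trivial. fold G. ring.
  - intros a0 a b (Ha & Hb & Hexp).
    assert (Ra := radius1_theta_twist (- G) a0 a Ha). assert (Rb := radius1_theta_twist (- G) 0 b Hb).
    assert (Sa := fun tau => fourier_sum_theta_twist (- G) a0 a tau Ha).
    assert (Sb := fun tau => fourier_sum_theta_twist (- G) 0 b tau Hb).
    exists a0, (theta_twist (- G) a0 a), (theta_twist (- G) 0 b).
    repeat split; try (now apply fourier_cvg_radius1); try (now apply radius1_subexponential);
      try (now apply fourier_cvg_subexponential).
    + intros tau Ht. assert (Hs := upper_inv tau Ht). rewrite Sa, Sb by trivial.
      rewrite hfg, Hexp by trivial.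
      assert (Hk := Hskew tau Ht).
      set (p := Cpower (tau / Ci) (RtoC (- beta))) in *. set (s := - (1) / tau) in *.
      (* [Hskew] for the opposite exponent, obtained by cancelling with [Hinv] at tau and at -1 /
         tau. *)
      assert (E : theta00_pow (- G) tau * p = theta00_pow (- G) s).
      { replace (theta00_pow (- G) tau * p) with
          (theta00_pow (- G) tau * (p * theta00_pow G s) * theta00_pow (- G) s
            + theta00_pow (- G) tau * p * (1 - theta00_pow (- G) s * theta00_pow G s)) by ring.
        rewrite Hk, !Hinv. ring. }
      rewrite <- E. ring.
    + intros tau Ht. rewrite Sa by trivial. fold G.
      replace ((theta00_pow G tau - 1) * a0 + theta00_pow G tau * (theta00_pow (- G) tau * (a0 + fourier_sum a tau) - a0))
        with (theta00_pow (- G) tau * theta00_pow G tau * (a0 + fourier_sum a tau) - a0) by ring.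
      rewrite Hinv. ring.
    + intros tau Ht. rewrite Sb by trivial. fold G.
      replace (theta00_pow G tau * (theta00_pow (- G) tau * (0 + fourier_sum b tau) - 0))
        with (theta00_pow (- G) tau * theta00_pow G tau * fourier_sum b tau) by ring.
      rewrite Hinv. ring.
Qed.
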